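(* There is an injective, affine and $H$-equivariant CLF-map $$j:\ \mathfrak{B}^1(H)\to\mathfrak{B}^1(G)$$ whose image, in terms of lattice functions, is the set of self-dual $o_E$-$o_D$-lattice functions in $V$.
   Context: **Basic setting.** $k$ is a non-Archimedean local field of odd residue characteristic; $D$ is a division algebra with centre $k$ and finite index $d$; $\nu$ is the valuation on $k$ with $\nu(k^\times)=\mathbb{Z}$, extended uniquely to $D$ and to every finite-dimensional division algebra over $k$; $\rho$ is an involution on $D$ (a ring isomorphism $D\to D^{op}$ of order one or two); $k_0$ is the fixed field of $\rho$ in $k$. For a division algebra $D'$ with discrete valuation, $o_{D'}$ and $\mathfrak{p}_{D'}$ are its valuation ring and maximal ideal. $V$ is an $m$-dimensional right $D$-vector space, $\epsilon\in\{1,-1\}$, $h:V\times V\to D$ is a non-degenerate $\epsilon$-hermitian form (biadditive, $h(v_1\lambda_1,v_2\lambda_2)=\epsilon\rho(\lambda_1)\rho(h(v_2,v_1))\lambda_2$), and $\sigma$ is its adjoint involution on $\mathrm{End}_D(V)$. $\mathbf{G}=\mathbf{U}(h)=\mathbf{U}(\sigma)$ is the unitary group over $k_0$, $G=\mathbf{G}(k_0)=\{g\in \mathrm{End}_D(V): \sigma(g)g=1\}$, $\mathfrak{g}=\mathrm{Lie}(\mathbf{G})(k_0)=\{a\in\mathrm{End}_D(V):\sigma(a)=-a\}$. **Lattice functions.** An $o_D$-lattice function in $V$ is a family $(\Lambda(r))_{r\in\mathbb{R}}$ of (full) $o_D$-lattices in $V$ with $\Lambda(r)\supseteq\Lambda(s)$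 for $r<s$, $\Lambda(r)=\bigcap_{t<r}\Lambda(t)$, $\Lambda(r)\mathfrak{p}_D=\Lambda(r+\frac1d)$. $\mathrm{Latt}^1_{o_D}(V)$ is the set of these. $\Lambda$ corresponds to the norm $\alpha_\Lambda(v)=\sup\{t: v\in\Lambda(t)\}$. $\Lambda$ is split by a direct sum decomposition of $V$ into $D$-subspaces $W$ if each $\Lambda(t)$ is the direct sum of the $\Lambda(t)\cap W$. Any two lattice functions are split by a common decomposition into lines $v_iD$; the convex combination $\lambda\Lambda+(1-\lambda)\Lambda'$ ($\lambda\in[0,1]$) is the lattice function split by this decomposition whose norm takes the value $\lambda\alpha_\Lambda(v_i)+(1-\lambda)\alpha_{\Lambda'}(v_i)$ at $v_i$ (independent of choices); this is the affine structure. The dual of $\Lambda$ is $\Lambda^{\#}(t)=\{v\in V: h(v,\Lambda(s))\subseteq\mathfrak{p}_D\text{ for all }s>-t\}$; $\mathrm{Latt}^1_h(V)$ is the set of self-dual ones ($\Lambda=\Lambda^\#$). $G$ acts by $(g.\Lambda)(t)=g(\Lambda(t))$. The extended Bruhat–Tits building $\mathfrak{B}^1(G)=\mathfrak{B}^1(\mathbf{G},k_0)$ is identified, by the unique affine $G$-equivariant bijection, with $\mathrm{Latt}^1_h(V)$. The square lattice function of $\Lambda$ is $\tilde{\mathfrak{g}}_\Lambda(t)=\{a\in\mathrm{End}_D(V): a\Lambda(s)\subseteq\Lambda(s+t)\ \forall s\in\mathbb{R}\}$; the Lie algebra filtration of $\Lambda\in\mathfrak{B}^1(G)$ is $\mathfrak{g}_\Lambda(t)=\tilde{\mathfrak{g}}_\Lambda(t)\cap\mathfrak{g}$.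 **Centralizer.** $\beta\in\mathfrak{g}$ is such that $E:=k[\beta]\subseteq\mathrm{End}_D(V)$ is a product of fields $E_i$ ($i\in I$) with identity elements $1_i$; $V_i=1_iV$. $\sigma$ acts on $I$ by $\sigma(1_i)=1_{\sigma(i)}$; write $-i=\sigma(i)$; $I_0$ is the fixed point set, and $I\setminus I_0=I_+\sqcup I_-$ with $\sigma(I_+)=I_-$. For $i\in I_0$, $(E_i)_0$ is the set of $\sigma$-fixed points in $E_i$; for $i\in I_+$, $(E_i)_0=E_i$. $H$ is the centralizer of $\beta$ in $G$. For each $i$, fix an $E_i$-algebra isomorphism of $\mathrm{End}_{E_i\otimes_kD}(V_i)$ (the centralizer of $E_i$ in $\mathrm{End}_D(V_i)$) with $\mathrm{End}_{D'_i}(V'_i)$, where $D'_i$ is a division algebra of finite index central over $E_i$ and $V_i'$ a finite-dimensional right $D_i'$-vector space. Put $\mathbf{H}_i=\mathbf{U}(\sigma|_{\mathrm{End}_{D'_i}(V'_i)})$ for $i\in I_0$, $\mathbf{H}_i=\mathbf{GL}_{D'_i}(V'_i)$ for $i\in I_+$, $H_i=\mathbf{H}_i((E_i)_0)$. Canonically $H\cong\prod_{i\in I_0\cup I_+}H_i$, and $\mathfrak{B}^1(H):=\prod_{i\in I_0\cup I_+}\mathfrak{B}^1(\mathbf{H}_i,(E_i)_0)$. Here $\mathfrak{B}^1(\mathbf{H}_i,(E_i)_0)$ is identified (affinely and $H_i$-equivariantly) with $\mathrm{Latt}^1_{o_{D'_i}}(V'_i)$ for $i\in I_+$ and with the self-dual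 elements $\mathrm{Latt}^1_{h_i}(V'_i)$ for $i\in I_0$, where $h_i$ is a fixed signed hermitian form on $V'_i$ with adjoint involution $\sigma|_{\mathrm{End}_{D'_i}(V'_i)}$; lattice functions over $D'_i$ are normalized via the extension of $\nu$, i.e. $\Lambda(r)\pi=\Lambda(r+\nu(\pi))$ for a uniformizer $\pi$ of $D'_i$. The Lie algebra of $H$ is $\mathfrak{h}=\bigoplus_{i\in I_0\cup I_+}\mathfrak{h}_i$, with $\mathfrak{h}_i=\{a\in\mathrm{End}_{E_i\otimes_kD}(V_i):\sigma(a)=-a\}$ for $i\in I_0$ and $\mathfrak{h}_i=\mathrm{End}_{E_i\otimes_kD}(V_i)$ for $i\in I_+$; it embeds in $\mathfrak{g}$ by $(a_i)\mapsto\sum_{i\in I_0}a_i+\sum_{i\in I_+}(a_i-\sigma(a_i))$. For $x=(x_i)\in\mathfrak{B}^1(H)$, $\mathfrak{h}_x(t)=\bigoplus_i\mathfrak{h}_{x_i}(t)$, where $\mathfrak{h}_{x_i}$ is the square lattice function of $x_i$ for $i\in I_+$ and its intersection with $\mathfrak{h}_i$ for $i\in I_0$. **CLF.** A map $f:\mathfrak{B}^1(H)\to\mathfrak{B}^1(G)$ is a CLF-map (compatible with the Lie algebra filtrations) if $\mathfrak{h}_x(t)=\mathfrak{h}\cap\mathfrak{g}_{f(x)}(t)$ (inside $\mathfrak{g}$) for all $x\in\mathfrak{B}^1(H)$, $t\in\mathbb{R}$. **$o_E$-$o_D$-lattice functions.** An $o_E$-$o_D$-lattice function in $V$ is an $o_D$-lattice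 function $\Lambda$ in $V$ split by $(V_i)_{i\in I}$ such that for every $i$ the function $t\mapsto\Lambda(t)\cap V_i$ is an $o_{E_i}$-lattice function in $V_i$ (with normalization by $\nu$: $\mathfrak{p}_{E_i}$ shifts by $1/e(E_i|k)$). *)

(* Defs.v *)
From HB Require Import structures.
From mathcomp Require Import all_boot all_order all_algebra all_field.
From mathcomp Require Import boolp classical_sets functions reals constructive_ereal ereal.

Set Implicit Arguments.
Unset Strict Implicit.
Unset Printing Implicit Defensive.

Import Order.TTheory GRing.Theory Num.Theory.

Local Open Scope classical_set_scope.
Local Open Scope ring_scope.

(* Valuations are written additively, with values in the extended reals and    *)
(* value +oo exactly at 0.                                                     *)
Section Valuation.
Variable R : realType.

Record is_valuation (A : nzRingType) (v : A -> \bar R) : Prop := IsValuation {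
  valuation_gtNy : forall x, (-oo < v x)%E;
  valuation_eqy : forall x, v x = +oo%E <-> x = 0;
  valuationM : forall x y, v (x * y)%R = (v x + v y)%E;
  valuationD : forall x y, (Order.min (v x) (v y) <= v (x + y)%R)%E }.

Definition val_ring (A : nzRingType) (v : A -> \bar R) : set A :=
  [set x | (0 <= v x)%E].

Definition val_ideal (A : nzRingType) (v : A -> \bar R) : set A :=
  [set x | (0 < v x)%E].

Definition is_uniformizer (A : nzRingType) (v : A -> \bar R) (pi : A) : Prop :=
  [/\ (0 < v pi)%E, (v pi < +oo)%E & forall x, (0 < v x)%E -> (v pi <= v x)%E].

(* The value group of v is (1/e)Z; when v extends a valuation with value group *)
(* Z, this says that e is the ramification index.                              *)
Definition is_ramification_index (A : nzRingType) (v : A -> \bar R) (e : nat) :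
    Prop :=
  (0 < e)%N /\
  [set v x | x in [set x | x != 0]] = [set (n%:~R / e%:R)%:E | n in @setT int].

Record is_local_field (k : fieldType) (nu : k -> \bar R) : Prop :=
  IsLocalField {
  local_valuation : is_valuation nu;
  local_value_group :
    [set nu x | x in [set x | x != 0]] = [set (n%:~R)%:E | n in @setT int];
  local_complete : forall u : nat -> k,
    (forall N : nat, exists n0 : nat, forall m n : nat,
      (n0 <= m)%N -> (n0 <= n)%N -> (N%:R%:E <= nu (u m - u n)%R)%E) ->
    exists l : k, forall N : nat, exists n0 : nat, forall n : nat,
      (n0 <= n)%N -> (N%:R%:E <= nu (u n - l)%R)%E;
  local_finite_residue_field : exists s : seq k, forall x : k,
    val_ring nu x -> exists2 y, y \in s & val_ideal nu (x - y) }.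

Definition odd_residue_char (k : fieldType) (nu : k -> \bar R) : Prop :=
  exists p : nat, [/\ prime p, odd p & val_ideal nu p%:R].

(* D is a division algebra with centre F; its dimension over F is finite by    *)
(* definition of falgType.                                                     *)
Definition is_central_division (F : fieldType) (D : falgType F) : Prop :=
  (forall x : D, x != 0 -> x \is a GRing.unit) /\
  (forall z : D, (forall x, z * x = x * z) <-> exists c : F, z = c%:A).

Definition extends_valuation (F : fieldType) (A : falgType F)
    (v : F -> \bar R) (w : A -> \bar R) : Prop :=
  is_valuation w /\ forall c : F, w c%:A = v c.

End Valuation.

(* A right A-module is a left module over the converse ring A^c.               *)
Definition ract (A : nzRingType) (V : lmodType A^c) (a : A) (v : V) : V :=
  (a : A^c) *: v.

Record is_involution (A : nzRingType) (rho : A -> A) : Prop := IsInvolution {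
  involutionD : forall x y, rho (x + y) = rho x + rho y;
  involutionM : forall x y, rho (x * y) = rho y * rho x;
  involutionK : forall x, rho (rho x) = x }.

Record is_nondeg_hermitian (A : nzRingType) (rho : A -> A) (eps : A)
    (V : lmodType A^c) (h : V -> V -> A) : Prop := IsNondegHermitian {
  hermitian_sign : eps = 1 \/ eps = -1;
  hermitianDl : forall v1 v2 w, h (v1 + v2) w = h v1 w + h v2 w;
  hermitianDr : forall v w1 w2, h v (w1 + w2) = h v w1 + h v w2;
  hermitianE : forall v1 v2 l1 l2,
    h (ract l1 v1) (ract l2 v2) = eps * rho l1 * rho (h v2 v1) * l2;
  hermitian_nondeg : forall v, (forall w, h v w = 0) -> v = 0 }.

Definition is_adjoint_involution (A : nzRingType) (V : vectType A^c)
    (h : V -> V -> A) (sigma : 'End(V) -> 'End(V)) : Prop :=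
  forall (a : 'End(V)) v w, h (a v) w = h v (sigma a w).

Section LatticeFunction.
Variable R : realType.

Definition act_span (A : nzRingType) (V : zmodType) (act : A -> V -> V)
    (C : set A) (L : set V) : set V :=
  [set x | exists n (c : 'I_n -> A) (w : 'I_n -> V),
    [/\ forall j, C (c j), forall j, L (w j) & x = \sum_j act (c j) (w j)]].

(* Full lattices in W, over the valuation ring of v: finitely generated         *)
(* submodules spanning W.  The action is a parameter because W is a right       *)
(* D-space in some uses, and the E_i-space V_i, a subset of V, in others.       *)
Definition is_lattice (A : nzRingType) (v : A -> \bar R) (V : zmodType)
    (act : A -> V -> V) (W L : set V) : Prop :=
  exists s : seq V, L = act_span act (val_ring v) [set` s] /\
                    W = act_span act setT [set` s].

(* step is the value of a uniformizer, i.e. the translation induced on the     *)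
(* parameter by the maximal ideal.                                             *)
Record is_lattice_function (A : nzRingType) (v : A -> \bar R) (V : zmodType)
    (act : A -> V -> V) (W : set V) (step : R) (L : R -> set V) : Prop :=
  IsLatticeFunction {
  lattice_function_lattice : forall r, is_lattice v act W (L r);
  lattice_function_anti : forall r s, r < s -> L s `<=` L r;
  lattice_function_left_cont : forall r, L r = \bigcap_(t in [set t | t < r]) L t;
  lattice_function_periodic : forall r,
    act_span act (val_ideal v) (L r) = L (r + step) }.

Definition is_direct_sum (V : zmodType) (J : finType) (W : J -> set V)
    (U : set V) : Prop :=
  U = [set x | exists2 y : J -> V, (forall j, W j (y j)) & x = \sum_j y j] /\
  forall y : J -> V, (forall j, W j (y j)) -> \sum_j y j = 0 ->
    forall j, y j = 0.

Definition split_by (V : zmodType) (J : finType) (W : J -> set V)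
    (L : R -> set V) : Prop :=
  forall t, is_direct_sum (fun j => L t `&` W j) (L t).

Definition lattice_norm (V : zmodType) (L : R -> set V) (v : V) : \bar R :=
  ereal_sup [set t%:E | t in [set t | L t v]].

Definition line (A : nzRingType) (V : lmodType A^c) (v : V) : set V :=
  [set ract a v | a in setT].

(* L is the point lam L1 + (1 - lam) L2 of the affine structure.               *)
Definition is_convex_comb (A : nzRingType) (V : lmodType A^c) (lam : R)
    (L1 L2 L : R -> set V) : Prop :=
  exists n (b : 'I_n -> V), [/\ forall j, b j != 0,
    is_direct_sum (fun j => line (b j)) setT,
    [/\ split_by (fun j => line (b j)) L1, split_by (fun j => line (b j)) L2
      & split_by (fun j => line (b j)) L]
    & forall j, lattice_norm L (b j) =
        (lam%:E * lattice_norm L1 (b j)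
           + (1 - lam)%R%:E * lattice_norm L2 (b j))%E].

Definition dual_lattice_function (A : nzRingType) (v : A -> \bar R)
    (V : lmodType A^c) (h : V -> V -> A) (L : R -> set V) : R -> set V :=
  fun t => [set x | forall s, - t < s -> forall w, L s w ->
                      val_ideal v (h x w)].

Definition square_lattice_function (A : nzRingType) (V : vectType A^c)
    (L : R -> set V) : R -> set 'End(V) :=
  fun t => [set a | forall s, [set a x | x in L s] `<=` L (s + t)].

Definition Latt1 (A : nzRingType) (v : A -> \bar R) (V : lmodType A^c)
    (step : R) : set (R -> set V) :=
  [set L | is_lattice_function v (@ract A V) setT step L].

Definition Latt1_h (A : nzRingType) (v : A -> \bar R) (V : lmodType A^c)
    (h : V -> V -> A) (step : R) : set (R -> set V) :=
  [set L | Latt1 v step L /\ dual_lattice_function v h L = L].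

End LatticeFunction.

Section ClassicalGroup.
Variables (R : realType) (A : nzRingType) (V : vectType A^c).
Variable sigma : 'End(V) -> 'End(V).

Definition unitary_group : set 'End(V) := [set g | (sigma g \o g)%VF = \1%VF].

Definition unitary_lie : set 'End(V) := [set a | sigma a = - a].

Definition lie_filtration (L : R -> set V) (t : R) : set 'End(V) :=
  square_lattice_function L t `&` unitary_lie.

Definition unitary_centralizer (beta : 'End(V)) : set 'End(V) :=
  [set g | unitary_group g /\ (g \o beta = beta \o g)%VF].

End ClassicalGroup.

Section Centralizer.
Variables (R : realType) (k : fieldType) (D : falgType k) (V : vectType D^c).

Definition poly_alg (beta : 'End(V)) : set 'End(V) :=
  [set a | exists p : {poly k}, forall v : V,
    a v = \sum_(i < size p) ract (p`_i)%:A (iter i beta v)].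

Variables (I : finType) (E : I -> fieldExtType k).
Variable iota : forall i, E i -> 'End(V).

(* (x_i) |-> \sum_i iota_i x_i is an isomorphism of k-algebras from the product *)
(* of the fields E_i onto k[beta].                                             *)
Record is_field_product (beta : 'End(V)) : Prop := IsFieldProduct {
  field_productD : forall i (x y : E i), iota (x + y) = iota x + iota y;
  field_productM : forall i (x y : E i), iota (x * y) = (iota x \o iota y)%VF;
  field_productZ : forall i (c : k) (x : E i) v,
    iota (c *: x) v = ract c%:A (iota x v);
  field_product_orth : forall i j (x : E i) (y : E j), i != j ->
    (iota x \o iota y)%VF = 0;
  field_product1 : \sum_i iota (1 : E i) = \1%VF;
  field_product_inj : forall i, injective (@iota i);
  field_product_image :
    poly_alg beta = [set \sum_i iota (x i) | x in @setT (forall i, E i)] }.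

Definition idem (i : I) : 'End(V) := iota (1 : E i).

Definition component (i : I) : set V := [set idem i v | v in setT].

Definition fixed_indices (sI : I -> I) : {set I} := [set i | sI i == i]%SET.

Record is_index_splitting (sI : I -> I) (Ip Im : {set I}) : Prop :=
  IsIndexSplitting {
  index_splittingU : (~: fixed_indices sI = Ip :|: Im)%SET;
  index_splittingI : [disjoint Ip & Im]%B;
  index_splitting_swap : (sI @: Ip)%SET = Im }.

(* o_E-o_D-lattice functions, where e i is the ramification index of E_i over k *)
(* and d the index of D.                                                       *)
Definition is_oE_oD_lattice_function (nuD : D -> \bar R) (d : nat)
    (nuE : forall i, E i -> \bar R) (e : I -> nat) (L : R -> set V) : Prop :=
  [/\ Latt1 nuD d%:R^-1 L,
      split_by component L
    & forall i, is_lattice_function (@nuE i) (fun x v => iota x v) (component i)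
                  (e i)%:R^-1 (fun t => L t `&` component i)].

Variables (D' : forall i, falgType (E i)) (V' : forall i, vectType (D' i)^c).
Variable theta : forall i, 'End(V' i) -> 'End(V).

(* theta_i is an isomorphism of E_i-algebras from End_{D'_i}(V'_i) onto the     *)
(* centralizer of E_i in End_D(V_i), the elements of the latter being extended *)
(* by 0 to V.                                                                  *)
Record is_centralizer_iso : Prop := IsCentralizerIso {
  centralizer_isoD : forall i (a b : 'End(V' i)),
    theta (a + b) = theta a + theta b;
  centralizer_isoM : forall i (a b : 'End(V' i)),
    theta (a \o b)%VF = (theta a \o theta b)%VF;
  centralizer_iso1 : forall i, theta (\1%VF : 'End(V' i)) = idem i;
  centralizer_isoZ : forall i (x : E i) (a b : 'End(V' i)),
    (forall v, b v = ract x%:A (a v)) -> theta b = (iota x \o theta a)%VF;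
  centralizer_iso_inj : forall i, injective (@theta i);
  centralizer_iso_image : forall i,
    [set theta a | a in @setT 'End(V' i)] =
    [set a | [/\ (idem i \o a)%VF = a, (a \o idem i)%VF = a &
                 forall x : E i, (iota x \o a = a \o iota x)%VF]] }.

Variables (sigma : 'End(V) -> 'End(V)) (sI : I -> I) (Ip : {set I}).

Record is_component_form (i : I) (rho' : D' i -> D' i) (eps' : D' i)
    (h' : V' i -> V' i -> D' i) : Prop := IsComponentForm {
  component_form_involution : is_involution rho';
  component_form_hermitian : is_nondeg_hermitian rho' eps' h';
  component_form_adjoint : forall a a' : 'End(V' i),
    theta a' = sigma (theta a) -> forall v w, h' (a v) w = h' v (a' w) }.

Definition HIdx : finType := {i : I | i \in (fixed_indices sI :|: Ip)%SET}.

Section BuildingH.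
Variables (nuD' : forall i, D' i -> \bar R) (varpi : forall i, D' i).
Variable h' : forall i, V' i -> V' i -> D' i.

Definition Latt1_i (i : I) : set (R -> set (V' i)) :=
  if i \in fixed_indices sI
  then Latt1_h (@nuD' i) (@h' i) (fine (nuD' (varpi i)))
  else Latt1 (@nuD' i) (fine (nuD' (varpi i))).

Definition building_H : Type := forall i : HIdx, {L : R -> set (V' (val i)) | Latt1_i L}.

Definition is_convex_comb_H (lam : R) (x y z : building_H) : Prop :=
  forall i : HIdx, is_convex_comb lam (sval (x i)) (sval (y i)) (sval (z i)).

(* y = g x, where the component g_i of g in H_i is its restriction to V_i,       *)
(* transported to V'_i.                                                        *)
Definition is_act_H (g : 'End(V)) (x y : building_H) : Prop :=
  forall i : HIdx, exists2 gi : 'End(V' (val i)),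
    theta gi = (idem (val i) \o g)%VF &
    forall t, sval (y i) t = [set gi v | v in sval (x i) t].

Definition lie_Hi (i : I) : set 'End(V' i) :=
  if i \in fixed_indices sI
  then [set a | sigma (theta a) = - theta a] else setT.

Definition lie_H_embed (a : forall i : HIdx, 'End(V' (val i))) : 'End(V) :=
  \sum_(i : HIdx) if val i \in fixed_indices sI then theta (a i)
                  else theta (a i) - sigma (theta (a i)).

Definition lie_H : set 'End(V) :=
  [set lie_H_embed a | a in [set a | forall i, @lie_Hi (val i) (a i)]].

Definition lie_H_filtration (x : building_H) (t : R) : set 'End(V) :=
  [set lie_H_embed a | a in [set a | forall i,
    (square_lattice_function (sval (x i)) t `&` @lie_Hi (val i)) (a i)]].

End BuildingH.

End Centralizer.

Section Building.
Variables (R : realType) (A : nzRingType) (v : A -> \bar R) (V : vectType A^c).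
Variables (h : V -> V -> A) (step : R).

Definition building_G : Type := {L : R -> set V | Latt1_h v h step L}.

Definition is_act_G (g : 'End(V)) (x y : building_G) : Prop :=
  forall t, sval y t = [set g w | w in sval x t].

End Building.

(* Main.v *)
(* Over a complete discretely valued division ring every norm (every lattice      *)
(* function) has an orthogonal basis.  Let S be the simple module of E_i (x) D,   *)
(* on which D'_i acts on the left, so that V_i = S (x) V'_i over D'_i.  S carries *)
(* a norm compatible with D and D'_i.  For this norm, and for any norm on V_i     *)
(* compatible with E_i and D, the operator norm on E_i (x) D is the tensor        *)
(* product norm, because the homogeneous centre of the graded ring of D is that   *)
(* of k.  Hence the matrix units of S over D'_i, which come from E_i (x) D, have  *)
(* the same norm on S and on V_i, and L' |-> S (x) L' is a bijection from the     *)
(* norms on V'_i onto the norms on V_i compatible with E_i and D.  For i in I_0,  *)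
(* duality commutes with it up to a translation, which is absorbed in the origin  *)
(* of the norm of S.  The map j is the sum of these bijections over I_0 and I_+,  *)
(* and of the duals of the latter over I_-.                                       *)

Require Import Defs.
From HB Require Import structures.
From mathcomp Require Import all_boot all_order all_algebra all_field fingroup cyclic.
From mathcomp Require Import boolp classical_sets functions reals constructive_ereal ereal.
From mathcomp Require Import ring lra zify.

Set Implicit Arguments.
Unset Strict Implicit.
Unset Printing Implicit Defensive.

Import Order.TTheory GRing.Theory Num.Theory VectorInternalTheory.

Local Open Scope classical_set_scope.
Local Open Scope ring_scope.

(** A lattice function is a norm: L(t) consists of the vectors of value at least t
    ([lattice_functionP]). Over a complete discretely valued division ring every norm has an
    orthogonal basis ([orth_basis_exists]), found by Gram-Schmidt with best approximations, so norms
    can be handled through coordinates.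

    The heart is a statement about one index i. Let S be the simple module of E_i (x) D, so that V_i
    is S (x) V'_i over D'_i, and fix on S a norm compatible with D'_i and D, with an orthogonal
    D'_i-basis s_a of values c_a. A norm X on V'_i gives on V_i the norm with value min_a (c_a +
    X(u_a)) at sum_a s_a (x) u_a ([transfer]), which is compatible with E_i and D. Conversely, on
    any norm of V_i compatible with E_i and D the matrix units of S over D'_i satisfy the same
    bounds as on S ([matrix_unit_norm]), so the norm is determined by its restriction to s_0 (x)
    V'_i and [transfer] is bijective ([component_structure]).

    The bound holds because a matrix unit is an element sum_l b_l (x) f_l of E_i (x) D
    ([endo_tensor]) and a bound for this operator on S bounds each coefficient ([tensor_norm]). In a
    counterexample, commuting with D and induction on the number of leading terms make the leading
    coefficients central in the graded ring of D. The homogeneous centre of that ring comes from k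
    ([graded_centre]), so the leading part lies in E_i, whose elements shift values exactly: a
    contradiction. The graded centre is computed with a Teichmueller root of unity, which generates
    a subfield of dimension d with integral values that contains its own centraliser.

    For duality, odd residue characteristic gives 2-power roots of 1-units, hence involutions
    preserve valuations ([involution_valu]) and the dual of a norm is a norm. The involution sigma
    pairs V_i with V_{-i}. For i in I_0, h on V_i is a function of h_i, so dualising commutes with
    [transfer] up to a translation, which half a translation of the norm of S removes
    ([dual_transfer]).

    The map j ([jmap]) takes the transfers of the x_i on I_0 and I_+, and on I_- the duals of the
    components at -i. A self-dual norm compatible with E and D is determined by its parts on I_0 and
    I_+ ([jmap_unique]); this gives the image, and with it equivariance. Operator bounds pass
    through [transfer] in both directions ([transport_op]), which gives CLF. Common orthogonal bases
    are carried to common orthogonal bases ([component_affine]) and dual bases negate values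
    ([component_dual_basis]), which gives affinity. *)

Lemma ereal_cut (R : realType) (z : \bar R) (r : R) :
  (forall t, (t%:E <= z)%E <-> t <= r) -> z = r%:E.
Proof.
move=> zr; apply/eqP; rewrite eq_le; apply/andP; split; last exact/zr.
case: z zr => [s| |] zr; last by rewrite leNye.
  by rewrite lee_fin; apply/zr.
by have [+ _] := zr (r + 1); rewrite leey gerDl ler10 => /(_ isT).
Qed.

(** * Valuations *)

Section Valuations.
Variables (R : realType) (A : unitRingType) (v : A -> \bar R).
Hypothesis vv : is_valuation v.
Implicit Types (x y : A) (r s t : R).

Lemma valu0 : v 0 = +oo%E. Proof. exact/(valuation_eqy vv). Qed.

Lemma valu_fin x : x != 0 -> exists r, v x = r%:E.
Proof.
move=> x0; case E: (v x) => [r| |]; first by exists r.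
  by move/(valuation_eqy vv): E x0 => ->; rewrite eqxx.
by have := valuation_gtNy vv x; rewrite E.
Qed.

Lemma valu_neq0 x r : v x = r%:E -> x != 0.
Proof. by move=> vx; apply/eqP => x0; rewrite x0 valu0 in vx. Qed.

Lemma valu1 : v 1 = 0%E.
Proof.
have [r vr] := valu_fin (oner_neq0 A).
have := valuationM vv 1 1; rewrite mul1r vr -EFinD => -[] rr; congr (_%:E); lra.
Qed.

Lemma valuN x : v (- x) = v x.
Proof.
have [r vr] : exists r, v (-1) = r%:E by apply: valu_fin; rewrite oppr_eq0 oner_neq0.
have r0 : r = 0.
  have := valuationM vv (-1) (-1); rewrite mulrNN mul1r valu1 vr -EFinD => -[]; lra.
by rewrite -mulN1r (valuationM vv) vr r0 add0e.
Qed.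

Lemma valuV x r : x \is a GRing.unit -> v x = r%:E -> v x^-1 = (- r)%:E.
Proof.
move=> ux vx; have xV0 : x^-1 != 0 by rewrite invr_eq0 (valu_neq0 vx).
have [s vs] := valu_fin xV0; rewrite vs; congr (_%:E).
have := valuationM vv x x^-1; rewrite divrr // valu1 vx vs -EFinD => -[]; lra.
Qed.

Lemma valuX x r n : v x = r%:E -> v (x ^+ n) = (n%:R * r)%:E.
Proof.
move=> vx; elim: n => [|n IH]; first by rewrite expr0 valu1 mul0r.
by rewrite exprS (valuationM vv) vx IH -EFinD; congr (_%:E); ring.
Qed.

Lemma valuBC x y : v (x - y) = v (y - x).
Proof. by rewrite -valuN opprB. Qed.

Lemma valuD_ge (z : \bar R) x y : (z <= v x -> z <= v y -> z <= v (x + y))%E.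
Proof.
move=> zx zy; apply: le_trans (valuationD vv x y).
by rewrite le_min zx zy.
Qed.

Lemma valuB_ge (z : \bar R) x y : (z <= v x -> z <= v y -> z <= v (x - y))%E.
Proof. by move=> zx zy; apply: valuD_ge => //; rewrite valuN. Qed.

Lemma valuD_gt (z : \bar R) x y : (z < v x -> z < v y -> z < v (x + y))%E.
Proof.
move=> zx zy; apply: lt_le_trans (valuationD vv x y).
by rewrite lt_min zx zy.
Qed.

Lemma valu_sum_ge (J : Type) (s : seq J) (P : pred J) (F : J -> A) (z : \bar R) :
  (forall j, P j -> z <= v (F j))%E -> (z <= v (\sum_(j <- s | P j) F j)%R)%E.
Proof.
move=> zF; elim/big_ind: _ => //; first by rewrite valu0 leey.
by move=> x y; exact: valuD_ge.
Qed.

Lemma valu_sum_gt (J : Type) (s : seq J) (P : pred J) (F : J -> A) r :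
  (forall j, P j -> r%:E < v (F j))%E -> (r%:E < v (\sum_(j <- s | P j) F j)%R)%E.
Proof.
move=> zF; elim/big_ind: _ => //; first by rewrite valu0 ltey.
by move=> x y; exact: valuD_gt.
Qed.

Lemma valuM_ge s t x y : (s%:E <= v x -> t%:E <= v y -> (s + t)%R%:E <= v (x * y)%R)%E.
Proof. by move=> sx ty; rewrite (valuationM vv) EFinD leeD. Qed.

Lemma valu_eq0 x : (forall t, t%:E <= v x)%E -> x = 0.
Proof.
move=> tx; apply/eqP/contraT => /valu_fin[r vr].
by have := tx (r + 1); rewrite vr lee_fin; lra.
Qed.

Lemma valu_dom x y : (v x < v y)%E -> v (x + y) = v x.
Proof.
move=> xy; apply/eqP; rewrite eq_le; apply/andP; split; last first.
  by apply: valuD_ge => //; exact: ltW.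
rewrite leNgt; apply/negP => lt.
have : (v x < v ((x + y) - y)%R)%E by apply: valuD_gt; rewrite ?valuN.
by rewrite addrK ltxx.
Qed.

Lemma valu_close x y : (v x < v (x - y))%E -> v y = v x.
Proof.
move=> xy; have -> : y = x + (y - x) by rewrite addrC subrK.
by rewrite valu_dom // valuBC.
Qed.

Lemma valu_mul_gt x y s t : v x = s%:E -> (t%:E < v y)%E -> ((s + t)%R%:E < v (x * y)%R)%E.
Proof. by move=> vx ty; rewrite (valuationM vv) vx EFinD lteD2lE. Qed.

Lemma valu_conj x y r : x \is a GRing.unit -> v x = r%:E -> v (x * y / x) = v y.
Proof.
move=> ux vx; rewrite !(valuationM vv) vx (valuV ux vx).
by case: (v y) => [s| |] //=; congr (_%:E); ring.
Qed.

End Valuations.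

(** * Complete discretely valued division rings *)

Record is_cdv (R : realType) (A : unitRingType) (v : A -> \bar R) : Prop := IsCdv {
  cdv_unit : forall x : A, x != 0 -> x \is a GRing.unit;
  cdv_val : is_valuation v;
  cdv_pi : exists pi : A, is_uniformizer v pi;
  cdv_complete : forall u : nat -> A,
    (forall t : R, exists n0, forall m n, (n0 <= m)%N -> (n0 <= n)%N ->
       (t%:E <= v (u m - u n)%R)%E) ->
    exists l : A, forall t : R, exists n0, forall n, (n0 <= n)%N -> (t%:E <= v (u n - l)%R)%E }.

Section DiscreteValuations.
Variables (R : realType) (A : unitRingType) (v : A -> \bar R).
Hypothesis Av : is_cdv v.
Let vv := cdv_val Av.
Variable pi : A.
Hypothesis pi_unif : is_uniformizer v pi.
Let st := fine (v pi).

Lemma step_val : v pi = st%:E.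
Proof. by rewrite /st; case: pi_unif; case: (v pi). Qed.

Lemma step_gt0 : 0 < st.
Proof. by rewrite -lte_fin -step_val; case: pi_unif. Qed.

Lemma step_min x : (0 < v x)%E -> (st%:E <= v x)%E.
Proof. by rewrite -step_val; case: pi_unif => _ _; exact. Qed.

Lemma valu_scalar (n : int) : exists2 a, a != 0 & v a = (n%:~R * st)%:E.
Proof.
case: n => n.
  by exists (pi ^+ n); [apply: (valu_neq0 vv)|]; rewrite (valuX vv n step_val).
have vp := valuX vv n.+1 step_val.
have up : pi ^+ n.+1 \is a GRing.unit by apply: (cdv_unit Av); apply: (valu_neq0 vv vp).
have vV := valuV vv up vp.
by exists (pi ^- n.+1); [apply: (valu_neq0 vv vV)|rewrite vV NegzE mulrNz mulNr].
Qed.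

(** Scaling by an element of value in Z st brings the value of x into [0, st), where minimality of
    st leaves only 0. *)
Lemma valu_discrete x : x != 0 -> exists n : int, v x = (n%:~R * st)%:E.
Proof.
move=> x0; have [r vr] := valu_fin vv x0; have st0 := step_gt0.
pose n := Num.floor (r / st); exists n; rewrite vr; congr (_%:E).
have [a a0 va] := valu_scalar (- n).
have /andP[] := floor_itv (r / st).
rewrite -/n ler_pdivlMr // ltr_pdivrMr // intrD mulrDl mul1r => le1 lt1.
have vxa : v (x * a) = (r - n%:~R * st)%:E.
  by rewrite (valuationM vv) vr va -EFinD mulrNz mulNr.
case: (ltrP 0 (r - n%:~R * st)) => [gt0|]; last lra.
have := @step_min (x * a); rewrite vxa lte_fin lee_fin => /(_ gt0); lra.
Qed.

(* Below T, the set c + Z st has a largest element. *)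
Lemma coset_below (c T : R) : exists2 m, m < T & forall n : int, c + n%:~R * st < T -> c + n%:~R * st <= m.
Proof.
have st0 := step_gt0.
pose n := Num.ceil ((T - c) / st) - 1.
have /andP[] := ceil_itv ((T - c) / st).
have -> : Num.ceil ((T - c) / st) = n + 1 by rewrite subrK.
rewrite ler_pdivrMr // ltr_pdivlMr // => lt1 le1.
have nE : (n + 1 - 1)%:~R = n%:~R :> R by rewrite addrK.
exists (c + n%:~R * st); first by move: lt1; rewrite ?addrK ?nE; lra.
move=> m mT; rewrite lerD2l ler_pM2r // ler_int.
rewrite -ltzD1 -(ltr_int R) -(ltr_pM2r st0); lra.
Qed.

(** The values of a norm on a finite-dimensional space lie in finitely many cosets of Z st. This
    discreteness is what makes the supremum in [orth_best] attained. *)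
Lemma cosets_below n (c : 'I_n -> R) (T : R) :
  exists2 m, m < T & forall i (k : int), c i + k%:~R * st < T -> c i + k%:~R * st <= m.
Proof.
elim: n c => [|n IH] c; first by exists (T - 1) => [|[]//]; lra.
have [m1 m1T H1] := IH (fun i => c (lift ord0 i)).
have [m2 m2T H2] := coset_below (c ord0) T.
exists (Num.max m1 m2) => [|i k]; first by rewrite gt_max m1T.
case: (unliftP ord0 i) => [j ->|->] lt; rewrite le_max.
  by rewrite H1.
by rewrite H2 // orbT.
Qed.

End DiscreteValuations.

(** * Bounds and cuts in the reals *)

Section FiniteBounds.
Variable R : realType.

Lemma fin_lower_bound_gt (J : finType) (f : J -> R) (c : R) :
  (forall j, c < f j) -> exists2 m, c < m & forall j, m <= f j.
Proof.
move=> cf; exists (\big[Order.min/(c + 1)]_j f j).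
  by elim/big_ind: _ => [|x y cx cy|j _]; rewrite ?lt_min ?cx ?cy ?cf ?ltrDl.
by move=> j; rewrite (bigD1 j) //= ge_min lexx.
Qed.

Lemma fin_lower_bound (J : finType) (f : J -> R) : exists m, forall j, m <= f j.
Proof.
exists (\big[Order.min/0]_j f j).
by move=> j; rewrite (bigD1 j) //= ge_min lexx.
Qed.

Lemma nat_above (t : R) : exists n : nat, t <= n%:R.
Proof.
exists (Num.bound `|t|); apply: le_trans (ler_norm _) _.
by apply: ltW; exact: archi_boundP.
Qed.

Lemma real_cut (P : R -> Prop) : (exists t, P t) -> (exists t, ~ P t) ->
  (forall s t, s <= t -> P t -> P s) -> (forall t, (forall s, s < t -> P s) -> P t) ->
  exists c, forall t, P t <-> t <= c.
Proof.
move=> [t0 Pt0] [t1 Pt1] down closed.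
have ub : ubound [set t | P t] t1.
  move=> t /= Pt; rewrite leNgt; apply/negP => lt.
  by apply: Pt1; apply: down Pt; exact: ltW.
exists (sup [set t | P t]) => t; split; first exact: (ub_le_sup (ex_intro _ t1 ub)).
move=> tc; apply: closed => s st.
have [u Pu su] := sup_gt (ex_intro _ t0 Pt0) (lt_le_trans st tc).
by apply: down Pu; exact: ltW.
Qed.

End FiniteBounds.

(** * Norms and orthogonal bases *)

Section Spaces.
Variables (R : realType) (A : unitRingType) (v : A -> \bar R).
Variables (V : zmodType) (act : A -> V -> V).

Definition aspan (J : finType) (s : J -> V) : set V :=
  [set x | exists a : J -> A, x = \sum_j act (a j) (s j)].

(** The action is a parameter and W a subset of V, so that one theory serves right spaces over D and
    D'_i (through the converse ring), V_i over E_i, and S over D'_i. The identity is asked to act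
    trivially on W only, since 1 in E_i acts on V as the projector onto V_i. *)
Record is_space (W : set V) : Prop := IsSpace {
  actDl : forall a b x, act (a + b) x = act a x + act b x;
  actDr : forall a x y, act a (x + y) = act a x + act a y;
  actM : forall a b x, act (a * b) x = act a (act b x);
  act1 : forall x, W x -> act 1 x = x;
  space_act : forall a x, W x -> W (act a x);
  space0 : W 0;
  spaceB : forall x y, W x -> W y -> W (x - y);
  space_fg : exists n (s : 'I_n -> V), (forall i, W (s i)) /\ W `<=` aspan s }.

(* L t stands for {x | alpha x >= t}, where alpha is a norm on W. *)
Record is_norm (W : set V) (L : R -> set V) : Prop := IsNorm {
  norm_sub : forall t x, L t x -> W x;
  norm0 : forall t, L t 0;
  normB : forall t x y, L t x -> L t y -> L t (x - y);
  norm_cont : forall t x, W x -> (forall s, s < t -> L s x) -> L t x;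
  norm_anti : forall s t x, s <= t -> L t x -> L s x;
  norm_exh : forall x, W x -> exists t, L t x;
  norm_sep : forall x, W x -> (forall t, L t x) -> x = 0;
  norm_act : forall s t a x, (s%:E <= v a)%E -> L t x -> L (s + t) (act a x) }.

(** In terms of the norm, [orthP] says that sum_j a_j b_j has value min_j (v(a_j) + c_j). Linear
    independence is a consequence ([orth_independent]). *)
Record orth_basis (W : set V) (L : R -> set V) (J : finType) (b : J -> V) (c : J -> R) : Prop :=
  IsOrthBasis {
  orth_in : forall j, W (b j);
  orth_span : W `<=` aspan b;
  orthP : forall t (a : J -> A),
    L t (\sum_j act (a j) (b j)) <-> forall j, ((t - c j)%:E <= v (a j))%E }.

Section SpaceTheory.
Variable W : set V.
Hypothesis VW : is_space W.

Lemma act0 a : act a 0 = 0.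
Proof. by apply: (addIr (act a 0)); rewrite -(actDr VW) !add0r. Qed.

Lemma act0l x : act 0 x = 0.
Proof. by apply: (addIr (act 0 x)); rewrite -(actDl VW) !add0r. Qed.

Lemma actN a x : act a (- x) = - act a x.
Proof. by apply: (addIr (act a x)); rewrite -(actDr VW) !addNr act0. Qed.

Lemma actNl a x : act (- a) x = - act a x.
Proof. by apply: (addIr (act a x)); rewrite -(actDl VW) !addNr act0l. Qed.

Lemma actB a x y : act a (x - y) = act a x - act a y.
Proof. by rewrite (actDr VW) actN. Qed.

Lemma actBl a b x : act (a - b) x = act a x - act b x.
Proof. by rewrite (actDl VW) actNl. Qed.

Lemma act_sum a (J : Type) (s : seq J) (P : pred J) (F : J -> V) :
  act a (\sum_(j <- s | P j) F j) = \sum_(j <- s | P j) act a (F j).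
Proof. by apply: (big_morph (act a) (actDr VW a) (act0 a)). Qed.

Lemma act_suml (J : Type) (s : seq J) (P : pred J) (F : J -> A) x :
  act (\sum_(j <- s | P j) F j) x = \sum_(j <- s | P j) act (F j) x.
Proof. by apply: (big_morph (act^~ x) (fun a b => actDl VW a b x) (act0l x)). Qed.

Lemma spaceN x : W x -> W (- x).
Proof. by move=> Wx; rewrite -sub0r; apply: (spaceB VW) => //; exact: space0. Qed.

Lemma spaceD x y : W x -> W y -> W (x + y).
Proof. by move=> Wx Wy; rewrite -[y]opprK; apply: (spaceB VW) => //; exact: spaceN. Qed.

Lemma space_sum (J : Type) (s : seq J) (P : pred J) (F : J -> V) :
  (forall j, P j -> W (F j)) -> W (\sum_(j <- s | P j) F j).
Proof.
move=> WF; elim/big_ind: _ => //; first exact: space0.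
by move=> x y; exact: spaceD.
Qed.

Lemma actK a x : a \is a GRing.unit -> W x -> act a^-1 (act a x) = x.
Proof. by move=> ua Wx; rewrite -(actM VW) mulVr // (act1 VW). Qed.

Lemma actVK a x : a \is a GRing.unit -> W x -> act a (act a^-1 x) = x.
Proof. by move=> ua Wx; rewrite -(actM VW) mulrV // (act1 VW). Qed.

Lemma span_lin (J : finType) (s : J -> V) a b x y :
  aspan s x -> aspan s y -> aspan s (act a x + act b y).
Proof.
move=> [f ->] [g ->]; exists (fun j => a * f j + b * g j).
rewrite !act_sum -big_split; apply: eq_bigr => j _.
by rewrite (actDl VW) !(actM VW).
Qed.

Lemma span0 (J : finType) (s : J -> V) : aspan s 0.
Proof. by exists (fun=> 0); rewrite big1 // => j _; rewrite act0l. Qed.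

Lemma span_sub (J : finType) (s : J -> V) : (forall j, W (s j)) -> aspan s `<=` W.
Proof. by move=> Ws _ [a ->]; apply: space_sum => j _; apply: (space_act VW). Qed.

Lemma span_act (J : finType) (s : J -> V) a x : aspan s x -> aspan s (act a x).
Proof. by move=> sx; have := span_lin a 0 sx sx; rewrite act0l addr0. Qed.

Lemma spanD (J : finType) (s : J -> V) x y : (forall j, W (s j)) ->
  aspan s x -> aspan s y -> aspan s (x + y).
Proof.
move=> Ws sx sy; have := span_lin 1 1 sx sy.
by rewrite !(act1 VW) //; [exact: span_sub sy|exact: span_sub sx].
Qed.

Lemma spanB (J : finType) (s : J -> V) x y : (forall j, W (s j)) ->
  aspan s x -> aspan s y -> aspan s (x - y).
Proof.
move=> Ws sx sy; apply: spanD => //; have := span_act (-1) sy.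
by rewrite actNl (act1 VW) //; exact: span_sub sy.
Qed.

Lemma span_gen (J : finType) (s : J -> V) j : W (s j) -> aspan s (s j).
Proof.
move=> Wsj; exists (fun i => if i == j then 1 else 0).
rewrite (bigD1 j) //= eqxx (act1 VW) // big1 ?addr0 // => i /negPf->.
by rewrite act0l.
Qed.

Section NormTheory.
Variable L : R -> set V.
Hypothesis NL : is_norm W L.

Lemma normN t x : L t x -> L t (- x).
Proof. by move=> Lx; rewrite -sub0r; apply: (normB NL) => //; exact: (norm0 NL). Qed.

Lemma normD t x y : L t x -> L t y -> L t (x + y).
Proof. by move=> Lx Ly; rewrite -[y]opprK; apply: (normB NL) => //; exact: normN. Qed.

Lemma norm_sum t (J : Type) (s : seq J) (P : pred J) (F : J -> V) :
  (forall j, P j -> L t (F j)) -> L t (\sum_(j <- s | P j) F j).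
Proof.
move=> LF; elim/big_ind: _ => //; first exact: (norm0 NL).
by move=> x y; exact: normD.
Qed.

Lemma norm_subr t x y : L t (x - y) -> L t y -> L t x.
Proof. by move=> Lxy Ly; rewrite -[x](subrK y); exact: normD. Qed.

Lemma norm_val x : W x -> x != 0 -> exists c, forall t, L t x <-> t <= c.
Proof.
move=> Wx x0; apply: (real_cut (P := fun t => L t x)).
- exact: (norm_exh NL).
- by apply/existsNP => H; move: x0; rewrite (norm_sep NL Wx H) eqxx.
- by move=> s t; exact: (norm_anti NL).
- by move=> t; exact: (norm_cont NL).
Qed.

Hypothesis Av : is_cdv v.
Let vv := cdv_val Av.

Lemma norm_act_eq a r t x : v a = r%:E -> W x -> L (r + t) (act a x) <-> L t x.
Proof.
move=> va Wx; have ua : a \is a GRing.unit by apply: (cdv_unit Av); apply: valu_neq0 va.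
split=> [Lax|Lx]; last by apply: (norm_act NL) => //; rewrite va.
rewrite -(actK ua Wx) -[t](addKr r); apply: (norm_act NL) => //.
by rewrite (valuV vv ua va).
Qed.

Section Orth.
Variables (J : finType) (b : J -> V) (c : J -> R).
Hypothesis bW : forall j, W (b j).
Hypothesis bL : orth_basis (aspan b) L b c.
(** Orthogonality makes the coordinates of a Cauchy sequence Cauchy, so completeness of the scalars
    applies to each of them. *)
Lemma orth_complete (y : nat -> V) : (forall n, aspan b (y n)) ->
  (forall t, exists n0, forall m n, (n0 <= m)%N -> (n0 <= n)%N -> L t (y m - y n)) ->
  exists2 l, aspan b l & forall t, exists n0, forall n, (n0 <= n)%N -> L t (y n - l).
Proof.
move=> /choice[a aP] yC.
have /choice[l lP] j : exists l, forall t : R, exists n0, forall n, (n0 <= n)%N ->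
    (t%:E <= v (a n j - l)%R)%E.
  apply: (cdv_complete Av) => t; have [n0 n0P] := yC (t + c j).
  exists n0 => m n n0m n0n; rewrite -[t](addrK (c j)).
  have [H _] := orthP bL (t + c j) (fun j => a m j - a n j); apply: H.
  by under eq_bigr do rewrite actBl; rewrite sumrB -!aP; exact: n0P.
exists (\sum_j act (l j) (b j)); first by exists l.
move=> t; have /choice[n0 n0P] j := lP j (t - c j).
exists (\max_j n0 j)%N => n n0n; rewrite aP -sumrB; under eq_bigr do rewrite -actBl.
apply/(orthP bL) => j; apply: n0P; apply: leq_trans n0n; exact: leq_bigmax.
Qed.

Variables (x : V).
Hypothesis Wx : W x.
Hypothesis bx : ~ aspan b x.

(** If no coordinate attained the minimum r, all of them would exceed it, and finitely many strict
    inequalities leave room for a value above r. *)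
Lemma orth_value z r : z != 0 -> aspan b z -> (forall t, L t z <-> t <= r) ->
  exists j (a : A), a != 0 /\ v a = (r - c j)%:E.
Proof.
move=> z0 [a za] zr; apply/not_existsP => H.
have /(orthP bL)Ha : L r (\sum_j act (a j) (b j)) by rewrite -za; apply/zr.
have /choice[f fP] j : exists s, r < s /\ ((s - c j)%:E <= v (a j))%E.
  have := Ha j; rewrite le_eqVlt => /orP[/eqP E|lt].
    exfalso; apply: (H j); exists (a j); split; last by rewrite -E.
    by apply: (valu_neq0 vv); rewrite -E.
  have [aj0|/(valu_fin vv)[s vs]] := eqVneq (a j) 0.
    by exists (r + 1); split; [lra|rewrite aj0 (valu0 vv) leey].
  exists (s + c j); split; last by rewrite vs lee_fin; lra.
  by move: lt; rewrite vs lte_fin; lra.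
have [m rm mf] := fin_lower_bound_gt (fun j => (fP j).1).
have : L m z.
  rewrite za; apply/(orthP bL) => j; apply: le_trans (fP j).2.
  by rewrite lee_fin lerD2r.
by move/zr; lra.
Qed.

(** A vector approximated to every order by the span is the limit of a Cauchy sequence there, and
    the span is complete. *)
Lemma orth_limit : (forall t, exists2 y, aspan b y & L t (x - y)) -> False.
Proof.
move=> H; apply: bx.
have /choice[y yP] (n : nat) : exists y, aspan b y /\ L n%:R (x - y).
  by have [y] := H n%:R; exists y.
have xy n t : t <= n%:R -> L t (x - y n) by move=> tn; exact: (norm_anti NL tn (yP n).2).
have [t|l bl lP] := orth_complete (fun n => (yP n).1).
  have [n0 tn0] := nat_above t; exists n0 => m n n0m n0n.
  have -> : y m - y n = (x - y n) - (x - y m) by rewrite opprB [RHS]addrC addrA subrK.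
  by apply: (normB NL); apply: xy; apply: le_trans tn0 _; rewrite ler_nat.
suff /eqP : x - l = 0 by rewrite subr_eq0 => /eqP->.
apply: (norm_sep NL) => [|t]; first by apply: (spaceB VW) => //; exact: span_sub bl.
have [n0 n0P] := lP t; have [n1 tn1] := nat_above t.
rewrite -(subrK (y (maxn n0 n1)) x) -addrA; apply: normD.
  by apply: xy; apply: le_trans tn1 _; rewrite ler_nat leq_maxr.
by apply: n0P; rewrite leq_maxl.
Qed.

(** The orders of approximation of x by the span are bounded by [orth_limit]. A y that comes close
    enough to the supremum is optimal, because an improvement z would make the value of z - y a
    value of the span lying too close below the supremum. *)
Lemma orth_best : exists y r, [/\ aspan b y, forall t, L t (x - y) <-> t <= r &
  forall z t, aspan b z -> L t (x - z) -> t <= r].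
Proof.
have [pi piu] := cdv_pi Av.
have nz y : aspan b y -> x - y != 0.
  by rewrite subr_eq0; move=> by_; apply/eqP => xy; apply: bx; rewrite xy.
have Wb y : aspan b y -> W y by exact: span_sub.
pose P := [set t | exists2 y, aspan b y & L t (x - y)].
have [[t0 t0P]|nub] := pselect (has_ubound P); last first.
  exfalso; apply: orth_limit => t; apply: contrapT => H; apply: nub.
  exists t => s [y sy Ly]; rewrite leNgt; apply/negP => ts; apply: H.
  by exists y => //; apply: (norm_anti NL) Ly; exact: ltW.
have P0 : P !=set0.
  by have [t Lt] := norm_exh NL Wx; exists t; exists 0; [exact: span0|rewrite subr0].
have [n [bb' [cc' cE]]] : exists n (g : 'I_n -> J) (c' : 'I_n -> R),
    forall j, exists i, c' i = c j.
  exists #|J|, enum_val, (fun i => c (enum_val i)) => j.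
  by exists (enum_rank j); rewrite enum_rankK.
(* No number of the cosets c_j + Z st lies strictly between m and the supremum. *)
have [m mT mP] := cosets_below piu cc' (sup P).
have [t [y sy Ly] mt] := sup_gt P0 mT.
have [r rP] : exists c, forall t, L t (x - y) <-> t <= c.
  by apply: norm_val; [apply: (spaceB VW) => //; exact: Wb|exact: nz].
have tr : t <= r by apply/rP.
have rT : r <= sup P.
  by apply: (ub_le_sup (ex_intro _ t0 t0P)); exists y => //; apply/rP.
exists y, r; split=> // z s sz Ls.
have sT : s <= sup P by apply: (ub_le_sup (ex_intro _ t0 t0P)); exists z.
rewrite leNgt; apply/negP => rs.
(* As z approximates x strictly better than y does, z - y has the same value r as x - y. *)
have rP' : forall u, L u (z - y) <-> u <= r.
  move=> u; have zyE : z - y = (x - y) - (x - z) by rewrite opprB [RHS]addrC addrA subrK.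
  split=> [Lu|ur]; last first.
    rewrite zyE; apply: (normB NL); first exact/rP.
    by apply: (norm_anti NL) Ls; lra.
  rewrite leNgt; apply/negP => ru.
  have : L (Num.min u s) (x - y).
    apply: (@norm_subr _ _ (x - z)); last by apply: (norm_anti NL) Ls; rewrite ge_min lexx orbT.
    have -> : x - y - (x - z) = z - y by rewrite zyE.
    by apply: (norm_anti NL) Lu; rewrite ge_min lexx.
  by move/rP; rewrite ge_min; lra.
have zy0 : z - y != 0.
  apply/eqP => E; have : L s (z - y) by rewrite E; exact: (norm0 NL).
  by move/rP'; lra.
have [j [a [a0 va]]] := orth_value zy0 (spanB bW sz sy) rP'.
have [k vk] := valu_discrete Av piu a0; have [i ci] := cE j.
have rE : r = cc' i + k%:~R * fine (v pi).
  by move: vk; rewrite va ci => -[]; lra.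
have := mP i k; rewrite -rE => /(_ (lt_le_trans rs sT)); lra.
Qed.

End Orth.

(** Gram-Schmidt: the new generator is replaced by its difference e from a best approximation in the
    span already treated. Optimality says that e is orthogonal to that span. *)
Lemma orth_basis_span n (s : 'I_n -> V) : (forall i, W (s i)) ->
  exists m (b : 'I_m -> V) (c : 'I_m -> R),
  (forall i, W (b i)) /\ aspan b = aspan s /\ orth_basis (aspan b) L b c.
Proof.
elim: n s => [|n IH] s Ws.
  exists 0%N, s, (fun=> 0); split=> //; split=> //; split=> //; first by case.
  by move=> t a; split=> [_ []//|_]; rewrite big_ord0; exact: (norm0 NL).
have [m [b [c [Wb [bE bL]]]]] := IH (fun i => s (lift ord0 i)) (fun i => Ws _).
have sE x : aspan s x <-> exists a y, aspan b y /\ x = act a (s ord0) + y.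
  split=> [[a ->]|[a [y [sy ->]]]].
    rewrite big_ord_recl; exists (a ord0); eexists; split; last by [].
    by rewrite bE; exists (fun i => a (lift ord0 i)).
  have [f ->] : aspan (fun i => s (lift ord0 i)) y by rewrite -bE.
  exists (fun i => oapp f a (unlift ord0 i)); rewrite big_ord_recl unlift_none /=.
  by congr (_ + _); apply: eq_bigr => i _; rewrite liftK.
have [bs0|bs0] := pselect (aspan b (s ord0)).
  exists m, b, c; split=> //; split=> //; apply/seteqP; split=> x.
    by move=> bx; apply/sE; exists 0, x; rewrite act0l add0r.
  by move=> /sE[a [y [sy ->]]]; apply: (spanD Wb) => //; exact: span_act.
have [y [r [sy rP rmax]]] := orth_best Wb bL (Ws ord0) bs0.
pose e := s ord0 - y.
have We : W e by apply: (spaceB VW) => //; exact: span_sub sy.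
pose b' (i : 'I_m.+1) := oapp b e (unlift ord0 i).
pose c' (i : 'I_m.+1) := oapp c r (unlift ord0 i).
have b'E (a : 'I_m.+1 -> A) : \sum_i act (a i) (b' i) =
    act (a ord0) e + \sum_i act (a (lift ord0 i)) (b i).
  rewrite big_ord_recl /b' unlift_none /=.
  by congr (_ + _); apply: eq_bigr => i _; rewrite liftK.
have Wb' i : W (b' i) by rewrite /b'; case: (unlift ord0 i).
exists m.+1, b', c'; split=> //; split.
  apply/seteqP; split=> x.
    move=> [a ->]; rewrite b'E; apply/sE.
    exists (a ord0), (- act (a ord0) y + \sum_i act (a (lift ord0 i)) (b i)); split.
      apply: (spanD Wb); last by eexists.
      by rewrite -actNl; exact: span_act.
    by rewrite addrA -actB.
  move=> /sE[a [z [sz ->]]].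
  have [f fE] : aspan b (act a y + z) by apply: (spanD Wb) => //; exact: span_act.
  exists (fun i => oapp f a (unlift ord0 i)); rewrite b'E unlift_none /=.
  under eq_bigr do rewrite liftK /=.
  by rewrite -fE actB addrA subrK.
split=> // [j|t a]; first exact: span_gen.
rewrite b'E.
(* Dividing a0 e + n0 by a0 turns it into the error of another approximation of [s ord0], so its
   value cannot exceed r. This bounds the value of a0 from below. *)
have step (a0 : A) n0 : aspan b n0 -> L t (act a0 e + n0) <->
    ((t - r)%:E <= v a0)%E /\ L t n0.
  move=> bn0; split=> [Len|[ta Ln]]; last first.
    apply: normD => //; have -> : t = (t - r) + r by lra.
    by apply: (norm_act NL) => //; apply/rP.
  have ta : ((t - r)%:E <= v a0)%E.
    have [->|a00] := eqVneq a0 0; first by rewrite (valu0 vv) leey.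
    have [w vw] := valu_fin vv a00; have ua := cdv_unit Av a00.
    rewrite vw lee_fin.
    have : L (t - w) (s ord0 - (y - act a0^-1 n0)).
      have -> : s ord0 - (y - act a0^-1 n0) = act a0^-1 (act a0 e + n0).
        by rewrite (actDr VW) actK // /e opprB addrCA addrC.
      by rewrite addrC; apply: (norm_act NL) => //; rewrite (valuV vv ua vw).
    have bz : aspan b (y - act a0^-1 n0) by apply: (spanB Wb) => //; exact: span_act.
    by move=> /(rmax _ _ bz); lra.
  split=> //.
  rewrite -[n0](addKr (act a0 e)) addrC; apply: (normB NL) => //.
  have -> : t = (t - r) + r by lra.
  by apply: (norm_act NL) => //; apply/rP.
rewrite step; last by eexists.
split=> [[H0 /(orthP bL)H] i|H].
  rewrite /c'; case: (unliftP ord0 i) => [j ->|->] //=; exact: H.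
split; first by have := H ord0; rewrite /c' unlift_none.
by apply/(orthP bL) => i; have := H (lift ord0 i); rewrite /c' liftK.
Qed.

Theorem orth_basis_exists : exists n (b : 'I_n -> V) (c : 'I_n -> R), orth_basis W L b c.
Proof.
have [n [s [Ws sW]]] := space_fg VW.
have [m [b [c [Wb [bs bL]]]]] := orth_basis_span Ws.
have WE : W = aspan b by rewrite bs; apply/seteqP; split=> //; exact: span_sub.
by exists m, b, c; rewrite {1}WE.
Qed.

(* Completeness makes subspaces closed. *)
Lemma dense_subspace n (s : 'I_n -> V) : (forall i, W (s i)) ->
  (forall x, W x -> x != 0 -> exists y t, [/\ aspan s y, L t (x - y) & ~ L t x]) ->
  W `<=` aspan s.
Proof.
move=> Ws H x Wx; apply: contrapT => sx.
have [m [b [c [Wb [bs bL]]]]] := orth_basis_span Ws.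
rewrite -bs in sx.
have [y [r [sy rP rmax]]] := orth_best Wb bL Wx sx.
have xy0 : x - y != 0 by rewrite subr_eq0; apply/eqP => E; apply: sx; rewrite E.
have [z [t [sz Lz Lx]]] := H _ (spaceB VW Wx (span_sub Wb sy)) xy0.
apply: Lx; apply/rP; apply: (rmax (y + z)); first by apply: (spanD Wb) => //; rewrite bs.
by rewrite opprD addrA.
Qed.

End NormTheory.

End SpaceTheory.

End Spaces.

Lemma norm_shift (R : realType) (A : unitRingType) (v : A -> \bar R) (V : zmodType) (act : A -> V -> V)
  (W : set V) (L : R -> set V) (z : R) : is_norm v act W L -> is_norm v act W (fun t => L (t + z)).
Proof.
move=> NL; split.
- by move=> t x; exact: (norm_sub NL).
- by move=> t; exact: (norm0 NL).
- by move=> t x y; exact: (normB NL).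
- move=> t x Wx Hs; apply: (norm_cont NL) => // s st.
  by have := Hs (s - z); rewrite subrK; apply; lra.
- by move=> s t x st; apply: (norm_anti NL); rewrite lerD2r.
- by move=> x /(norm_exh NL)[t]; exists (t - z); rewrite subrK.
- move=> x Wx Hx; apply: (norm_sep NL) => // t; have := Hx (t - z).
  by rewrite subrK.
- by move=> s t a x sa; rewrite -addrA; exact: (norm_act NL).
Qed.

(** * Existence of norms; lattice functions are norms *)

Section NormConstruction.
Variables (R : realType) (A : unitRingType) (v : A -> \bar R).
Variables (V : zmodType) (act : A -> V -> V) (W : set V).
Hypothesis Av : is_cdv v.
Hypothesis VW : is_space act W.
Let vv := cdv_val Av.

Definition independent (J : finType) (b : J -> V) :=
  forall a : J -> A, \sum_j act (a j) (b j) = 0 -> forall j, a j = 0.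

(** A generating family of minimal size is independent: a nonzero coefficient in a relation is
    invertible and lets one generator be dropped. *)
Lemma basis_exists : exists n (b : 'I_n -> V),
  [/\ forall i, W (b i), W `<=` aspan act b & independent b].
Proof.
have [n0 H0] : exists n, exists s : 'I_n -> V, (forall i, W (s i)) /\ W `<=` aspan act s.
  exact: (space_fg VW).
pose P n := `[< exists s : 'I_n -> V, (forall i, W (s i)) /\ W `<=` aspan act s >].
have exP : exists n, P n by exists n0; apply/asboolP.
have [n /asboolP[s [Ws sW]] nmin] := ex_minnP exP.
exists n, s; split=> // a a0 j; apply/eqP/contraT => aj.
case: n => [|n] in s Ws sW nmin a a0 j aj *; first by case: j aj.
suff /nmin : P n by rewrite ltnn.
apply/asboolP; exists (fun i => s (lift j i)); split=> // x /sW[c ->].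
have sj : s j = \sum_(i | i != j) act (- ((a j)^-1 * a i)) (s i).
  have ua := cdv_unit Av aj; rewrite -[LHS](actK VW ua (Ws j)).
  move: a0; rewrite (bigD1 j) //= => /eqP; rewrite addr_eq0 => /eqP->.
  rewrite (actN VW) (act_sum VW) -sumrN; apply: eq_bigr => i _.
  by rewrite (actNl VW) (actM VW).
exists (fun i => c (lift j i) - c j * ((a j)^-1 * a (lift j i))).
have liftE (F : 'I_n.+1 -> V) : \sum_(i | i != j) F i = \sum_i F (lift j i).
  apply: (addrI (F j)); have -> : F j + \sum_(i | i != j) F i = \sum_i F i.
    by rewrite [RHS](bigD1 j).
  by rewrite (bigD1_ord j).
rewrite (bigD1 j) //= {1}sj (act_sum VW) -big_split /= liftE.
apply: eq_bigr => i _.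
by rewrite -(actM VW) -(actDl VW) mulrN addrC.
Qed.

Lemma independent_inj (J : finType) (b : J -> V) (a a' : J -> A) : independent b ->
  \sum_j act (a j) (b j) = \sum_j act (a' j) (b j) -> forall j, a j = a' j.
Proof.
move=> ib E j; apply/eqP; rewrite -subr_eq0; apply/eqP.
apply: (ib (fun j => a j - a' j)).
by under eq_bigr do rewrite (actBl VW); rewrite sumrB E subrr.
Qed.

Lemma independent_coord (J : finType) (b : J -> V) : W `<=` aspan act b ->
  exists f : J -> V -> A, forall x, W x -> x = \sum_j act (f j x) (b j).
Proof.
move=> sW; have /choice[f fP] x : exists a : J -> A, W x -> x = \sum_j act (a j) (b j).
  have [/sW[a xa]|nW] := pselect (W x); first by exists a.
  by exists (fun=> 0).
by exists (fun j x => f x j).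
Qed.

Lemma coord_sum (J : finType) (b : J -> V) (f : J -> V -> A) : independent b ->
  (forall x, W x -> x = \sum_j act (f j x) (b j)) -> (forall j, W (b j)) ->
  forall a j, f j (\sum_i act (a i) (b i)) = a j.
Proof.
move=> ib fP Wb a j; move: j; apply: (independent_inj ib); rewrite -fP //.
by apply: (space_sum VW) => i _; exact: (space_act VW).
Qed.

Definition basis_norm (J : finType) (b : J -> V) (c : J -> R) (t : R) : set V :=
  [set x | exists2 a, x = \sum_j act (a j) (b j) & forall j, ((t - c j)%:E <= v (a j))%E].

Section BasisNorm.
Variables (J : finType) (b : J -> V) (c : J -> R).
Hypotheses (Wb : forall j, W (b j)) (sW : W `<=` aspan act b) (ib : independent b).

Lemma basis_normP t (a : J -> A) : basis_norm b c t (\sum_j act (a j) (b j)) <->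
  forall j, ((t - c j)%:E <= v (a j))%E.
Proof.
split=> [[a' E H] j|H]; last by exists a.
by rewrite (independent_inj ib E).
Qed.

Lemma basis_norm_norm : is_norm v act W (basis_norm b c).
Proof.
split.
- by move=> t _ [a -> _]; apply: (span_sub VW) => //; exists a.
- move=> t; exists (fun=> 0) => [|j]; last by rewrite (valu0 vv) leey.
  by rewrite big1 // => j _; rewrite (act0l VW).
- move=> t _ _ [a -> Ha] [a' -> Ha']; exists (fun j => a j - a' j) => [|j].
    by rewrite -sumrB; apply: eq_bigr => j _; rewrite (actBl VW).
  exact: (valuB_ge vv).
- move=> t x Wx H; have [a xa] := sW Wx; exists a => // j.
  have [->|aj0] := eqVneq (a j) 0; first by rewrite (valu0 vv) leey.
  have [r vr] := valu_fin vv aj0; rewrite vr lee_fin leNgt; apply/negP => lt.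
  have := H ((t + r + c j) / 2); rewrite xa => /(_ _)/basis_normP.
  have tl : (t + r + c j) / 2 < t by rewrite ltr_pdivrMr //; lra.
  by move=> /(_ tl j); rewrite vr lee_fin lerBlDr ler_pdivrMr //; lra.
- move=> s t x st [a -> H]; exists a => // j; apply: le_trans (H j).
  by rewrite lee_fin lerD2r.
- move=> x /sW[a ->].
  have /choice[f fP] j : exists r, (r%:E <= v (a j))%E.
    have [->|aj0] := eqVneq (a j) 0; first by exists 0; rewrite (valu0 vv) leey.
    by have [r ->] := valu_fin vv aj0; exists r.
  have [m mP] := fin_lower_bound (fun j => f j + c j).
  exists m; apply/basis_normP => j; apply: le_trans (fP j).
  by rewrite lee_fin lerBlDr.
- move=> x /sW[a ->] H; rewrite big1 // => j _.
  suff -> : a j = 0 by rewrite (act0l VW).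
  apply: (valu_eq0 vv) => t; rewrite -[t](addrK (c j)).
  by have /basis_normP := H (t + c j); apply.
- move=> s t a x sa [a' -> H]; exists (fun j => a * a' j) => [|j].
    by rewrite (act_sum VW); apply: eq_bigr => j _; rewrite (actM VW).
  by rewrite -addrA; apply: (valuM_ge vv).
Qed.

End BasisNorm.

Lemma norm_exists : exists L, is_norm v act W L.
Proof.
have [n [b [Wb sW ib]]] := basis_exists.
by exists (basis_norm b (fun=> 0)); apply: basis_norm_norm.
Qed.

Section OrthFacts.
Variables (L : R -> set V) (NL : is_norm v act W L).
Variables (J : finType) (b : J -> V) (c : J -> R) (bL : orth_basis v act W L b c).

Lemma orth_independent : independent b.
Proof.
move=> a a0 j; apply: (valu_eq0 vv) => t; rewrite -[t](addrK (c j)).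
have [H _] := orthP bL (t + c j) a; apply: H; rewrite a0; exact: (norm0 NL).
Qed.

Lemma orth1 t a j : L t (act a (b j)) <-> ((t - c j)%:E <= v a)%E.
Proof.
have -> : act a (b j) = \sum_i act (if i == j then a else 0) (b i).
  rewrite (bigD1 j) //= eqxx big1 ?addr0 // => i /negPf->.
  by rewrite (act0l VW).
rewrite (orthP bL); split=> [/(_ j)|H i]; first by rewrite eqxx.
by case: eqVneq => [->//|_]; rewrite (valu0 vv) leey.
Qed.

Lemma orth1_gen t j : L t (b j) <-> t <= c j.
Proof.
by rewrite -{1}(act1 VW (orth_in bL j)) orth1 (valu1 vv) lee_fin subr_le0.
Qed.

End OrthFacts.

Section Lattices.
Variables (pi : A) (piu : is_uniformizer v pi).
Let st := fine (v pi).

(** An orthogonal basis, each vector scaled by a scalar of the least value in Z st that puts it into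
    L r, generates L r over the valuation ring. Rounding up with [ceil] is exact because
    coefficients have values in Z st. *)
Lemma norm_lattice_function L : is_norm v act W L -> is_lattice_function v act W st L.
Proof.
move=> NL; have [n [b [c bL]]] := orth_basis_exists VW NL Av.
have st0 := step_gt0 piu.
split.
- move=> r.
  pose k i := Num.ceil ((r - c i) / st).
  have /choice[g gP] i : exists a, a != 0 /\ v a = ((k i)%:~R * st)%:E.
    by have [a] := valu_scalar Av piu (k i); exists a.
  have kP i : r - c i <= (k i)%:~R * st.
    have /andP[_] := ceil_itv ((r - c i) / st).
    by rewrite ler_pdivrMr.
  pose s := [seq act (g i) (b i) | i <- enum 'I_n].
  have sP i : (act (g i) (b i)) \in s by apply: map_f; rewrite mem_enum.
  have Ls w : w \in s -> L r w.
    move=> /mapP[i _ ->]; apply/(orth1 bL); rewrite (gP i).2 lee_fin; exact: kP.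
  have expand (a : 'I_n -> A) : \sum_j act (a j) (b j) =
      \sum_j act (a j / g j) (act (g j) (b j)).
    apply: eq_bigr => j _; rewrite -(actM VW) divrK //.
    by apply: (cdv_unit Av); have [] := gP j.
  exists s; split; apply/seteqP; split=> x.
  + move=> Lx; have [a xa] := orth_span bL (norm_sub NL Lx).
    exists n, (fun j => a j / g j), (fun j => act (g j) (b j)); split=> //; last first.
      by rewrite xa expand.
    move=> j; rewrite /val_ring /=.
    have ug : g j \is a GRing.unit by apply: (cdv_unit Av); have [] := gP j.
    have := (iffLR (orthP bL r a)); rewrite -xa => /(_ Lx j).
    have [->|aj0] := eqVneq (a j) 0; first by rewrite mul0r (valu0 vv) leey.
    have [m vm] := valu_discrete Av piu aj0.
    rewrite (valuationM vv) vm (valuV vv ug (gP j).2) -EFinD !lee_fin -mulNr -mulrDl.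
    rewrite -ler_pdivrMr // -ceil_le_int // => km.
    by rewrite mulr_ge0 ?(ltW st0) // subr_ge0 ler_int.
  + move=> [m [a [w [Ca Lw ->]]]]; apply: (norm_sum NL) => j _.
    by rewrite -[r]add0r; apply: (norm_act NL); [exact: Ca|apply: Ls; exact: Lw].
  + move=> /(orth_span bL)[a ->]; exists n, (fun j => a j / g j), (fun j => act (g j) (b j)).
    by split=> //; exact: expand.
  + move=> [m [a [w [Ca Lw ->]]]]; apply: (space_sum VW) => j _.
    by apply: (space_act VW); apply: (norm_sub NL); apply: Ls; exact: Lw.
- by move=> r s rs x; apply: (norm_anti NL); exact: ltW.
- move=> r; apply/seteqP; split=> x; first by move=> Lx t /= tr; apply: (norm_anti NL) Lx; exact: ltW.
  move=> H; apply: (norm_cont NL) => [|s sr]; last exact: H.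
  by apply: (norm_sub NL); apply: (H (r - 1)) => /=; lra.
- move=> r; apply/seteqP; split=> x.
    move=> [m [a [w [Ca Lw ->]]]]; apply: (norm_sum NL) => j _.
    by rewrite addrC; apply: (norm_act NL) => //; apply: (step_min piu); exact: Ca.
  move=> Lx; have Wx := norm_sub NL Lx.
  have vp : v pi = st%:E := step_val piu; have up : pi \is a GRing.unit by apply: (cdv_unit Av); exact: valu_neq0 vp.
  exists 1%N, (fun=> pi), (fun=> act pi^-1 x); split=> [j|j|].
  + by case: piu.
  + have -> : r = - st + (r + st) by lra.
    by apply: (norm_act NL) => //; rewrite (valuV vv up vp).
  + by rewrite big_ord1 (actVK VW).
Qed.

(** Periodicity gives the effect of the uniformizer in both directions, and every nonzero scalar is
    a unit of the valuation ring times a power of it. *)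
Lemma lattice_function_is_norm L : is_lattice_function v act W st L -> is_norm v act W L.
Proof.
move=> LF; have st0 := step_gt0 piu.
have vp : v pi = st%:E := step_val piu; have up : pi \is a GRing.unit by apply: (cdv_unit Av); exact: valu_neq0 vp.
have LW r x : L r x -> W x.
  have [s [-> ->]] := lattice_function_lattice LF r.
  by move=> [n [c [w [_ Hw ->]]]]; exists n, c, w.
have L0 r : L r 0.
  have [s [-> _]] := lattice_function_lattice LF r.
  exists 0%N, (fun=> 0), (fun=> 0); split=> [[]//|[]//|].
  by rewrite big_ord0.
have Lo r a x : (0 <= v a)%E -> L r x -> L r (act a x).
  have [s [-> _]] := lattice_function_lattice LF r.
  move=> va [n [c [w [Hc Hw ->]]]]; exists n, (fun j => a * c j), w; split=> //.
    by move=> j; rewrite /val_ring /= -[0%E]/(0%:E) -[0%R]addr0; apply: (valuM_ge vv) => //; exact: Hc.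
  by rewrite (act_sum VW); apply: eq_bigr => j _; rewrite (actM VW).
have LD r x y : L r x -> L r y -> L r (x + y).
  have [s [-> _]] := lattice_function_lattice LF r.
  move=> [n [c [w [Hc Hw ->]]]] [n' [c' [w' [Hc' Hw' ->]]]].
  exists (n + n')%N, (fun j => match fintype.split j with inl i => c i | inr i => c' i end),
    (fun j => match fintype.split j with inl i => w i | inr i => w' i end); split.
  - by move=> j; case: (fintype.split j).
  - by move=> j; case: (fintype.split j).
  - rewrite big_split_ord /=; congr (_ + _); apply: eq_bigr => i _.
      by rewrite (unsplitK (inl i)).
    by rewrite (unsplitK (inr i)).
have LN r x : L r x -> L r (- x).
  move=> Lx; have Wx := LW _ _ Lx; rewrite -[x](act1 VW) // -(actNl VW).
  by apply: Lo => //; rewrite (valuN vv) (valu1 vv).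
have Lsum r n (F : 'I_n -> V) : (forall j, L r (F j)) -> L r (\sum_j F j).
  by move=> HF; elim/big_ind: _ => // x y; exact: LD.
have anti s t x : s <= t -> L t x -> L s x.
  by rewrite le_eqVlt => /orP[/eqP->//|/(lattice_function_anti LF)]; apply.
have Lpi r x : L r x -> L (r + st) (act pi x).
  rewrite -(lattice_function_periodic LF) => Lx.
  exists 1%N, (fun=> pi), (fun=> x); split=> // [j|]; first by case: piu.
  by rewrite big_ord1.
have Lpi' r y : W y -> L (r + st) (act pi y) -> L r y.
  move=> Wy; rewrite -(lattice_function_periodic LF) => -[n [c [w [Hc Hw E]]]].
  rewrite -(actK VW up Wy) E (act_sum VW); apply: Lsum => j.
  rewrite -(actM VW); apply: Lo => //.
  have -> : 0%E = (- st + st)%:E by rewrite addNr.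
  apply: (valuM_ge vv); first by rewrite (valuV vv up vp).
  by apply: (step_min piu); exact: Hc.
have Lpos n : forall a t x, v a = (n%:R * st)%:E -> L t x -> L (t + n%:R * st) (act a x).
  elim: n => [|n IH] a t x va Lx.
    by rewrite mul0r addr0; apply: Lo => //; rewrite va mul0r.
  have -> : t + n.+1%:R * st = t + n%:R * st + st by rewrite -natr1; ring.
  rewrite -[a](mulVKr up).
  rewrite (actM VW); apply: Lpi; apply: IH => //.
  by rewrite (valuationM vv) (valuV vv up vp) va -EFinD; congr (_%:E); rewrite -natr1; ring.
have Lneg n : forall a t x, v a = (- (n%:R * st))%:E -> L t x -> L (t - n%:R * st) (act a x).
  elim: n => [|n IH] a t x va Lx.
    by rewrite mul0r subr0; apply: Lo => //; rewrite va mul0r oppr0.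
  apply: Lpi'; first by apply: (space_act VW); exact: LW Lx.
  rewrite -(actM VW); have -> : t - n.+1%:R * st + st = t - n%:R * st by rewrite -natr1; ring.
  apply: IH => //.
  by rewrite (valuationM vv) vp va -EFinD; congr (_%:E); rewrite -natr1; ring.
have Lact s t a x : (s%:E <= v a)%E -> L t x -> L (s + t) (act a x).
  have [->|a0] := eqVneq a 0; first by rewrite (act0l VW).
  have [m] := valu_discrete Av piu a0; rewrite -/st => vm; rewrite vm lee_fin => sm Lx.
  apply: (@anti _ (t + m%:~R * st)); first by lra.
  case: m vm {sm} => m vm; first exact: Lpos.
  rewrite NegzE mulrNz mulNr; apply: Lneg => //.
  by rewrite vm NegzE mulrNz mulNr.
have gens r : exists2 s : seq V, forall w, w \in s -> L r (act 1 w) &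
    W `<=` act_span act setT [set` s] /\ L r = act_span act (val_ring v) [set` s].
  have [s [Lr Ws]] := lattice_function_lattice LF r; exists s.
    move=> w sw; rewrite Lr; exists 1%N, (fun=> 1), (fun=> w); split=> // [j|].
      by rewrite /val_ring /= (valu1 vv).
    by rewrite big_ord1.
  by split=> //; rewrite {1}Ws.
split=> //.
- by move=> t x y Lx Ly; apply: LD => //; exact: LN.
- move=> t x Wx H; rewrite (lattice_function_left_cont LF) => s /=; exact: H.
- move=> x; have [s Hs [sW _]] := gens 0.
  move=> /sW[n [c [w [_ Hw ->]]]].
  have /choice[f fP] j : exists t, L t (act (c j) (w j)).
    have [->|cj0] := eqVneq (c j) 0; first by exists 0; rewrite (act0l VW).
    have [r vr] := valu_fin vv cj0; exists (r + 0).
    by rewrite -[c j]mulr1 (actM VW); apply: Lact; [rewrite vr|exact/Hs/Hw].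
  have [m mP] := fin_lower_bound f; exists m; apply: Lsum => j.
  exact: anti (mP j) (fP j).
(* Separation is borrowed from an auxiliary norm M. The lattice L 0 is finitely generated, hence
   inside some M t0, and scaling makes a vector that lies in all L t lie in all M t. *)
- have [M NM] := norm_exists.
  have [s Hs [sW L0E]] := gens 0.
  have [t0 t0P] : exists t0, forall w, w \in s -> M t0 (act 1 w).
    have /choice[f fP] (j : 'I_(size s)) : exists t, M t (act 1 (nth 0 s j)).
      by apply: (norm_exh NM); apply: (@LW 0); apply: Hs; apply: mem_nth.
    have [m mP] := fin_lower_bound f; exists m => w ws.
    have := fP (Ordinal (etrans (index_mem w s) ws)); rewrite /= nth_index //.
    by apply: (norm_anti NM); exact: mP.
  have L0M x : L 0 x -> M t0 x.
    rewrite L0E => -[n [c [w [Hc Hw ->]]]]; apply: (norm_sum NM) => j _.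
    rewrite -[c j]mulr1 (actM VW) -[t0]add0r; apply: (norm_act NM); first exact: Hc.
    exact/t0P/Hw.
  move=> x Wx Lx; apply: (norm_sep NM) => // t.
  pose k := Num.ceil ((t - t0) / st).
  have [g g0 vg] := valu_scalar Av piu k.
  have ug := cdv_unit Av g0.
  rewrite -(actVK VW ug Wx); apply: (norm_anti NM (t := k%:~R * st + t0)).
    by rewrite -lerBlDr -ler_pdivrMr //; have /andP[_] := ceil_itv ((t - t0) / st).
  apply: (norm_act NM); first by rewrite vg.
  apply: L0M; have -> : 0 = - (k%:~R * st) + k%:~R * st by rewrite addNr.
  by apply: Lact; rewrite ?(valuV vv ug vg).
Qed.

Lemma lattice_functionP L : is_lattice_function v act W st L <-> is_norm v act W L.
Proof. by split; [exact: lattice_function_is_norm|exact: norm_lattice_function]. Qed.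

End Lattices.

End NormConstruction.

(** * Passage to the converse ring *)

Section ConverseRing.
Variables (R : realType) (A : unitRingType) (v : A -> \bar R).

Lemma is_valuation_conv : is_valuation v -> @is_valuation R A^c v.
Proof.
move=> vv; split; [exact: valuation_gtNy vv|exact: valuation_eqy vv| |exact: valuationD vv].
by move=> x y; rewrite addeC; exact: (valuationM vv y x).
Qed.

Lemma is_cdv_conv : is_cdv v -> @is_cdv R A^c v.
Proof.
move=> Av; split; [exact: cdv_unit Av|exact: is_valuation_conv (cdv_val Av)|
  exact: cdv_pi Av|exact: cdv_complete Av].
Qed.

Lemma is_lattice_function_conv (V : zmodType) (act : A -> V -> V) W st L :
  is_lattice_function v act W st L <-> @is_lattice_function R A^c v V act W st L.
Proof. by split=> -[]; split. Qed.

End ConverseRing.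

(** * Valuations on finite-dimensional division algebras *)

Section FiniteDimensional.
Variables (R : realType) (K : fieldType) (nu : K -> \bar R) (D : falgType K) (w : D -> \bar R).
Hypothesis Kv : is_cdv nu.
Hypothesis D_unit : forall x : D, x != 0 -> x \is a GRing.unit.
Hypothesis w_ext : extends_valuation nu w.
Let wv : is_valuation w := w_ext.1.

Lemma extM c x : w (c *: x) = (nu c + w x)%E.
Proof. by rewrite -mulr_algl (valuationM wv) w_ext.2. Qed.

Lemma falg_space : @is_space K D *:%R setT.
Proof.
split=> //; do ?by move=> *; rewrite ?scalerDl ?scalerDr ?scalerA ?scale1r.
exists (\dim {:D}), (fun i => (vbasis {:D})`_i); split=> // x _.
exists (fun i => coord (vbasis {:D}) i x).
exact: coord_vbasis (memvf x).
Qed.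

Definition val_filtration (t : R) : set D := [set x | (t%:E <= w x)%E].

Lemma val_norm : is_norm nu *:%R setT val_filtration.
Proof.
split=> //; rewrite /val_filtration /=.
- by move=> t; rewrite (valu0 wv) leey.
- by move=> t x y; exact: (valuB_ge wv).
- move=> t x _ H; have [->|x0] := eqVneq x 0; first by rewrite (valu0 wv) leey.
  have [r vr] := valu_fin wv x0; rewrite vr lee_fin leNgt; apply/negP => rt.
  have := H ((r + t) / 2); rewrite vr lee_fin ltr_pdivrMr // ler_pdivrMr //; lra.
- by move=> s t x st; apply: le_trans; rewrite lee_fin.
- move=> x _; have [->|x0] := eqVneq x 0; first by exists 0; rewrite (valu0 wv) leey.
  by have [r ->] := valu_fin wv x0; exists r.
- by move=> x _; exact: (valu_eq0 wv).
- by move=> s t a x sa tx; rewrite extM EFinD leeD.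
Qed.

Lemma val_orth_basis : exists n (b : 'I_n -> D) (c : 'I_n -> R),
  orth_basis nu *:%R setT val_filtration b c.
Proof. exact: orth_basis_exists falg_space _ val_norm Kv. Qed.

Lemma val_orthE (J : finType) (b : J -> D) (c : J -> R) :
  orth_basis nu *:%R setT val_filtration b c -> forall j, w (b j) = (c j)%:E.
Proof.
by move=> bL j; apply: ereal_cut => t; exact: (orth1_gen Kv falg_space bL t j).
Qed.

(** The valuation is a norm over K, so D has an orthogonal basis. Completeness holds coordinatewise,
    and the values lie in finitely many cosets c_j + Z st, so there is a least positive one. *)
Lemma falg_cdv : is_cdv w.
Proof.
have [n [b [c bL]]] := val_orth_basis; have [pi piu] := cdv_pi Kv.
have st0 := step_gt0 piu; set st := fine (nu pi) in st0.
have wb := val_orthE bL.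
have setTE : setT = aspan *:%R b by apply/seteqP; split => // x; exact: (orth_span bL).
have bL' : orth_basis nu *:%R (aspan *:%R b) val_filtration b c by rewrite -setTE.
split=> //.
- have /choice[g gP] j : exists g, nu g = ((Num.floor (- c j / st) + 1)%:~R * st)%:E.
    by have [g] := valu_scalar Kv piu (Num.floor (- c j / st) + 1); exists g.
  pose d j := (Num.floor (- c j / st) + 1)%:~R * st + c j.
  have wd j : w (g j *: b j) = (d j)%:E by rewrite extM gP wb.
  have d0 j : 0 < d j.
    have /andP[_] := floor_itv (- c j / st).
    by rewrite ltr_pdivrMr // /d; lra.
  have dmin x : (0 < w x)%E -> exists j, ((d j)%:E <= w x)%E.
    have [->|x0] := eqVneq x 0.
      have [j _] : exists (j : 'I_n) (a : K), a != 0 /\ nu a = (0 - c j)%:E.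
        apply: (orth_value Kv bL' (oner_neq0 D)).
        - by rewrite -setTE.
        - by move=> t; rewrite /val_filtration /= (valu1 wv) lee_fin.
      by move=> _; exists j; rewrite (valu0 wv) leey.
    have [r vr] := valu_fin wv x0; rewrite vr lte_fin => r0.
    have [j [a [a0 va]]] : exists (j : 'I_n) (a : K), a != 0 /\ nu a = (r - c j)%:E.
      apply: (orth_value Kv bL' x0).
      - by rewrite -setTE.
      - by move=> t; rewrite /val_filtration /= vr lee_fin.
    exists j; rewrite lee_fin.
    have [k] := valu_discrete Kv piu a0; rewrite va -/st => -[rk].
    have /andP[fl _] := floor_itv (- c j / st).
    have : Num.floor (- c j / st) < k.
      by rewrite -(ltr_int R); apply: le_lt_trans fl _; rewrite ltr_pdivrMr //; lra.
    rewrite -lezD1 -(ler_int R) -(ler_pM2r st0) /d; lra.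
  have [j0 _] : exists j0 : 'I_n, ((d j0)%:E <= w 0%R)%E by apply: dmin; rewrite (valu0 wv) ltey.
  pose j1 := [arg min_(j < j0) d j]%O.
  have j1P j : d j1 <= d j by rewrite /j1; case: arg_minP => // i _; apply.
  exists (g j1 *: b j1); split; rewrite ?wd ?lte_fin ?ltey //.
  by move=> x /dmin[j]; apply: le_trans; rewrite lee_fin.
- move=> u uC; have uspan n0 : aspan *:%R b (u n0) by rewrite -setTE.
  have [l _ lP] := orth_complete falg_space Kv bL' uspan uC.
  by exists l.
Qed.

End FiniteDimensional.

Lemma local_field_cdv (R : realType) (k : fieldType) (nu : k -> \bar R) :
  is_local_field nu -> is_cdv nu.
Proof.
move=> [vv vg cmp _]; split=> //.
- by move=> x; rewrite unitfE.
- have [pi p0 vp] : [set nu x | x in [set x | x != 0]] 1%:E.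
    by rewrite vg; exists 1 => //; rewrite ?mulr1z.
  exists pi; rewrite /is_uniformizer vp; split; rewrite ?lte_fin ?ltey // => x x0.
  have [->|nx0] := eqVneq x 0; first by rewrite (valu0 vv) leey.
  have : [set nu x | x in [set x | x != 0]] (nu x) by exists x.
  rewrite vg => -[n _ vn]; move: x0; rewrite -vn lte_fin lee_fin.
  by rewrite ltr0z gtz0_ge1 -(ler_int R).
- move=> u uC; have [|l lP] := cmp u.
    by move=> N; apply: uC.
  exists l => t; have [N tN] := nat_above t; have [n0 n0P] := lP N.
  by exists n0 => n /n0P; apply: le_trans; rewrite lee_fin.
Qed.

Lemma extends_valu_nat (R : realType) (F : fieldType) (A : falgType F) (v : F -> \bar R)
  (w : A -> \bar R) (n : nat) : extends_valuation v w -> w n%:R = v n%:R.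
Proof. by move=> [_ <-]; rewrite scaler_nat. Qed.

(** With p odd, 1 = p - 2 (p-1)/2, so 2 cannot lie in the maximal ideal along with p. *)
Lemma odd_residue_valu2 (R : realType) (k : fieldType) (nu : k -> \bar R) :
  is_valuation nu -> odd_residue_char nu -> nu 2%:R = 0%E.
Proof.
move=> vv [p [_ po vp]].
have vnat n : (0 <= nu n%:R)%E.
  elim: n => [|n IH]; first by rewrite (valu0 vv) leey.
  by rewrite -natr1; apply: (valuD_ge vv) => //; rewrite (valu1 vv).
apply/eqP; rewrite eq_le vnat andbT leNgt; apply/negP => v2.
have : (0 < nu 1%R)%E.
  have -> : 1 = p%:R - (p./2)%:R * 2%:R :> k.
    by rewrite -natrM muln2 -{1}(odd_double_half p) po natrD addrK.
  apply: (valuD_gt vv) => //; rewrite (valuN vv) (valuationM vv).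
  by apply: lt_le_trans v2 _; rewrite leeDr.
by rewrite (valu1 vv) ltxx.
Qed.

(** * Ring maps and involutions preserve valuations *)

Section SquareRoots.
Variables (R : realType) (A : unitRingType) (v : A -> \bar R).
Hypotheses (Av : is_cdv v) (v2 : v 2%:R = 0%E).
Let vv := cdv_val Av.

(* The root is 1 + z with z the limit of z |-> (x - z ^ 2) / 2. *)
Lemma one_unit_sqrt x : (0 < v x)%E -> exists2 y, y * y = 1 + x & (0 < v (y - 1))%E.
Proof.
move=> x0; have [pi piu] := cdv_pi Av; have st0 := step_gt0 piu.
set st := fine (v pi) in st0.
have vx : (st%:E <= v x)%E by exact: (step_min piu).
have u2 : (2%:R : A) \is a GRing.unit by apply: (cdv_unit Av); exact: (valu_neq0 vv v2).
pose h : A := 2%:R^-1.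
have vh : v h = 0%E by rewrite (valuV vv u2 v2) oppr0.
have hC y : GRing.comm y h by apply: commrV; exact: commr_nat.
pose z n : A := iter n (fun z => h * (x - z * z)) 0.
have zS n : z n.+1 = h * (x - z n * z n) by [].
have zC y : GRing.comm y x -> forall n, GRing.comm y (z n).
  move=> yx; elim=> [|n IH]; first exact: commr0.
  rewrite zS; apply: commrM; first exact: hC.
  by apply: commrB => //; exact: commrM.
have zz m n : GRing.comm (z m) (z n) by apply: (zC) => //; apply: commr_sym; apply: (zC).
have zv n : (st%:E <= v (z n))%E.
  elim: n => [|n IH]; first by rewrite (valu0 vv) leey.
  rewrite zS -[st]add0r; apply: (valuM_ge vv); first by rewrite vh.
  apply: (valuB_ge vv) => //; apply: le_trans (valuM_ge vv IH IH).
  by rewrite lee_fin; lra.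
have sqd a b : GRing.comm a b -> (x - a * a) - (x - b * b) = (a - b) * (- (a + b)).
  move=> ab; rewrite opprB [LHS]addrC addrA subrK mulrN mulrDr !mulrBl ab opprD !opprB.
  by rewrite [RHS]addrC addrA subrK.
have zd n : ((n.+1%:R * st)%:E <= v (z n.+1 - z n))%E.
  elim: n => [|n IH].
    by rewrite mul1r /z /= subr0 mulr0 subr0 (valuationM vv) vh add0e.
  have -> : z n.+2 - z n.+1 = h * ((x - z n.+1 * z n.+1) - (x - z n * z n)).
    by rewrite mulrBr -!zS.
  rewrite sqd; last exact: zz.
  rewrite (valuationM vv) vh add0e.
  have -> : n.+2%:R * st = n.+1%:R * st + st by rewrite -(natr1 n.+1); ring.
  by apply: (valuM_ge vv) => //; rewrite (valuN vv); exact: (valuD_ge vv).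
have zfar n m : ((n.+1%:R * st)%:E <= v (z (n + m)%N - z n))%E.
  elim: m => [|m IH]; first by rewrite addn0 subrr (valu0 vv) leey.
  rewrite addnS -(subrK (z (n + m)%N) (z _)) -addrA; apply: (valuD_ge vv) => //.
  by apply: le_trans (zd _); rewrite lee_fin ler_pM2r // ler_nat ltnS leq_addr.
have near (t : R) : exists n : nat, t <= n%:R * st.
  by have [n tn] := nat_above (t / st); exists n; rewrite -ler_pdivrMr.
have [|l lP] := cdv_complete Av (u := z).
  move=> t; have [n0 tn0] := near t; exists n0 => m n n0m n0n.
  have H k : (n0 <= k)%N -> (t%:E <= v (z k - z n0))%E.
    move=> n0k; rewrite -(subnKC n0k); apply: le_trans (zfar _ _).
    by rewrite lee_fin (le_trans tn0) // ler_pM2r // ler_nat.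
  have -> : z m - z n = (z m - z n0) - (z n - z n0) by rewrite opprB addrA subrK.
  by apply: (valuB_ge vv); exact: H.
have vl : (st%:E <= v l)%E.
  have [n0 n0P] := lP st; have -> : l = z n0 - (z n0 - l) by rewrite opprB addrC subrK.
  by apply: (valuB_ge vv) => //; exact: n0P.
exists (1 + l); last first.
  by rewrite addrAC subrr add0r; apply: lt_le_trans vl; rewrite lte_fin.
suff /eqP : l * l + 2%:R * l - x = 0.
  rewrite subr_eq0 => /eqP <-; rewrite mulrDl mul1r mulrDr mulr1.
  by rewrite mulr_natl mulr2n [l * l + _]addrC !addrA.
apply: (valu_eq0 vv) => t; have [n0 n0P] := lP t.
pose n := n0; have Hn := n0P n (leqnn _); have HSn := n0P n.+1 (leqnSn _).
have -> : l * l + 2%:R * l - x = - (l * (z n - l)) - (z n - l) * z n - 2%:R * (z n.+1 - l).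
  have -> : 2%:R * (z n.+1 - l) = x - z n * z n - 2%:R * l.
    by rewrite mulrBr zS mulrA divrr // mul1r.
  rewrite mulrBr mulrBl !opprB [_ + (l * z n - _)]addrA subrK -!addrA; congr (_ + _).
  by rewrite [RHS]addrCA; congr (_ + _); rewrite addrA addNr add0r.
have t0 u y : (t%:E <= v u)%E -> (0%:E <= v y)%E -> (t%:E <= v (u * y))%E.
  by move=> tu y0; rewrite -[t]addr0; exact: (valuM_ge vv).
have t0' u y : (0%:E <= v u)%E -> (t%:E <= v y)%E -> (t%:E <= v (u * y))%E.
  by move=> tu y0; rewrite -[t]add0r; exact: (valuM_ge vv).
have vst y : (st%:E <= v y)%E -> (0%:E <= v y)%E by apply: le_trans; rewrite lee_fin ltW.
apply: (valuB_ge vv); last by apply: t0' => //; rewrite v2.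
apply: (valuB_ge vv); first by rewrite (valuN vv); apply: t0' => //; exact: vst.
by apply: t0 => //; exact: vst.
Qed.

Lemma one_unit_root n x : (0 < v x)%E -> exists y, y ^+ (2 ^ n) = 1 + x.
Proof.
elim: n x => [|n IH] x x0; first by exists (1 + x).
have [y yx y1] := one_unit_sqrt x0.
have [z zy] := IH _ y1; exists z.
by rewrite expnSr exprM zy addrC subrK expr2.
Qed.

End SquareRoots.

Section RingMaps.
Variables (R : realType) (A B : unitRingType) (v : A -> \bar R) (w : B -> \bar R).
Hypotheses (Av : is_cdv v) (Bw : is_cdv w) (v2 : v 2%:R = 0%E).
Variable f : A -> B.
Hypotheses (fD : forall x y, f (x + y) = f x + f y)
  (fX : forall x, f (x * x) = f x * f x)
  (fM : forall x y, w (f (x * y)) = (w (f x) + w (f y))%E)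
  (f_inj : forall x, f x = 0 -> x = 0).
Let vv := cdv_val Av.
Let ww := cdv_val Bw.

Lemma ring_map0 : f 0 = 0.
Proof. by apply: (addIr (f 0)); rewrite -fD !add0r. Qed.

Lemma ring_map_neq0 x : x != 0 -> f x != 0.
Proof. by apply: contra => /eqP/f_inj->. Qed.

Lemma ring_map1 : f 1 = 1.
Proof.
have u1 := cdv_unit Bw (ring_map_neq0 (oner_neq0 A)).
by apply: (mulrI u1); rewrite -fX !mulr1.
Qed.

Lemma ring_map_valX x n : w (f (x ^+ n)) = w (f x ^+ n).
Proof.
elim: n => [|n IH]; first by rewrite !expr0 ring_map1.
by rewrite !exprS fM IH (valuationM ww).
Qed.

(** The element 1 + x has 2^n-th roots for all n, so the value of its image is divisible by every
    power of 2 in Z st and must vanish. Hence f x has no pole. The hypotheses on f involve products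
    only through squares and values, so that anti-homomorphisms are covered too. *)
Lemma ring_map_pos x : (0 < v x)%E -> (0 <= w (f x))%E.
Proof.
move=> x0; have [pi piu] := cdv_pi Bw; have st0 := step_gt0 piu.
have fx1 : f (1 + x) = 1 + f x by rewrite fD ring_map1.
have n0 : 1 + x != 0.
  apply/eqP => E; have : v (-1) = v x.
    by congr v; apply/eqP; rewrite eq_sym -subr_eq0 opprK addrC E.
  by rewrite (valuN vv) (valu1 vv) => E'; rewrite -E' ltxx in x0.
have [k kv] := valu_discrete Bw piu (ring_map_neq0 n0).
have k0 : k = 0.
  have [y yx] := one_unit_root Av v2 `|k|.+1 x0.
  have y0 : y != 0.
    by apply: contraNneq n0 => y0; rewrite -yx y0 expr0n expn_eq0.
  have [m mv] := valu_discrete Bw piu (ring_map_neq0 y0).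
  have : w (f (1 + x)) = w (f y ^+ (2 ^ `|k|.+1)) by rewrite -yx ring_map_valX.
  rewrite (valuX ww _ mv) kv => -[] /eqP.
  rewrite mulrA (inj_eq (mulIf (lt0r_neq0 st0))) => /eqP E.
  have : k = (2 ^ `|k|.+1)%:Z * m by apply/eqP; rewrite -(eqr_int R) E intrM.
  move/(congr1 absz); rewrite abszM absz_nat => E'.
  case: (posnP `|m|%N) => [m0|m0].
    by apply/eqP; rewrite -absz_eq0 E' m0 muln0.
  have : (`|k| < `|k|)%N; last by rewrite ltnn.
  rewrite {2}E'; apply: leq_trans (leq_pmulr _ m0).
  exact: ltn_trans (ltnSn _) (ltn_expl _ _).
rewrite leNgt; apply/negP => fx0.
have : w (1 + f x) = w (f x) by rewrite addrC valu_dom // (valu1 ww).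
by rewrite -fx1 kv k0 mul0r => E; rewrite -E ltxx in fx0.
Qed.

(** If f x had a pole, so would f (x^n pi) for large n, although x^n pi lies in the maximal
    ideal. *)
Lemma ring_map_nonneg x : (0 <= v x)%E -> (0 <= w (f x))%E.
Proof.
move=> x0; have [pi piu] := cdv_pi Av.
have p0 : pi != 0 by apply: (valu_neq0 vv (step_val piu)).
have [s ws] := valu_fin ww (ring_map_neq0 p0).
have [->|nx0] := eqVneq x 0; first by rewrite ring_map0 (valu0 ww) leey.
have [r wr] := valu_fin ww (ring_map_neq0 nx0).
rewrite wr lee_fin leNgt; apply/negP => r0.
have [n ns] := nat_above ((s + 1) / - r).
have : (0 <= w (f (x ^+ n * pi)))%E.
  apply: ring_map_pos; rewrite (valuationM vv).
  apply: lt_le_trans (_ : 0%E < v pi)%E _; first by case: piu.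
  rewrite leeDr //; have [z vz] := valu_fin vv nx0.
  by rewrite (valuX vv n vz) lee_fin mulr_ge0 //; rewrite vz in x0.
rewrite fM ring_map_valX (valuX ww n wr) ws -EFinD lee_fin.
move: ns; rewrite ler_pdivrMr ?oppr_gt0 //; lra.
Qed.

(** Preservation of integrality, applied to x^n c^(-m), compares the two valuations up to an error
    that n makes negligible. The element c fixes the scale, and the inverse of x gives the opposite
    inequality. *)
Lemma ring_map_val c a : v c = a%:E -> w (f c) = a%:E -> 0 < a -> forall x, w (f x) = v x.
Proof.
move=> vc wc a0.
have c0 := valu_neq0 vv vc; have uc := cdv_unit Av c0.
have vcV := valuV vv uc vc.
have wcV : w (f c^-1) = (- a)%:E.
  have cV0 : c^-1 != 0 by rewrite invr_eq0.
  have [s ws] := valu_fin ww (ring_map_neq0 cV0); rewrite ws; congr (_%:E).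
  by have := fM c c^-1; rewrite divrr // ring_map1 (valu1 ww) wc ws -EFinD => -[]; lra.
have le x r s : v x = r%:E -> w (f x) = s%:E -> r <= s.
  move=> vx wx; rewrite leNgt; apply/negP => sr.
  (* With n (r - s) at least a and m = floor(n r / a), the element x^n c^(-m) is integral while its
     image has value n s - m a < 0. *)
  have [n na] := nat_above (a / (r - s)).
  move: na; rewrite ler_pdivrMr ?subr_gt0 // => na.
  pose m := Num.floor (n%:R * r / a).
  have /andP[] := floor_itv (n%:R * r / a).
  rewrite -/m intrD ler_pdivlMr // ltr_pdivrMr // mulrDl mul1r => le1 lt1.
  have [g [vg wg]] : exists g, v g = (- m%:~R * a)%:E /\ w (f g) = (- m%:~R * a)%:E.
    case: (m) => k.
      exists (c^-1 ^+ k); rewrite ring_map_valX (valuX vv _ vcV) (valuX ww _ wcV).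
      by split; congr (_%:E); rewrite mulrN mulNr.
    exists (c ^+ k.+1); rewrite ring_map_valX (valuX vv _ vc) (valuX ww _ wc).
    by split; congr (_%:E); rewrite NegzE mulrNz opprK.
  have : (0 <= w (f (x ^+ n * g)))%E.
    apply: ring_map_nonneg; rewrite (valuationM vv) (valuX vv _ vx) vg -EFinD lee_fin.
    by rewrite mulNr subr_ge0.
  rewrite fM ring_map_valX (valuX ww _ wx) wg -EFinD lee_fin; lra.
move=> x; have [->|x0] := eqVneq x 0; first by rewrite ring_map0 (valu0 vv) (valu0 ww).
have [r vr] := valu_fin vv x0; have [s ws] := valu_fin ww (ring_map_neq0 x0).
rewrite vr ws; congr (_%:E); apply/eqP; rewrite eq_le (le _ _ _ vr ws) andbT.
have ux := cdv_unit Av x0; have xV0 : x^-1 != 0 by rewrite invr_eq0.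
have [s' ws'] := valu_fin ww (ring_map_neq0 xV0).
have := le _ _ _ (valuV vv ux vr) ws'.
by have := fM x x^-1; rewrite divrr // ring_map1 (valu1 ww) ws ws' -EFinD => -[]; lra.
Qed.

End RingMaps.

(** Only the value k st of rho(pi) is in question. Integrality is preserved, so k >= 0. If k >= 2,
    then rho(pi) pi^(-2) is integral but its image is not; if k = 0, the inverse of rho(pi) is a
    unit with image of negative value. *)
Lemma involution_valu (R : realType) (A : unitRingType) (v : A -> \bar R) (rho : A -> A) :
  is_cdv v -> v 2%:R = 0%E -> is_involution rho -> forall x, v (rho x) = v x.
Proof.
move=> Av v2 [rD rM rK]; have vv := cdv_val Av.
have r0 : rho 0 = 0 by apply: (addIr (rho 0)); rewrite -rD !add0r.
have rX x : rho (x * x) = rho x * rho x by [].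
have rvM x y : v (rho (x * y)) = (v (rho x) + v (rho y))%E.
  by rewrite rM (valuationM vv) addeC.
have rinj x : rho x = 0 -> x = 0 by move=> E; rewrite -(rK x) E.
have nonneg := ring_map_nonneg Av Av v2 rD rX rvM rinj.
have [pi piu] := cdv_pi Av; have st0 := step_gt0 piu; have vp := step_val piu.
set st := fine (v pi) in st0 vp.
apply: (ring_map_val Av Av v2 rD rX rvM rinj vp _ st0).
have p0 := valu_neq0 vv vp; have up := cdv_unit Av p0.
have rp0 : rho pi != 0 by apply: contra p0 => /eqP/rinj->.
have [k] := valu_discrete Av piu rp0; rewrite -/st => vk.
have v' := valuV vv up vp.
have k0 : 0 <= k.
  have := nonneg pi; rewrite vp vk !lee_fin => /(_ (ltW st0)).
  by rewrite pmulr_lge0 // ler0z.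
have vrV : v (rho pi^-1) = (- (k%:~R * st))%:E.
  have rV0 : rho pi^-1 != 0.
    by apply/eqP => /rinj/eqP; rewrite invr_eq0 (negPf p0).
  have [s vs] := valu_fin vv rV0; rewrite vs; congr (_%:E).
  have r1 : v (rho 1) = 0%E by rewrite (ring_map1 Av rX rinj) (valu1 vv).
  by have := rvM pi pi^-1; rewrite divrr // r1 vk vs -EFinD => -[]; lra.
rewrite vk; congr (_%:E); suff -> : k = 1 by rewrite mul1r.
apply/eqP; rewrite eq_le -gtz0_ge1 lt_neqAle k0 andbT; apply/andP; split.
  rewrite leNgt; apply/negP => k1.
  have := nonneg (rho pi * (pi^-1 * pi^-1)); rewrite rvM rK rvM vrV vp.
  rewrite !(valuationM vv) vk v' -!EFinD !lee_fin => H.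
  have k2 : 2 <= k%:~R :> R by rewrite -[2]/(2%:~R) ler_int -lezD1 in k1 *.
  have : 0 <= k%:~R * st + (- st - st) by rewrite -subr_ge0 in k2; nra.
  by move/H; nra.
apply/eqP => k00; rewrite -k00 mul0r in vk.
have uV : v (rho pi)^-1 = 0%E by rewrite (valuV vv (cdv_unit Av rp0) vk) oppr0.
have := nonneg (rho pi)^-1; rewrite uV lexx => /(_ isT).
have := rvM (rho pi) (rho pi)^-1; rewrite divrr ?(cdv_unit Av) // rK vp.
rewrite (ring_map1 Av rX rinj) (valu1 vv).
by case: (v _) => [s| |] //; rewrite -EFinD lee_fin => -[]; lra.
Qed.

Lemma linear_lfun (R : nzRingType) (aT rT : vectType R) (f : aT -> rT) :
  (forall x y, f (x + y) = f x + f y) -> (forall a x, f (a *: x) = a *: f x) ->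
  exists g : 'Hom(aT, rT), forall x, g x = f x.
Proof.
move=> fD fZ; have fL : linear f by move=> a x y; rewrite fD fZ.
pose fM := GRing.isLinear.Build _ _ _ _ f fL.
pose F : {linear _ -> _} := HB.pack f fM.
by exists (linfun f) => x; rewrite (lfunE F).
Qed.

(** * Central division algebras over local fields *)

Section CentralDivision.
Variables (F : fieldType) (D : falgType F).
Hypothesis D_central : is_central_division D.
Let D_unit := D_central.1.

Lemma alg_comm (c : F) (x : D) : c%:A * x = x * c%:A.
Proof. by rewrite mulr_algl mulr_algr. Qed.

(* Injectivity of the sandwich map from D (x) D^op to End(D), by minimality of *)
(* the number of terms: commuting with x kills the term with coefficient 1.    *)
Lemma sandwich_inj n (b c : 'I_n -> D) :
  (forall a : 'I_n -> F, \sum_i a i *: b i = 0 -> forall i, a i = 0) ->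
  (forall z, \sum_i b i * z * c i = 0) -> forall i, c i = 0.
Proof.
elim: n b c => [|n IH] b c bfree bc j; first by case: j.
apply/eqP; apply: contraT => cj0; have uj := D_unit cj0.
pose c' i := c i / c j.
have bc' z : \sum_i b i * z * c' i = 0.
  by under eq_bigr do rewrite mulrA; rewrite -mulr_suml bc mul0r.
have c'j : c' j = 1 by rewrite /c' divrr.
have c'C x i : x * c' i - c' i * x = 0.
  case: (unliftP j i) => [i' ->|->]; last by rewrite c'j mulr1 mul1r subrr.
  apply: (IH (fun i => b (lift j i)) (fun i => x * c' (lift j i) - c' (lift j i) * x)).
    move=> a a0 k; pose a' i := oapp a 0 (unlift j i).
    have <- : a' (lift j k) = a k by rewrite /a' liftK.
    apply: bfree; rewrite (bigD1_ord j) //= /a' unlift_none scale0r add0r.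
    by under eq_bigr do rewrite liftK.
  move=> z; apply: (addrI (b j * z * x)); rewrite addr0.
  transitivity (\sum_i b i * (z * x) * c' i - (\sum_i b i * z * c' i) * x + b j * z * x).
    rewrite mulr_suml !(bigD1_ord j) //= c'j !mulr1 mulrA opprD addrACA subrr add0r -sumrB [RHS]addrC.
    by congr (_ + _); apply: eq_bigr => k _; rewrite mulrBr !mulrA.
  by rewrite !bc' mul0r subrr add0r.
have /choice[f fP] i : exists f : F, c' i = f%:A.
  by apply/(D_central.2) => x; apply/eqP; rewrite -subr_eq0 -opprB c'C oppr0.
have := bfree f _ j; have := c'j; rewrite fP => fj H.
have f0 : f j = 0.
  by apply: H; have := bc' 1; under eq_bigr do rewrite fP mulr1 mulr_algr.
by move: fj; rewrite f0 scale0r => /esym/eqP; rewrite oner_eq0.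
Qed.

Let N := \dim {:D}.
Let bs (i : 'I_N) : D := (vbasis {:D})`_i.

Lemma vbasis_indep (U : {vspace D}) (a : 'I_(\dim U) -> F) :
  \sum_i a i *: (vbasis U)`_i = 0 -> forall i, a i = 0.
Proof. by move=> a0; have /freeP := basis_free (vbasisP U); apply. Qed.

Lemma vbasis_sum x : x = \sum_i coord (vbasis {:D}) i x *: bs i.
Proof. exact: coord_vbasis (memvf x). Qed.

(** The sandwich map from families (y_i) to End(D) is injective, and both sides have dimension N^2
    over F. *)
Lemma sandwich_surj (f : D -> D) :
  (forall x y, f (x + y) = f x + f y) -> (forall a x, f (a *: x) = a *: f x) ->
  exists y : 'I_N -> D, forall z, f z = \sum_i bs i * z * y i.
Proof.
move=> fD fZ; have [g gE] := linear_lfun fD fZ.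
pose P (y : {ffun 'I_N -> D}) : 'End(D) := \sum_i (amulr (y i) \o amull (bs i))%VF.
have PE y z : P y z = \sum_i bs i * z * y i.
  by rewrite sum_lfunE; apply: eq_bigr => i _; rewrite !lfunE /= !lfunE.
have PD x y : P (x + y) = P x + P y.
  apply/lfunP => z; rewrite add_lfunE !PE -big_split; apply: eq_bigr => i _.
  by rewrite ffunE mulrDr.
have PZ a x : P (a *: x) = a *: P x.
  apply/lfunP => z; rewrite scale_lfunE !PE scaler_sumr; apply: eq_bigr => i _.
  by rewrite ffunE scalerAr.
have [h hP] := linear_lfun PD PZ.
have kh : lker h == 0%VS.
  apply/lker0P => x y; rewrite !hP => E; apply/eqP; rewrite -subr_eq0; apply/eqP/ffunP => i.
  rewrite !ffunE; apply: (@sandwich_inj _ bs (fun i => x i - y i)) => [a|z].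
    exact: vbasis_indep.
  have := congr1 (fun u : 'End(D) => u z) E; rewrite !PE => E'.
  by under eq_bigr do rewrite mulrBr; rewrite sumrB E' subrr.
have : (limg h == fullv)%VS.
  rewrite eqEdim subvf limg_dim_eq ?(eqP kh) ?capv0 //=.
  by rewrite !dimvf /dim /= card_ord /N dimvf.
move=> /eqP hfull.
have /memv_imgP[y _ gy] : g \in limg h by rewrite hfull memvf.
by exists y => z; rewrite -gE gy hP PE.
Qed.

(** The y l j represent the l-th coordinate functional as a sandwich sum. The second clause
    expresses that its values commute with d, the third that z is the sum of its coordinates times
    the basis; both are read off by [sandwich_inj]. They serve in [endo_expand] to cut a map into
    D-linear pieces. *)
Lemma casimir : exists n (b : 'I_n -> D) (y : 'I_n -> 'I_n -> D),
  [/\ forall l z, exists c : F, \sum_j b j * z * y l j = c%:A,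
      forall d, exists2 c : 'I_n -> 'I_n -> F, (forall j, d * b j = \sum_i c i j *: b i) &
        forall l i, \sum_j c i j *: y l j = y l i * d
    & exists2 u : 'I_n -> F, \sum_j u j *: b j = 1 &
        forall j, \sum_l y l j * b l = (u j)%:A].
Proof.
pose lam l (z : D) : D := (coord (vbasis {:D}) l z)%:A.
have /choice[y yP] l : exists y : 'I_N -> D, forall z, lam l z = \sum_i bs i * z * y i.
  apply: sandwich_surj => [x z|a x]; first by rewrite /lam linearD scalerDl.
  by rewrite /lam linearZ /= scalerA.
exists N, bs, y; split.
- by move=> l z; exists (coord (vbasis {:D}) l z); rewrite -yP.
- move=> d; pose c i j := coord (vbasis {:D}) i (d * bs j).
  have cP j : d * bs j = \sum_i c i j *: bs i by exact: vbasis_sum.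
  exists c => // l i; apply/eqP; rewrite -subr_eq0; apply/eqP.
  apply: (@sandwich_inj _ bs (fun i => \sum_j c i j *: y l j - y l i * d)).
    by move=> a; exact: vbasis_indep.
  move=> z; under eq_bigr do rewrite mulrBr; rewrite sumrB.
  under [X in _ - X]eq_bigr do rewrite mulrA; rewrite -mulr_suml -yP.
  under eq_bigr do rewrite mulr_sumr; rewrite exchange_big /=.
  transitivity (d * lam l z - lam l z * d); last by rewrite /lam alg_comm subrr.
  congr (_ - _); rewrite yP mulr_sumr; apply: eq_bigr => j _.
  rewrite mulrA mulrA cP !mulr_suml; apply: eq_bigr => k _.
  by rewrite -scalerAr -!scalerAl.
- pose u j := coord (vbasis {:D}) j 1; exists u; first by rewrite [RHS]vbasis_sum.
  move=> j; apply/eqP; rewrite -subr_eq0; apply/eqP.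
  apply: (@sandwich_inj _ bs (fun j => \sum_l y l j * bs l - (u j)%:A)).
    by move=> a; exact: vbasis_indep.
  move=> z; under eq_bigr do rewrite mulrBr mulr_sumr; rewrite sumrB exchange_big /=.
  apply/eqP; rewrite subr_eq0; apply/eqP; transitivity z.
    rewrite [RHS]vbasis_sum; apply: eq_bigr => l _.
    under eq_bigr do rewrite mulrA; rewrite -mulr_suml -yP.
    by rewrite mulr_algl.
  under eq_bigr do rewrite mulr_algr scalerAl.
  by rewrite -mulr_suml -vbasis_sum mul1r.
Qed.

(** A functional with value 1 at 1, written as a sandwich sum, projects D onto its centre. *)
Lemma casimir_unit : exists n (b y : 'I_n -> D),
  (forall z, exists c : F, \sum_j b j * z * y j = c%:A) /\ \sum_j b j * y j = 1.
Proof.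
have [l l1] : exists l, coord (vbasis {:D}) l 1 != 0.
  apply/existsP; rewrite -negb_forall; apply/negP => /forallP H.
  have := oner_neq0 D; rewrite [1]vbasis_sum big1 ?eqxx // => i _.
  by rewrite (eqP (H i)) scale0r.
pose a := (coord (vbasis {:D}) l 1)^-1.
have [|b x|y yP] := @sandwich_surj (fun z => (a * coord (vbasis {:D}) l z)%:A).
- by move=> x z; rewrite linearD mulrDr scalerDl.
- by rewrite linearZ /= mulrCA scalerA.
- exists N, bs, y; split=> [z|]; first by exists (a * coord (vbasis {:D}) l z); rewrite -yP.
  by under eq_bigr do rewrite -[bs _]mulr1; rewrite -yP /a mulVf // scale1r.
Qed.

(** D is a free left K-module on X. Left multiplications by C(K) and right multiplications by D are
    K-linear, hence determined on X, and by [sandwich_inj] they embed dim C(K) copies of D into |X|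
    copies. *)
Lemma dim_centraliser (K : {aspace D}) : (\dim K * \dim 'C(K) <= N)%N.
Proof.
have field_D : GRing.field_axiom D by exact: D_unit.
have [X [XK dX X0]] := skew_field_module_semisimple field_D (subvf (K * fullv)).
have NX : N = (\dim K * size X)%N.
  rewrite /N -XK (directvP dX) /= -sum1_size big_distrr /= big_seq [RHS]big_seq.
  apply: eq_bigr => x Xx; rewrite muln1 dim_cosetv_unit // field_D //.
  by apply: contraNneq X0 => <-.
pose m := \dim 'C(K); pose x (j : 'I_m) := (vbasis 'C(K))`_j.
have xC j : x j \in 'C(K)%VS by apply: vbasis_mem; rewrite mem_nth // size_tuple.
pose P (y : {ffun 'I_m -> D}) : {ffun 'I_(size X) -> D} :=
  [ffun i : 'I_(size X) => \sum_j x j * X`_i * y j].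
have PD u v : P (u + v) = P u + P v.
  apply/ffunP => i; rewrite !ffunE -big_split; apply: eq_bigr => j _.
  by rewrite ffunE mulrDr.
have PZ a u : P (a *: u) = a *: P u.
  apply/ffunP => i; rewrite !ffunE scaler_sumr; apply: eq_bigr => j _.
  by rewrite ffunE scalerAr.
have [h hP] := linear_lfun PD PZ.
have Psub u v : P (u - v) = P u - P v by rewrite PD -scaleN1r PZ scaleN1r.
have kh : lker h == 0%VS.
  apply/lker0P => u v; rewrite !hP => E; apply/eqP; rewrite -subr_eq0; apply/eqP/ffunP.
  set w := u - v; have {}E : P w = 0 by rewrite Psub E subrr.
  move=> j; rewrite [RHS]ffunE; move: j; apply: (@sandwich_inj _ x w) => [a|z].
    exact: vbasis_indep.
  pose g (z : D) := \sum_j x j * z * w j.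
  have gD z1 z2 : g (z1 + z2) = g z1 + g z2.
    by rewrite -big_split; apply: eq_bigr => j _; rewrite mulrDr mulrDl.
  have gK a z1 : a \in K -> g (a * z1) = a * g z1.
    move=> Ka; rewrite mulr_sumr; apply: eq_bigr => j _.
    by rewrite mulrA (centvP (xC j)) // !mulrA.
  have gX i : (i < size X)%N -> g X`_i = 0.
    by move=> iX; have := congr1 (fun f : {ffun _ -> _} => f (Ordinal iX)) E; rewrite !ffunE.
  have : z \in (\sum_(x <- X) K * <[x]>)%VS by rewrite XK memvf.
  rewrite (big_nth 0) big_mkord => /memv_sumP[f fP ->].
  rewrite -/(g _) (big_morph g gD (_ : g 0 = 0)); last first.
    by rewrite /g big1 // => j _; rewrite mulr0 mul0r.
  rewrite big1 // => i _; have := fP i isT.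
  rewrite -limg_amulr => /memv_imgP[a Ka ->].
  by rewrite lfunE /= gK // gX // mulr0.
have := limgS h (subvf fullv).
have : (\dim (limg h) <= \dim {: {ffun 'I_(size X) -> D}})%N by exact: dimvS (subvf _).
rewrite limg_dim_eq ?(eqP kh) ?capv0 //.
rewrite !dimvf /dim /= !card_ord => H _.
rewrite NX leq_mul2l; apply/orP; right.
have D0 : (0 < dim D)%N by rewrite -dimvf -/N lt0n dimv_eq0 -subv0; apply/negP => /subvP/(_ 1 (memvf _)); rewrite memv0 oner_eq0.
by rewrite -(leq_pmul2r D0).
Qed.

Lemma centraliser_adjoin (x y : D) : x * y = y * x -> y \in 'C(<<1; x>>)%VS.
Proof.
move=> xy; suff : (<<1; x>> <= 'C[y])%VS.
  by move/subvP => H; apply/centvP => z /H/cent1vP ->.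
apply: agenv_sub_modl; first by rewrite -memvE cent1v1.
apply: (@subv_trans _ _ ('C[y] * 'C[y])%VS); last exact: asubv.
by apply: prodvSl; rewrite subv_add -!memvE cent1v1; apply/cent1vP.
Qed.

End CentralDivision.

(** * Residue fields and Teichmueller lifts *)

Definition finite_residue (R : realType) (A : nzRingType) (v : A -> \bar R) :=
  exists s : seq A, forall x : A, val_ring v x -> exists2 y, y \in s & val_ideal v (x - y).

(** Scaling an orthogonal basis by least scalars into the valuation ring, integral elements have
    integral coordinates, and these may be replaced by representatives from s. *)
Lemma falg_finite_residue (R : realType) (K : fieldType) (nu : K -> \bar R)
  (D : falgType K) (w : D -> \bar R) : is_cdv nu -> extends_valuation nu w ->
  finite_residue nu -> finite_residue w.
Proof.
move=> Kv w_ext [s sP]; have wv : is_valuation w := w_ext.1; have kv := cdv_val Kv.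
have [n [b [c bL]]] := val_orth_basis Kv w_ext; have wb := val_orthE Kv bL.
have [pi piu] := cdv_pi Kv; have st0 := step_gt0 piu; set st := fine (nu pi) in st0.
pose q i := Num.ceil (- c i / st).
have /choice[g gP] i : exists g, g != 0 /\ nu g = ((q i)%:~R * st)%:E.
  by have [g] := valu_scalar Kv piu (q i); exists g.
exists [seq \sum_i (g i * ssval (f i)) *: b i | f : {ffun 'I_n -> seq_sub s}] => x x0.
have [a xa] := orth_span bL (I : setT x).
have av i : ((- c i)%:E <= nu (a i))%E.
  have [H _] := orthP bL 0 a; rewrite -[- c i]add0r; apply: H.
  by rewrite -xa /val_filtration.
have uv i : (0 <= nu (a i / g i)%R)%E.
  have ug : g i \is a GRing.unit by rewrite unitfE; have [] := gP i.
  have [->|ai0] := eqVneq (a i) 0; first by rewrite mul0r (valu0 kv) leey.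
  have [m vm] := valu_discrete Kv piu ai0.
  rewrite (valuationM kv) vm (valuV kv ug (gP i).2) -EFinD lee_fin -mulNr -mulrDl.
  have := av i; rewrite vm lee_fin -ler_pdivrMr // -ceil_le_int // => km.
  by rewrite mulr_ge0 ?(ltW st0) // subr_ge0 ler_int.
have /choice[f fP] i : exists f : seq_sub s, val_ideal nu (a i / g i - ssval f).
  by have [y ys yP] := sP _ (uv i); exists (SeqSub ys).
exists (\sum_i (g i * ssval (f i)) *: b i).
  apply/mapP; exists [ffun i => f i]; first by rewrite mem_enum.
  by apply: eq_bigr => i _; rewrite ffunE.
rewrite /val_ideal /= xa -sumrB; apply: (valu_sum_gt wv) => i _.
have -> : a i *: b i - (g i * ssval (f i)) *: b i = (g i * (a i / g i - ssval (f i))) *: b i.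
  by rewrite -scalerBl mulrBr mulrCA divff ?mulr1 //; have [] := gP i.
rewrite (extM w_ext) wb.
have := fP i; rewrite /val_ideal /= => /(valu_mul_gt kv (gP i).2) lt.
have le : 0 <= (q i)%:~R * st + c i.
  have /andP[_] := ceil_itv (- c i / st); rewrite -/(q i) ler_pdivrMr //; lra.
apply: (@le_lt_trans _ _ ((q i)%:~R * st + c i)%:E); first by rewrite lee_fin.
by rewrite EFinD lteD2rE // -[X in X%:E]addr0.
Qed.

Section Residue.
Variables (R : realType) (A : unitRingType) (v : A -> \bar R).
Hypothesis Av : is_cdv v.
Let vv := cdv_val Av.
Variable s : seq A.
Hypothesis sP : forall x : A, val_ring v x -> exists2 y, y \in s & val_ideal v (x - y).

Definition residue_rep (x : A) : A := nth 0 s (find (fun y => 0 < v (x - y)%R)%E s).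

Lemma residue_repP x : (0 <= v x)%E -> residue_rep x \in s /\ (0 < v (x - residue_rep x)%R)%E.
Proof.
move=> /sP[y ys yP]; have hs : has (fun y => 0 < v (x - y)%R)%E s by apply/hasP; exists y.
by split; [rewrite mem_nth // -has_find|exact: (nth_find 0 hs)].
Qed.

Lemma cong_sym x y : (0 < v (x - y)%R)%E = (0 < v (y - x)%R)%E.
Proof. by rewrite valuBC. Qed.

Lemma cong_trans y x z : (0 < v (x - y)%R -> 0 < v (y - z)%R -> 0 < v (x - z)%R)%E.
Proof.
move=> xy yz; have -> : x - z = (x - y) + (y - z) by rewrite addrA subrK.
exact: (valuD_gt vv).
Qed.

Lemma residue_rep_cong x y : (0 < v (x - y)%R)%E -> residue_rep x = residue_rep y.
Proof.
move=> xy; rewrite /residue_rep; congr nth; apply: eq_find => z.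
apply/idP/idP => H; first by apply: (cong_trans _ H); rewrite -cong_sym.
exact: cong_trans xy H.
Qed.

Lemma integral_cong x y : (0 < v (x - y)%R -> 0 <= v x -> 0 <= v y)%E.
Proof.
move=> xy x0; have -> : y = x - (x - y) by rewrite opprB addrC subrK.
by apply: (valuB_ge vv) => //; exact: ltW.
Qed.

(** The residue ring as a finite type: the integral elements of s that are their own representative,
    one in each class. Operations are transported from A by [to_residue]. *)
Definition residue :=
  {y : seq_sub s | (residue_rep (ssval y) == ssval y) && (0 <= v (ssval y))%E}.
HB.instance Definition _ := Finite.on residue.
Definition lift_residue (t : residue) : A := ssval (val t).
Local Notation "t %:L" := (lift_residue t) (at level 2, format "t %:L").

Lemma lift_integral t : (0 <= v t%:L)%E.
Proof. by have /andP[] := valP t. Qed.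

Lemma lift_inj t t' : (0 < v (t%:L - t'%:L)%R)%E -> t = t'.
Proof.
move=> /residue_rep_cong E; apply: val_inj; apply: val_inj.
by have /andP[/eqP + _] := valP t; have /andP[/eqP + _] := valP t'; rewrite /= -E => -> ->.
Qed.

Lemma lift_exists x : exists t : residue, (0 <= v x -> 0 < v (x - t%:L)%R)%E.
Proof.
have ex y : (0 <= v y)%E -> exists t : residue, (0 < v (y - t%:L)%R)%E.
  move=> y0; have [ys yP] := residue_repP y0.
  have H : (residue_rep (ssval (SeqSub ys)) == ssval (SeqSub ys)) && (0 <= v (ssval (SeqSub ys)))%E.
    rewrite /= -(residue_rep_cong yP) eqxx /=; exact: integral_cong yP y0.
  by exists (exist _ (SeqSub ys) H).
have [x0|x0] := pselect (0 <= v x)%E; first by have [t] := ex x x0; exists t.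
by have [t _] := ex 0 (ltac:(by rewrite (valu0 vv) leey)); exists t.
Qed.

Definition to_residue x : residue := projT1 (cid (lift_exists x)).

Lemma to_residueP x : (0 <= v x -> 0 < v (x - (to_residue x)%:L)%R)%E.
Proof. exact: projT2 (cid (lift_exists x)). Qed.

Lemma to_residue_eq x t : (0 < v (x - t%:L)%R)%E -> to_residue x = t.
Proof.
move=> xt; apply: lift_inj; apply: (cong_trans _ xt); rewrite cong_sym; apply: to_residueP.
by apply: (integral_cong _ (lift_integral t)); rewrite cong_sym.
Qed.

Definition residue_add t t' := to_residue (t%:L + t'%:L).
Definition residue_mul t t' := to_residue (t%:L * t'%:L).
Definition residue_opp t := to_residue (- t%:L).
Definition residue0 := to_residue 0.
Definition residue1 := to_residue 1.

Lemma integralD x y : (0 <= v x -> 0 <= v y -> 0 <= v (x + y)%R)%E.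
Proof. exact: (valuD_ge vv). Qed.

Lemma integralM x y : (0 <= v x -> 0 <= v y -> 0 <= v (x * y)%R)%E.
Proof. by move=> x0 y0; rewrite (valuationM vv) adde_ge0. Qed.

Lemma congD x y x' y' : (0 < v (x - x')%R -> 0 < v (y - y')%R -> 0 < v (x + y - (x' + y'))%R)%E.
Proof. by move=> xx yy; rewrite opprD addrACA; exact: (valuD_gt vv). Qed.

Lemma congM x y x' y' : (0 <= v x -> 0 <= v y' -> 0 < v (x - x')%R -> 0 < v (y - y')%R ->
  0 < v (x * y - (x' * y'))%R)%E.
Proof.
move=> x0 y0 xx yy.
have -> : x * y - x' * y' = x * (y - y') + (x - x') * y' by rewrite mulrBr mulrBl addrA subrK.
apply: (valuD_gt vv); rewrite (valuationM vv).
  by apply: lt_le_trans yy _; rewrite leeDr.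
by apply: lt_le_trans xx _; rewrite leeDl.
Qed.

Lemma cong_refl x : (0 < v (x - x)%R)%E.
Proof. by rewrite subrr (valu0 vv) ltey. Qed.

Lemma residue_addP t t' : (0 < v (t%:L + t'%:L - (residue_add t t')%:L)%R)%E.
Proof. by apply: to_residueP; apply: integralD; exact: lift_integral. Qed.

Lemma residue_mulP t t' : (0 < v (t%:L * t'%:L - (residue_mul t t')%:L)%R)%E.
Proof. by apply: to_residueP; apply: integralM; exact: lift_integral. Qed.

Lemma residue0P : (0 < v (0 - residue0%:L)%R)%E.
Proof. by apply: to_residueP; rewrite (valu0 vv) leey. Qed.

Lemma residue1P : (0 < v (1 - residue1%:L)%R)%E.
Proof. by apply: to_residueP; rewrite (valu1 vv). Qed.

Lemma residue_addA : associative residue_add.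
Proof.
move=> a b c; apply: to_residue_eq; apply: (cong_trans _ (residue_addP (residue_add a b) c)).
apply: (@cong_trans (a%:L + b%:L + c%:L)); last first.
  by apply: congD; [exact: residue_addP|exact: cong_refl].
by rewrite -[X in (_ - X)%R]addrA; apply: congD; [exact: cong_refl|rewrite cong_sym; exact: residue_addP].
Qed.

Lemma residue_addC : commutative residue_add.
Proof. by move=> a b; rewrite /residue_add addrC. Qed.

Lemma residue_add0r : left_id residue0 residue_add.
Proof.
move=> a; apply: to_residue_eq; rewrite -[X in (_ - X)%R]add0r.
by apply: congD; [rewrite cong_sym; exact: residue0P|exact: cong_refl].
Qed.

Lemma residue_addNr : left_inverse residue0 residue_opp residue_add.
Proof.
move=> a; apply: to_residue_eq; apply: (cong_trans _ residue0P).
rewrite -(addNr a%:L); apply: congD; last exact: cong_refl.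
by rewrite cong_sym; apply: to_residueP; rewrite (valuN vv) lift_integral.
Qed.

Lemma residue_mulA : associative residue_mul.
Proof.
move=> a b c; apply: to_residue_eq; apply: (cong_trans _ (residue_mulP (residue_mul a b) c)).
have li := lift_integral.
apply: (@cong_trans (a%:L * b%:L * c%:L)); last first.
  by apply: congM => //; [exact: integralM|exact: residue_mulP|exact: cong_refl].
rewrite -mulrA; apply: congM => //; [exact: integralM|exact: cong_refl|].
by rewrite cong_sym; exact: residue_mulP.
Qed.

Lemma residue_mul1r : left_id residue1 residue_mul.
Proof.
have li := lift_integral; move=> a; apply: to_residue_eq; rewrite -[X in (_ - X)%R]mul1r.
by apply: congM => //; [rewrite cong_sym; exact: residue1P|exact: cong_refl].
Qed.

Lemma residue_mulr1 : right_id residue1 residue_mul.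
Proof.
have li := lift_integral; move=> a; apply: to_residue_eq; rewrite -[X in (_ - X)%R]mulr1.
apply: congM => //; [by rewrite (valu1 vv)|exact: cong_refl|by rewrite cong_sym; exact: residue1P].
Qed.

Lemma residue_mulDl : left_distributive residue_mul residue_add.
Proof.
have li := lift_integral; move=> a b c; apply: to_residue_eq.
apply: (cong_trans _ (residue_addP (residue_mul a c) (residue_mul b c))).
apply: (@cong_trans ((a%:L + b%:L) * c%:L)).
  by apply: congM => //; [rewrite cong_sym; exact: residue_addP|exact: cong_refl].
by rewrite mulrDl; apply: congD; exact: residue_mulP.
Qed.

Lemma residue_mulDr : right_distributive residue_mul residue_add.
Proof.
have li := lift_integral; move=> a b c; apply: to_residue_eq.
apply: (cong_trans _ (residue_addP (residue_mul a b) (residue_mul a c))).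
apply: (@cong_trans (a%:L * (b%:L + c%:L))).
  by apply: congM => //; [exact: integralD|exact: cong_refl|rewrite cong_sym; exact: residue_addP].
by rewrite mulrDr; apply: congD; exact: residue_mulP.
Qed.

Lemma residue1_neq0 : residue1 != residue0.
Proof.
apply/eqP => E; have : (0 < v (1 - 0)%R)%E.
  by apply: (cong_trans residue1P); rewrite E cong_sym residue0P.
by rewrite subr0 (valu1 vv) ltxx.
Qed.

HB.instance Definition _ := GRing.isZmodule.Build residue residue_addA residue_addC residue_add0r residue_addNr.
HB.instance Definition _ :=
  GRing.Zmodule_isNzRing.Build residue residue_mulA residue_mul1r residue_mulr1 residue_mulDl residue_mulDr residue1_neq0.

Lemma residue_eq0 (t : residue) : (t == 0) = (0 < v t%:L)%E.
Proof.
apply/eqP/idP => [->|t0]; first by have := residue0P; rewrite sub0r (valuN vv).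
by apply/esym/to_residue_eq; rewrite sub0r (valuN vv).
Qed.

Definition residue_inv (t : residue) : residue := if t == 0 then t else to_residue (t%:L)^-1.

Lemma residue_unit_val (t : residue) : t != 0 -> t%:L \is a GRing.unit /\ v t%:L = 0%E.
Proof.
rewrite residue_eq0 -leNgt => t0; have v0 : v t%:L = 0%E.
  by apply/eqP; rewrite eq_le t0 lift_integral.
by split=> //; apply: (cdv_unit Av); exact: (valu_neq0 vv v0).
Qed.

Lemma residue_invP (t : residue) : t != 0 -> (0 < v ((t%:L)^-1 - (residue_inv t)%:L)%R)%E.
Proof.
move=> t0; have [u v0] := residue_unit_val t0.
by rewrite /residue_inv (negPf t0); apply: to_residueP; rewrite (valuV vv u v0) oppr0.
Qed.

Let unitp : {pred residue} := fun t => t != 0.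

Lemma residue_mulVr : {in unitp, left_inverse 1 residue_inv *%R}.
Proof.
move=> t t0; have [u v0] := residue_unit_val t0; apply: to_residue_eq; apply: (cong_trans _ residue1P).
rewrite -(mulVr u); apply: congM => //; try exact: lift_integral; last exact: cong_refl.
by rewrite cong_sym; exact: residue_invP.
Qed.

Lemma residue_mulrV : {in unitp, right_inverse 1 residue_inv *%R}.
Proof.
move=> t t0; have [u v0] := residue_unit_val t0; apply: to_residue_eq; apply: (cong_trans _ residue1P).
rewrite -(mulrV u); apply: congM; rewrite ?(valuV vv u v0) ?oppr0 //.
- exact: lift_integral.
- exact: cong_refl.
- by rewrite cong_sym; exact: residue_invP.
Qed.

Lemma residue_inv_unit (x y : residue) : y * x = 1 /\ x * y = 1 -> unitp x.
Proof. by move=> [_ xy]; apply: contraNneq residue1_neq0 => x0; rewrite -[residue1]xy x0 mul0r. Qed.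

Lemma residue_inv_out : {in [predC unitp], residue_inv =1 id}.
Proof. by move=> t; rewrite inE negbK /residue_inv => ->. Qed.

HB.instance Definition _ := GRing.NzRing_hasMulInverse.Build residue residue_mulVr residue_mulrV residue_inv_unit residue_inv_out.

Lemma residue_domain : GRing.integral_domain_axiom residue.
Proof.
move=> x y xy; rewrite -implyNb; apply/implyP => x0.
by rewrite -[y](mulKr (x0 : x \is a GRing.unit)) xy mulr0.
Qed.

(** The residue ring is a finite domain, hence a field by Wedderburn, and its unit group is
    cyclic. *)
Lemma residue_cyclic : exists2 g : residue, g != 0 & forall t : residue, t != 0 -> exists i, t = g ^+ i.
Proof.
pose FF : finFieldType := FinDomainFieldType residue_domain.
have /cyclicP[x xE] : cyclic [set: {unit FF}]%G := field_unit_group_cyclic _.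
exists (FinRing.uval x); first by have := valP x; rewrite unitfE.
move=> t t0; have ut : (t : FF) \is a GRing.unit by rewrite unitfE.
have : FinRing.Unit ut \in <[x]>%g by rewrite -xE inE.
move=> /cycleP[i /(congr1 FinRing.uval)]; rewrite FinRing.val_unitX /= => ->.
by exists i.
Qed.

(** Translation by 1 permutes the elements, so it leaves their sum unchanged. *)
Lemma residue_card0 : #|{: residue}|%:R = 0 :> residue.
Proof.
apply: (addrI (\sum_(x : residue) x)); rewrite addr0.
rewrite [RHS](reindex_inj (addIr 1)) big_split /=; congr (_ + _).
by rewrite sumr_const.
Qed.

Lemma lift_nat n : (0 < v (n%:R - (n%:R : residue)%:L)%R)%E.
Proof.
elim: n => [|n IH]; first exact: residue0P.
rewrite -!natr1; apply: (cong_trans _ (residue_addP _ _)).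
by apply: congD => //; exact: residue1P.
Qed.

Lemma lift_exp (t : residue) n : (0 < v (t%:L ^+ n - (t ^+ n)%:L)%R)%E.
Proof.
elim: n => [|n IH]; first exact: residue1P.
rewrite !exprSr; apply: (cong_trans _ (residue_mulP _ _)).
have vt : (0 <= v (t%:L ^+ n))%E.
  by apply: integral_cong (lift_integral (t ^+ n)); rewrite cong_sym.
by apply: congM => //; [exact: lift_integral|exact: cong_refl].
Qed.

Lemma card_residue_gt0 : (0 < #|{: residue}|)%N.
Proof. by apply/card_gt0P; exists 0. Qed.

Let Q := #|{: residue}|.

Lemma valu_card_residue : (0 < v (Q%:R : A))%E.
Proof.
rewrite -[Q%:R]subr0; apply: cong_trans (lift_nat Q) _.
by rewrite residue_card0 cong_sym residue0P.
Qed.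

Variables (pi : A) (piu : is_uniformizer v pi).
Let st := fine (v pi).

Lemma integralX x n : (0 <= v x -> 0 <= v (x ^+ n))%E.
Proof.
move=> x0; elim: n => [|n IH]; first by rewrite expr0 (valu1 vv).
by rewrite exprS; exact: integralM.
Qed.

Lemma congX x y n : (0 <= v x -> 0 <= v y -> 0 < v (x - y)%R -> 0 < v (x ^+ n - y ^+ n)%R)%E.
Proof.
move=> x0 y0 xy; elim: n => [|n IH]; first exact: cong_refl.
by rewrite !exprS; apply: congM => //; exact: integralX.
Qed.

(** The cofactor of x - y in x^Q - y^Q is congruent to Q x^(Q-1), and Q vanishes in the residue
    field. *)
Lemma frobenius_contracts x y t : GRing.comm x y -> (0 <= v x)%E -> (0 <= v y)%E ->
  0 < t -> (t%:E <= v (x - y)%R)%E -> ((t + st)%R%:E <= v (x ^+ Q - y ^+ Q)%R)%E.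
Proof.
move=> xy x0 y0 t0 txy; rewrite (subrXX_comm _ xy); apply: (valuM_ge vv) => //.
apply: (step_min piu).
have cxy : (0 < v (x - y)%R)%E by apply: lt_le_trans txy; rewrite lte_fin.
have -> : \sum_(i < Q) x ^+ (Q.-1 - i) * y ^+ i =
   \sum_(i < Q) x ^+ (Q.-1 - i) * (y ^+ i - x ^+ i) + Q%:R * x ^+ Q.-1.
  have -> : Q%:R * x ^+ Q.-1 = \sum_(i < Q) x ^+ Q.-1.
    by rewrite sumr_const card_ord mulr_natl.
  rewrite -big_split; apply: eq_bigr => i _ /=.
  rewrite mulrBr -exprD subnK ?subrK //.
  by rewrite -ltnS prednK ?card_residue_gt0.
apply: (valuD_gt vv).
  apply: (valu_sum_gt vv) => i _; rewrite (valuationM vv).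
  apply: lt_le_trans (_ : v (y ^+ i - x ^+ i)%R <= _)%E; last by rewrite leeDr ?integralX.
  by apply: congX => //; rewrite cong_sym.
rewrite (valuationM vv); apply: lt_le_trans valu_card_residue _.
by rewrite leeDl ?integralX.
Qed.

(* The Teichmueller lift of a generator of the residue field is the limit of its *)
(* Q-th power iterates.                                                           *)
Lemma teichmuller : exists z M, [/\ (0 < M)%N, z ^+ M = 1, v (M%:R : A) = 0%E, v z = 0%E &
  forall u, v u = 0%E -> exists i, (0 < v (u - z ^+ i)%R)%E].
Proof.
have st0 := step_gt0 piu; rewrite -/st in st0.
have [g g0 gen] := residue_cyclic; have [ug vg] := residue_unit_val g0.
set a := g%:L in ug vg.
have Q0 := card_residue_gt0; rewrite -/Q in Q0.
have gQ : g ^+ Q = g.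
  exact: (expf_card (g : FinDomainFieldType residue_domain)).
have aQ : (0 < v (a ^+ Q - a)%R)%E by have := lift_exp g Q; rewrite gQ.
pose s_ n := a ^+ (Q ^ n).
have ss n : s_ n.+1 = s_ n ^+ Q by rewrite /s_ expnSr exprM.
have sC n x : GRing.comm x a -> GRing.comm x (s_ n) by exact: commrX.
have ssC m n : GRing.comm (s_ m) (s_ n).
  by apply: sC; apply: commr_sym; apply: commrX.
have s0 n : (0 <= v (s_ n))%E by apply: integralX; rewrite vg.
have sd n : ((n.+1%:R * st)%:E <= v (s_ n.+1 - s_ n))%E.
  elim: n => [|n IH]; first by rewrite mul1r /s_ expn0 expn1 expr1; exact: (step_min piu).
  rewrite ss [in X in (_ - X)%R]ss.
  have -> : n.+2%:R * st = n.+1%:R * st + st by rewrite -(natr1 n.+1); ring.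
  by apply: frobenius_contracts => //; rewrite mulr_gt0 // ltr0n.
have sfar n m : ((n.+1%:R * st)%:E <= v (s_ (n + m)%N - s_ n))%E.
  elim: m => [|m IH]; first by rewrite addn0 subrr (valu0 vv) leey.
  rewrite addnS -(subrK (s_ (n + m)%N) (s_ _)) -addrA; apply: (valuD_ge vv) => //.
  by apply: le_trans (sd _); rewrite lee_fin ler_pM2r // ler_nat ltnS leq_addr.
have near (t : R) : exists n : nat, t <= n%:R * st.
  by have [n tn] := nat_above (t / st); exists n; rewrite -ler_pdivrMr.
have [|l lP] := cdv_complete Av (u := s_).
  move=> t; have [n0 tn0] := near t; exists n0 => m n n0m n0n.
  have H k : (n0 <= k)%N -> (t%:E <= v (s_ k - s_ n0))%E.
    move=> n0k; rewrite -(subnKC n0k); apply: le_trans (sfar _ _).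
    by rewrite lee_fin (le_trans tn0) // ler_pM2r // ler_nat.
  have -> : s_ m - s_ n = (s_ m - s_ n0) - (s_ n - s_ n0) by rewrite opprB addrA subrK.
  by apply: (valuB_ge vv); exact: H.
have la : (0 < v (a - l)%R)%E.
  have [n0 n0P] := lP st; apply: (@cong_trans (s_ n0)); last first.
    by apply: lt_le_trans (n0P _ (leqnn _)); rewrite lte_fin.
  rewrite cong_sym; apply: lt_le_trans (sfar 0%N n0).
  by rewrite mul1r lte_fin.
have vl : v l = 0%E by rewrite -vg; apply: (valu_close vv); rewrite vg.
have lC m : GRing.comm l (s_ m).
  apply/eqP; rewrite -subr_eq0; apply/eqP/(valu_eq0 vv) => t.
  have [n0 n0P] := lP t; have {n0P} tl := n0P _ (leqnn n0).
  have -> : l * s_ m - s_ m * l = s_ m * (s_ n0 - l) - (s_ n0 - l) * s_ m.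
    by rewrite mulrBr mulrBl ssC opprB [RHS]addrC addrA subrK.
  apply: (valuB_ge vv).
    by rewrite -[t]add0r; apply: (valuM_ge vv) => //; exact: s0.
  by rewrite -[t]addr0; apply: (valuM_ge vv) => //; exact: s0.
have lQ : l ^+ Q = l.
  apply/eqP; rewrite -subr_eq0; apply/eqP/(valu_eq0 vv) => t.
  have [n0 n0P] := lP (Num.max t st).
  have tl := n0P _ (leqnn n0); have tl' := n0P _ (leqnSn n0).
  have le x : ((Num.max t st)%:E <= v x)%E -> (t%:E <= v x)%E.
    by apply: le_trans; rewrite lee_fin le_max lexx.
  rewrite -(subrK (s_ n0 ^+ Q) (l ^+ Q)) -addrA; apply: (valuD_ge vv); last by rewrite -ss le.
  have := @frobenius_contracts l (s_ n0) (Num.max t st) (lC _); rewrite vl lexx (valuBC vv l).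
  move=> /(_ isT (s0 _) _ tl); rewrite lt_max st0 orbT => /(_ isT); apply: le_trans.
  by rewrite lee_fin (le_trans (_ : t <= Num.max t st)) ?le_max ?lexx // lerDl ltW.
have ul : l \is a GRing.unit by apply: (cdv_unit Av); exact: (valu_neq0 vv vl).
have M1 : v (Q.-1%:R : A) = 0%E.
  have -> : Q.-1%:R = - (1 - Q%:R) :> A by rewrite -{2}(prednK Q0) -natr1 opprB addrK.
  rewrite (valuN vv) (valu_dom vv) (valu1 vv) // (valuN vv).
  exact: valu_card_residue.
(* The order Q - 1 is congruent to -1, hence invertible in the valuation ring; averaging over the
   powers of the root of unity requires this. *)
exists l, Q.-1; split => //.
- by case: (Q.-1) M1 => // ; rewrite (valu0 vv).
- by apply: (mulIr ul); rewrite mul1r -exprSr prednK.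
- move=> u vu; have ut := to_residueP (_ : 0 <= v u)%E; rewrite vu lexx in ut.
  have {ut} := ut isT; set t := to_residue u => ut.
  have t0 : t != 0.
    rewrite residue_eq0 -leNgt.
    by rewrite (valu_close vv (x := u)) ?vu.
  have [i ti] := gen _ t0; exists i; apply: (cong_trans ut); rewrite ti cong_sym.
  apply: (@cong_trans (a ^+ i)); last exact: lift_exp.
  by apply: congX; rewrite ?vl ?vg // cong_sym.
Qed.

End Residue.

(** If some term were nonzero, the one of least value would be unique and would give the sum a
    finite value. *)
Lemma distinct_values (R : realType) (A : unitRingType) (v : A -> \bar R) (J : finType) (F : J -> A) :
  is_valuation v -> (forall i j, F i != 0 -> F j != 0 -> v (F i) = v (F j) -> i = j) ->
  \sum_j F j = 0 -> forall j, F j = 0.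
Proof.
move=> vv inj F0 j; apply/eqP; apply: contraT => Fj.
have /choice[f fP] i : exists r, F i != 0 -> v (F i) = r%:E.
  have [->|Fi] := eqVneq (F i) 0; first by exists 0.
  by have [r vr] := valu_fin vv Fi; exists r.
pose i0 := [arg min_(i < j | F i != 0) f i]%O.
have [Fi0 i0min] : F i0 != 0 /\ forall i, F i != 0 -> f i0 <= f i.
  by rewrite /i0; case: arg_minP.
have : (v (F i0) < v (\sum_(i | i != i0) F i)%R)%E.
  rewrite (fP _ Fi0); apply: (valu_sum_gt vv) => i ii0.
  have [->|Fi] := eqVneq (F i) 0; first by rewrite (valu0 vv) ltey.
  rewrite (fP _ Fi) lte_fin lt_neqAle i0min // andbT.
  apply: contraNneq ii0 => E; apply/eqP/inj => //.
  by rewrite (fP _ Fi0) (fP _ Fi) E.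
have F0' : F i0 + \sum_(i | i != i0) F i = 0 by apply: etrans F0; rewrite [RHS](bigD1 i0).
move/(valu_dom vv); rewrite F0' (valu0 vv) => E.
by case/eqP: Fi0; apply/(valuation_eqy vv).
Qed.

(** * Averaging over conjugation by a root of unity *)

Section Averaging.
Variables (R : realType) (A : unitRingType) (v : A -> \bar R).
Hypothesis Av : is_cdv v.
Let vv := cdv_val Av.
Variables (g : A) (M : nat).
Hypotheses (gM : g ^+ M = 1) (vM : v (M%:R : A) = 0%E) (vg : v g = 0%E).

Let ug : g \is a GRing.unit. Proof. by apply: (cdv_unit Av); exact: (valu_neq0 vv vg). Qed.
Let uM : (M%:R : A) \is a GRing.unit. Proof. by apply: (cdv_unit Av); exact: (valu_neq0 vv vM). Qed.

(** The mean of the conjugates of x by the powers of g: a projection onto the centraliser of g. *)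
Definition average (x : A) : A := M%:R^-1 * \sum_(j < M) g ^- j * x * g ^+ j.

Lemma natV_comm (x : A) : M%:R^-1 * x = x * M%:R^-1.
Proof. by apply: commr_sym; apply: commrV; exact: commr_nat. Qed.

Lemma averageB x y : average (x - y) = average x - average y.
Proof. by rewrite /average -mulrBr -sumrB; under eq_bigr do rewrite mulrBr mulrBl. Qed.

Lemma average_id x : x * g = g * x -> average x = x.
Proof.
move=> xg; rewrite /average (eq_bigr (fun=> x)) => [|j _].
  by rewrite sumr_const card_ord -[x *+ M]mulr_natl mulrA mulVr // mul1r.
have xj : x * g ^+ j = g ^+ j * x by exact: commrX.
by rewrite -mulrA xj mulKr // unitrX.
Qed.

Lemma average_comm x : average x * g = g * average x.
Proof.
pose c j := g ^- j * x * g ^+ j.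
have gc j : g * c j.+1 = c j * g.
  by rewrite /c exprSr invrM ?unitrX // -!mulrA mulVKr.
have cS : \sum_(j < M) c j.+1 = \sum_(j < M) c j.
  apply: (addrI (c 0%N)); rewrite -(big_ord_recl M (fun i => c i)) big_ord_recr /= addrC.
  by congr (_ + _); rewrite /c gM expr0.
rewrite /average -/c mulrA -natV_comm -!mulrA; congr (_ * _).
by rewrite -[in RHS]cS mulr_suml mulr_sumr; apply: eq_bigr => j _; rewrite gc.
Qed.

Lemma commutator_exp (x : A) j : (v x < v (x * g - g * x)%R)%E -> (v x < v (x * g ^+ j - g ^+ j * x)%R)%E.
Proof.
move=> xg; have x0 : x != 0.
  by apply: contraTneq xg => ->; rewrite mul0r mulr0 subrr ltxx.
have [r vr] := valu_fin vv x0; rewrite vr in xg *.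
elim: j => [|j IH]; first by rewrite expr0 mulr1 mul1r subrr (valu0 vv) ltey.
have -> : x * g ^+ j.+1 - g ^+ j.+1 * x = (x * g ^+ j - g ^+ j * x) * g + g ^+ j * (x * g - g * x).
  by rewrite mulrBl mulrBr exprSr !mulrA addrA subrK.
apply: (valuD_gt vv); rewrite (valuationM vv).
  by rewrite vg adde0.
by rewrite (valuX vv j vg) mulr0 add0e.
Qed.

(** If x commutes with g to leading order, each conjugate agrees with x to leading order, and so
    does their mean since M is a unit. *)
Lemma average_close x : (v x < v (x * g - g * x)%R)%E -> (v x < v (average x - x)%R)%E.
Proof.
move=> xg; have x0 : x != 0.
  by apply: contraTneq xg => ->; rewrite mul0r mulr0 subrr ltxx.
have [r vr] := valu_fin vv x0.
have -> : average x - x = M%:R^-1 * \sum_(j < M) (g ^- j * (x * g ^+ j - g ^+ j * x)).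
  rewrite /average; have {2}-> : x = M%:R^-1 * \sum_(j < M) x.
    by rewrite sumr_const card_ord -[x *+ M]mulr_natl mulrA mulVr // mul1r.
  rewrite -mulrBr -sumrB; congr (_ * _); apply: eq_bigr => j _.
  by rewrite mulrBr mulrA mulKr // unitrX.
rewrite (valuationM vv) (valuV vv uM vM) oppr0 add0e vr.
apply: (valu_sum_gt vv) => j _; rewrite (valuationM vv).
rewrite (valuV vv _ (valuX vv j vg)) ?unitrX // mulr0 oppr0 add0e -vr.
exact: commutator_exp.
Qed.

End Averaging.

(** * Ramification and graded centre of a local division algebra *)

Section LocalDivisionAlgebra.
Variables (R : realType) (k : fieldType) (nu : k -> \bar R) (D : falgType k) (w : D -> \bar R) (d : nat).
Hypothesis k_local : is_local_field nu.
Hypothesis D_central : is_central_division D.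
Hypothesis D_index : \dim {:D} = (d ^ 2)%N.
Hypothesis w_ext : extends_valuation nu w.
Let kv := local_field_cdv k_local.
Let D_unit := D_central.1.
Let Dw : is_cdv w := falg_cdv kv D_unit w_ext.
Let wv := cdv_val Dw.

Variables (pi : D) (piu : is_uniformizer w pi).
Let st := fine (w pi).
Let st0 : 0 < st := step_gt0 piu.
Let wpi : w pi = st%:E := step_val piu.

Lemma local_scalar (a : int) : exists c : k, w c%:A = (a%:~R)%:E.
Proof.
have : [set nu x | x in [set x | x != 0]] (a%:~R)%:E.
  by rewrite (local_value_group k_local); exists a.
by move=> [c _ vc]; exists c; rewrite w_ext.2.
Qed.

Lemma local_nat : exists2 e : nat, (0 < e)%N & e%:R * st = 1.
Proof.
have [c vc] := local_scalar 1.
have [n] := valu_discrete Dw piu (valu_neq0 wv vc); rewrite vc -/st => -[] n1.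
have n0 : 0 < n by rewrite -(ltr0z R) -(pmulr_lgt0 _ st0) -n1.
by exists `|n|%N; [rewrite absz_gt0 gt_eqF|rewrite natr_absz gtr0_norm].
Qed.

(** The sum of the K q_j contains a leading-order approximation of every nonzero element, so it is
    all of D by completeness ([dense_subspace]). *)
Lemma dim_approx (K : {vspace D}) (J : finType) (q : J -> D) :
  (forall x, x != 0 -> exists j y, y \in K /\ (w x < w (x - y * q j)%R)%E) ->
  (\dim {:D} <= #|J| * \dim K)%N.
Proof.
move=> H; pose U := (\sum_j K * <[q j]>)%VS.
have dimU : (\dim U <= #|J| * \dim K)%N.
  apply: leq_trans (dimv_leq_sum _ _ _) _; rewrite -sum_nat_const.
  apply: leq_sum => j _; by rewrite -limg_amulr -(limg_ker_dim (amulr (q j)) K) leq_addl.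
suff -> : {:D}%VS = U by [].
apply/eqP; rewrite eqEsubv subvf andbT; apply/subvP => x _.
have [|y _ y0|a ->] := dense_subspace (falg_space D) (val_norm w_ext) kv
  (s := fun i : 'I_(\dim U) => (vbasis U)`_i) _ _ (I : setT x) => //.
  have [j [z [zK yz]]] := H y y0.
  have [r vr] := valu_fin wv y0.
  have zU : z * q j \in U by apply: (subvP (sumv_sup j _ (subvv _))) => //; apply: memv_mul => //; exact: memv_line.
  have [t [rt tz]] : exists t, r < t /\ (t%:E <= w (y - z * q j)%R)%E.
    have [->|yz0] := eqVneq (y - z * q j) 0; first by exists (r + 1); rewrite (valu0 wv) leey; split => //; lra.
    have [t vt] := valu_fin wv yz0; exists t; rewrite vt; split=> //.
    by move: yz; rewrite vr vt lte_fin.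
  exists (z * q j), t; split=> //; last first.
    by rewrite /val_filtration /= vr lee_fin; apply/negP; rewrite -ltNge.
  by exists (fun i => coord (vbasis U) i (z * q j)); exact: coord_vbasis.
by apply: memv_suml => i _; apply: memvZ; apply: vbasis_mem; rewrite mem_nth // size_tuple.
Qed.

(** The subfield k[x] is contained in its centraliser, so its dimension squared is at most d^2 by
    [dim_centraliser]. *)
Lemma dim_adjoin_le (x : D) : (\dim <<1; x>> <= d)%N.
Proof.
have xC : x \in 'C(<<1; x>>)%VS by exact: centraliser_adjoin.
have cK : (<<1; x>> <= 'C(<<1; x>>))%VS.
  by apply/subvP => y /(centvP xC) xy; exact: centraliser_adjoin.
rewrite -leq_sqr -D_index -mulnn; apply: (leq_trans _ (dim_centraliser D_central [aspace of <<1; x>>%VS])).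
by rewrite leq_mul2l dimvS ?orbT.
Qed.

Lemma adjoin_exp (x : D) n : x ^+ n \in <<1; x>>%VS.
Proof.
elim: n => [|n IH]; first by rewrite expr0 subvP_adjoin // memv_line.
by rewrite exprS -[<<1; x>>%VS]agenvM; apply: memv_mul => //; exact: memv_adjoin.
Qed.

(** The powers pi^i with i < e have values in distinct classes modulo Z, the value group of k, hence
    are linearly independent over k and lie in k[pi]. *)
Lemma ramification_le e : e%:R * st = 1 -> (e <= d)%N.
Proof.
move=> e1; apply: (leq_trans _ (dim_adjoin_le pi)).
pose X := [tuple pi ^+ i | i < e].
have fX : free X.
  apply/freeP => a a0 i.
  have aE j : a j *: X`_j = a j *: pi ^+ j by rewrite -tnth_nth tnth_mktuple.
  have := @distinct_values _ _ w _ (fun j => a j *: X`_j) wv _ a0 i.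
  rewrite aE => H; have /H/eqP : forall i j : 'I_e, a i *: X`_i != 0 -> a j *: X`_j != 0 ->
      w (a i *: X`_i) = w (a j *: X`_j) -> i = j.
    move=> i' j; rewrite !aE !scaler_eq0 !negb_or => /andP[ai _] /andP[aj _].
    rewrite !(extM w_ext) !(valuX wv _ wpi).
    have vz (x : k) : x != 0 -> exists n : int, nu x = (n%:~R)%:E.
      move=> x0; have : [set nu x | x in [set x | x != 0]] (nu x) by exists x.
      by rewrite (local_value_group k_local) => -[n _ <-]; exists n.
    have [m ->] := vz _ ai; have [n ->] := vz _ aj.
    rewrite -!EFinD => -[] E.
    have E' : m%:~R * e%:R + i'%:R = n%:~R * e%:R + j%:R :> R.
      apply: (mulIf (lt0r_neq0 st0)); rewrite !mulrDl -!mulrA e1 !mulr1; exact: E.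
    have {}E' : m * e%:Z + i'%:Z = n * e%:Z + j%:Z.
      by apply/eqP; rewrite -(eqr_int R) !intrD !intrM -!pmulrn E'.
    have e0 : (0 < e)%N by exact: leq_ltn_trans (leq0n _) (ltn_ord i').
    apply: val_inj => /=; apply/eqP; rewrite -eqz_nat; apply/eqP.
    have := congr1 (fun z => (z %% e%:Z)%Z) E'.
    by rewrite !modzMDl !modz_small //= ltz_nat ltn_ord.
  by rewrite scaler_eq0 => /orP[/eqP //|]; rewrite (negPf (valu_neq0 wv (valuX wv i wpi))).
have /eqP <- : \dim <<X>> == e by have := fX; rewrite /free size_tuple.
apply: dimvS; apply/span_subvP => _ /tnthP[i ->]; rewrite tnth_mktuple.
exact: adjoin_exp.
Qed.

Section Teichmuller.
Variables (z : D) (M : nat).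
Hypotheses (zM : z ^+ M = 1) (vM : w (M%:R : D) = 0%E) (wz : w z = 0%E).
Hypothesis zgen : forall u, w u = 0%E -> exists i, (0 < w (u - z ^+ i)%R)%E.
Local Notation K := (<<1; z>>)%VS.

(** For c of value a, the quotient x / (c t) has value 0 and is congruent to a power of z. *)
Lemma scaled_approx (x t : D) (a : int) (r s : R) : w x = r%:E -> w t = s%:E -> r = a%:~R + s ->
  exists (c : k) i, w c%:A = (a%:~R)%:E /\ (w x < w (x - (c *: z ^+ i) * t)%R)%E.
Proof.
move=> wx wt rE; have [c vc] := local_scalar a.
have wct : w (c%:A * t) = r%:E by rewrite (valuationM wv) vc wt rE.
have uct := cdv_unit Dw (valu_neq0 wv wct).
have [i zi] : exists i, (0 < w (x / (c%:A * t) - z ^+ i)%R)%E.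
  by apply: zgen; rewrite (valuationM wv) wx (valuV wv uct wct) -EFinD subrr.
exists c, i; split=> //.
have -> : x - (c *: z ^+ i) * t = (x / (c%:A * t) - z ^+ i) * (c%:A * t).
  by rewrite mulrBl divrK // mulrA mulr_algr.
rewrite (valuationM wv) wct wx -[X in (X < _)%E]add0e.
by rewrite lteD2rE.
Qed.

Lemma scaled_mem (c : k) i : c *: z ^+ i \in K.
Proof. by apply: memvZ; exact: adjoin_exp. Qed.

Variable e : nat.
Hypotheses (e0 : (0 < e)%N) (e_st : e%:R * st = 1).

Lemma value_split x : x != 0 -> exists (a : int) (j : 'I_e), w x = (a%:~R + j%:R * st)%:E.
Proof.
move=> x0; have [m vm] := valu_discrete Dw piu x0.
have lt : (`|(m %% e%:Z)%Z| < e)%N.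
  have e0' : e%:Z != 0 by rewrite eqz_nat -lt0n.
  by rewrite -ltz_nat gez0_abs ?modz_ge0 // ltz_pmod.
exists (m %/ e%:Z)%Z, (Ordinal lt); rewrite vm -/st; congr (_%:E) => /=.
have e0' : e%:Z != 0 by rewrite eqz_nat -lt0n.
rewrite {1}(divz_eq m e%:Z) intrD intrM mulrDl -mulrA -pmulrn e_st mulr1.
by rewrite natr_absz ger0_norm // modz_ge0.
Qed.

(** Approximation by K pi^j gives d^2 <= e dim K, and both factors are at most d. *)
Lemma local_dims : e = d /\ \dim K = d.
Proof.
have d2 : (d * d <= e * \dim K)%N.
  have := @dim_approx K 'I_e (fun j => pi ^+ j); rewrite D_index card_ord mulnn; apply.
  move=> x x0; have [a [j wx]] := value_split x0.
  have [c [i [_ lt]]] := scaled_approx wx (valuX wv j wpi) erefl.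
  by exists j, (c *: z ^+ i); split=> //; exact: scaled_mem.
have ed := ramification_le e_st; have Kd := dim_adjoin_le z.
have d0 : (0 < d)%N by exact: leq_trans e0 ed.
by split; apply/eqP; rewrite eqn_leq ?ed ?Kd /=; nia.
Qed.

Lemma adjoin_integer x : x \in K -> x != 0 -> exists a : int, w x = (a%:~R)%:E.
Proof.
move=> xK x0; have [a [j wx]] := value_split x0.
have [j0|j0] := posnP j; first by exists a; rewrite wx j0 mul0r addr0.
exfalso; have [ed Kd] := local_dims.
have := @dim_approx K {i : 'I_e | i != j} (fun i => pi ^+ val i).
have -> : #|{: {i : 'I_e | i != j}}| = e.-1.
  by rewrite card_sig -[in RHS](card_ord e) -(cardC1 j); apply: eq_card => i; rewrite !inE.
rewrite D_index Kd -ed => H.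
have : (e ^ 2 <= e.-1 * e)%N; last by nia.
apply: H => y y0; have [b [i wy]] := value_split y0.
have [ij|ij] := eqVneq i j; last first.
  have [c [l [_ lt]]] := scaled_approx wy (valuX wv i wpi) erefl.
  by exists (exist _ i ij), (c *: z ^+ l); split=> //; exact: scaled_mem.
have [|c [l [_ lt]]] := @scaled_approx y x (b - a) _ _ wy wx.
  by rewrite ij intrB; lra.
have j0' : Ordinal e0 != j by rewrite -val_eqE /= eq_sym -lt0n.
(* For values in the class of j, the element x of K itself is used as a coefficient of pi^0. *)
exists (exist _ (Ordinal e0) j0'), ((c *: z ^+ l) * x); rewrite /= expr0 mulr1; split=> //.
by rewrite -[K]agenvM memv_mul // scaled_mem.
Qed.

(** K has dimension d, so its centraliser has dimension at most d and contains K. *)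
Lemma adjoin_selfcent : ('C(K) <= K)%VS.
Proof.
have zC : z \in 'C(K)%VS by exact: centraliser_adjoin.
have cK : (K <= 'C(K))%VS.
  by apply/subvP => y /(centvP zC) xy; exact: centraliser_adjoin.
have := dim_centraliser D_central [aspace of K].
have [ed Kd] := local_dims; rewrite D_index /= Kd -mulnn leq_mul2l.
have -> /= : (d == 0)%N = false by rewrite -ed; case: (e) e0.
by move=> H; rewrite -(geq_leqif (dimv_leqif_sup cK)) Kd.
Qed.

(* The homogeneous centre of the graded ring of D is that of k. *)
Lemma graded_centre_normalised y : (forall x, x != 0 -> (w x + w y < w (x * y - y * x)%R)%E) -> y != 0 ->
  exists c : k, (w y < w (y - c%:A)%R)%E.
Proof.
move=> yC y0; have [s ws] := valu_fin wv y0.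
have z0 := valu_neq0 wv wz.
(* The average agrees with y to leading order and commutes with z, so it lies in K and has integral
   value. *)
pose y1 := average z M y.
have yz : (w y < w (y * z - z * y)%R)%E.
  by have := yC z z0; rewrite wz add0e (valuBC wv).
have yy1 : (w y < w (y1 - y)%R)%E := average_close Dw vM wz yz.
have wy1 : w y1 = s%:E by rewrite -ws; apply: (valu_close wv); rewrite (valuBC wv).
have y1K : y1 \in K.
  apply: (subvP adjoin_selfcent); apply: centraliser_adjoin.
  exact/esym/(average_comm Dw zM wz).
have [a wa] := adjoin_integer y1K (valu_neq0 wv wy1).
(* To leading order y is thus a scalar c times a root of unity g. Cancelling c, g commutes with D to
   leading order; it remains to see that g is exactly central. *)
have [|c [i [wc lt]]] := @scaled_approx y1 1 a _ _ wa (valu1 wv); first by rewrite addr0.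
rewrite mulr1 in lt; set g := z ^+ i in lt.
have wg : w g = 0%E by rewrite (valuX wv i wz) mulr0.
have gM : g ^+ M = 1 by rewrite /g exprAC zM expr1n.
have sa : s = a%:~R by move: wa; rewrite wy1 => -[].
have ycg : (w y < w (y - c *: g)%R)%E.
  have -> : y - c *: g = (y1 - c *: g) - (y1 - y) by rewrite opprB [RHS]addrC addrA subrK.
  by rewrite ws; apply: (valuD_gt wv); rewrite ?(valuN wv) -ws // ws -wy1.
have wcE : w c%:A = s%:E by rewrite wc sa.
have c0 := valu_neq0 wv wcE; have uc := cdv_unit Dw c0.
have gC x : x != 0 -> (w x < w (x * g - g * x)%R)%E.
  move=> x0; have [r wx] := valu_fin wv x0.
  have : ((r + s)%:E < w (c%:A * (x * g - g * x))%R)%E.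
    have -> : c%:A * (x * g - g * x) = (x * y - y * x) - (x * (y - c *: g) - (y - c *: g) * x).
      rewrite mulr_algl !mulrBr !mulrBl -scalerAr -scalerAl scalerBr.
      by rewrite opprB addrA [_ + (y * x - _)]addrA subrK opprB [RHS]addrC addrA subrK.
    apply: (valuD_gt wv); first by have := yC x x0; rewrite wx ws -EFinD.
    rewrite (valuN wv); apply: (valuD_gt wv).
      by apply: (valu_mul_gt wv wx); rewrite -ws.
    by rewrite (valuN wv) (valuationM wv) wx addrC EFinD lteD2rE // -ws.
  by rewrite (valuationM wv) wcE addrC EFinD lteD2lE // -wx.
(* The difference of x and its average has average 0, which [average_close] forbids for a nonzero
   element. So x equals its average and commutes with g. *)
have gcent x : x * g = g * x.
  have E : average g M (x - average g M x) = 0.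
    by rewrite averageB (average_id Dw vM wg (average_comm Dw gM wg x)) subrr.
  have [x0|x0] := eqVneq (x - average g M x) 0.
    move/eqP: x0; rewrite subr_eq0 => /eqP ->; exact: (average_comm Dw gM wg x).
  by have := average_close Dw vM wg (gC _ x0); rewrite E sub0r (valuN wv) ltxx.
have [f gf] : exists f : k, g = f%:A by apply/D_central.2 => x; rewrite gcent.
by exists (c * f); rewrite -scalerA -gf.
Qed.

End Teichmuller.

(** The ramification index of D over k equals its index d. This identifies the step 1/d of lattice
    functions over D with the value of a uniformizer. *)
Theorem local_index : st = d%:R^-1.
Proof.
have [e e0 e1] := local_nat.
have [s sP] : finite_residue w.
  exact: falg_finite_residue kv w_ext (local_finite_residue_field k_local).
have [z [M [_ zM vM wz zgen]]] := teichmuller Dw sP piu.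
have [<- _] := local_dims zgen e0 e1.
exact/esym/mulr1_eq.
Qed.

Theorem graded_centre y : y != 0 ->
  (forall x, x != 0 -> (w x + w y < w (x * y - y * x)%R)%E) ->
  exists c : k, (w y < w (y - c%:A)%R)%E.
Proof.
move=> y0 yC; have [e e0 e1] := local_nat.
have [s sP] : finite_residue w.
  exact: falg_finite_residue kv w_ext (local_finite_residue_field k_local).
have [z [M [_ zM vM wz zgen]]] := teichmuller Dw sP piu.
by apply: (graded_centre_normalised zM vM wz zgen e0 e1 _ y0) => x; exact: yC.
Qed.

End LocalDivisionAlgebra.

(** * Right vector spaces and rank one maps *)

Section RightSpaces.
Variables (A : unitRingType) (V : vectType A^c).
Implicit Types (a b : A) (x y : V).

Lemma ractDl a b x : ract (a + b) x = ract a x + ract b x.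
Proof. exact: scalerDl. Qed.

Lemma ractDr a x y : ract a (x + y) = ract a x + ract a y.
Proof. exact: scalerDr. Qed.

Lemma ractM a b x : ract (a * b) x = ract b (ract a x).
Proof. by rewrite /ract scalerA. Qed.

Lemma ract1 x : ract 1 x = x.
Proof. exact: scale1r. Qed.

Lemma ract0 a : ract a (0 : V) = 0.
Proof. exact: scaler0. Qed.

Lemma ract0l x : ract 0 x = 0.
Proof. exact: scale0r. Qed.

Lemma ract_sumr (J : Type) (s : seq J) (P : pred J) a (F : J -> V) :
  ract a (\sum_(j <- s | P j) F j) = \sum_(j <- s | P j) ract a (F j).
Proof. exact: scaler_sumr. Qed.

Lemma ract_suml (J : Type) (s : seq J) (P : pred J) (F : J -> A) x :
  ract (\sum_(j <- s | P j) F j) x = \sum_(j <- s | P j) ract (F j) x.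
Proof. by rewrite /ract (big_morph (fun a : A^c => a *: x) (fun a b => scalerDl x a b) (scale0r x)). Qed.

Lemma lfun_ract (W : vectType A^c) (f : 'Hom(V, W)) a x : f (ract a x) = ract a (f x).
Proof. exact: linearZ. Qed.

Lemma linfun_ract (W : vectType A^c) (f : V -> W) :
  (forall x y, f (x + y) = f x + f y) -> (forall a x, f (ract a x) = ract a (f x)) ->
  linfun f =1 f.
Proof.
move=> fD fZ x; have fL : linear f by move=> a u v; rewrite fD; congr (_ + _); exact: fZ.
pose fM := GRing.isLinear.Build _ _ _ _ f fL.
pose F : {linear _ -> _} := HB.pack f fM.
exact: (lfunE F).
Qed.

Definition vcoord (j : 'I_(dim V)) (x : V) : A := (v2r x) 0 j.
Definition vgen (j : 'I_(dim V)) : V := r2v (delta_mx 0 j).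

Lemma v2r_ract a x : v2r (ract a x) = (a : A^c) *: v2r x.
Proof. by rewrite /ract linearZ. Qed.

Lemma vcoordK x : x = \sum_j ract (vcoord j x) (vgen j).
Proof.
apply: v2r_inj; rewrite raddf_sum /= {1}(row_sum_delta (v2r x)); apply: eq_bigr => j _.
by rewrite v2r_ract /vgen r2vK.
Qed.

Lemma vcoordD j x y : vcoord j (x + y) = vcoord j x + vcoord j y.
Proof. by rewrite /vcoord linearD mxE. Qed.

Lemma vcoordZ j a x : vcoord j (ract a x) = vcoord j x * a.
Proof. by rewrite /vcoord v2r_ract mxE. Qed.

Lemma vcoord_gen j i : vcoord j (vgen i) = (j == i)%:R.
Proof. by rewrite /vcoord /vgen r2vK mxE eqxx. Qed.

(* W is the image of a D-linear projector. *)
Lemma right_space (P : 'End(V)) (W : set V) : (forall x, W x <-> P x = x) ->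
  (forall x, P (P x) = P x) -> @is_space A^c V (@ract A V) W.
Proof.
move=> WP PP; split.
- by move=> a b x; exact: ractDl.
- by move=> a x y; exact: ractDr.
- by move=> a b x; exact: (ractM b a).
- by move=> x _; exact: ract1.
- by move=> a x /WP Px; apply/WP; rewrite lfun_ract Px.
- by apply/WP; rewrite linear0.
- by move=> x y /WP Px /WP Py; apply/WP; rewrite linearB /= Px Py.
- exists (dim V), (fun j => P (vgen j)); split=> [j|x /WP Px]; first by apply/WP.
  exists (fun j => vcoord j x); rewrite -{1}Px {1}(vcoordK x) linear_sum.
  by apply: eq_bigr => j _; exact: lfun_ract.
Qed.

Lemma right_spaceT : @is_space A^c V (@ract A V) setT.
Proof. by apply: (right_space (P := \1%VF)) => x; rewrite !id_lfunE. Qed.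

Definition rank_one (j : 'I_(dim V)) (u : V) : 'End(V) := linfun (fun x => ract (vcoord j x) u).

Lemma rank_oneE j u x : rank_one j u x = ract (vcoord j x) u.
Proof.
by apply: linfun_ract => [y z|a y]; rewrite ?vcoordD ?ractDl ?vcoordZ ?ractM.
Qed.

Lemma rank_oneD j u v : rank_one j (u + v) = rank_one j u + rank_one j v.
Proof. by apply/lfunP => x; rewrite add_lfunE !rank_oneE ractDr. Qed.

Lemma lfun_rank_one (a : 'End(V)) j u : (a \o rank_one j u)%VF = rank_one j (a u).
Proof. by apply/lfunP => x; rewrite comp_lfunE !rank_oneE lfun_ract. Qed.

Lemma rank_one_comp i j u v : (rank_one i u \o rank_one j v)%VF = rank_one j (ract (vcoord i v) u).
Proof. by rewrite lfun_rank_one rank_oneE. Qed.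

Lemma rank_one_sum : \sum_j rank_one j (vgen j) = \1%VF.
Proof.
apply/lfunP => x; rewrite sum_lfunE id_lfunE [RHS]vcoordK.
by apply: eq_bigr => j _; rewrite rank_oneE.
Qed.

End RightSpaces.

(* The tensor product norm on E (x) D is the operator norm on S: a term of minimal *)
(* value normalised to coefficient 1 is killed by commutation with D, so a minimal *)
(* counterexample has central coefficients to leading order and lies in E.         *)
Section TensorNorm.
Variables (R : realType) (k : fieldType) (nu : k -> \bar R) (D : falgType k) (nuD : D -> \bar R) (d : nat).
Hypotheses (k_local : is_local_field nu) (D_central : is_central_division D).
Hypotheses (D_index : \dim {:D} = (d ^ 2)%N) (nuD_ext : extends_valuation nu nuD).
Variables (E : fieldExtType k) (nuE : E -> \bar R) (nuE_ext : extends_valuation nu nuE).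
Let kv := local_field_cdv k_local.
Let Dv : is_cdv nuD := falg_cdv kv D_central.1 nuD_ext.
Let E_unit (x : E) : x != 0 -> x \is a GRing.unit. Proof. by rewrite unitfE. Qed.
Let Ev : is_cdv nuE := falg_cdv kv E_unit nuE_ext.
Let vD := cdv_val Dv.
Let vE := cdv_val Ev.
Variables (V : vectType D^c) (iota : E -> 'End(V)).
Hypotheses (iotaD : forall x y, iota (x + y) = iota x + iota y)
  (iotaM : forall x y, iota (x * y) = (iota x \o iota y)%VF)
  (iotaZ : forall (c : k) x v, iota (c *: x) v = ract c%:A (iota x v)).
Variables (S : set V) (G : R -> set V).
Hypotheses (S_act : forall a x, S x -> S (ract a x)) (S_iota : forall x v, S v -> S (iota x v))
  (S_id : forall v, S v -> iota 1 v = v).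
Hypotheses (GS : forall t v, G t v -> S v) (GB : forall t x y, G t x -> G t y -> G t (x - y)) (G0 : forall t, G t 0)
  (G_anti : forall s t x, s <= t -> G t x -> G s x)
  (G_act : forall s t a x, (s%:E <= nuD a)%E -> G t x -> G (s + t) (ract a x))
  (G_iota : forall s t a x, (s%:E <= nuE a)%E -> G t x -> G (s + t) (iota a x)).
Variables (s0 : V) (g0 : R) (Ss0 : S s0) (Gs0 : forall t, G t s0 <-> t <= g0).
Variables (m : nat) (b : 'I_m -> E) (c : 'I_m -> R).
Hypothesis bL : orth_basis nu *:%R setT (val_filtration nuE) b c.
Let b_val := val_orthE kv bL.

(** The action on V of the element sum_l b_l (x) f_l of E (x) D. *)
Definition tensor_act (f : 'I_m -> D) (v : V) : V := \sum_l ract (f l) (iota (b l) v).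

(** The operator raises all values of G by at least r, i.e. its operator norm on S is at least r in
    additive notation. *)
Definition contracts (f : 'I_m -> D) (r : R) := forall t v, G t v -> G (t + r) (tensor_act f v).

Let GD t x y : G t x -> G t y -> G t (x + y).
Proof. by move=> Gx Gy; rewrite -[y]opprK -[- y]sub0r; apply: GB => //; exact: GB. Qed.

Let G_sum t (P : pred 'I_m) (F : 'I_m -> V) : (forall l, P l -> G t (F l)) -> G t (\sum_(l | P l) F l).
Proof. by move=> GF; elim/big_ind: _ => //; exact: GD. Qed.

Lemma tensor_act_ract f a v : tensor_act f (ract a v) = tensor_act (fun l => a * f l) v.
Proof. by apply: eq_bigr => l _; rewrite lfun_ract ractM. Qed.

Lemma ract_tensor_act f a v : ract a (tensor_act f v) = tensor_act (fun l => f l * a) v.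
Proof. by rewrite /tensor_act ract_sumr; apply: eq_bigr => l _; rewrite ractM. Qed.

Lemma tensor_actB f g v : tensor_act f v - tensor_act g v = tensor_act (fun l => f l - g l) v.
Proof. by rewrite /tensor_act -sumrB; apply: eq_bigr => l _; rewrite /ract -scalerBl. Qed.

Lemma contracts_mulr f r a q : nuD a = q%:E -> contracts f r -> contracts (fun l => f l * a) (r + q).
Proof.
move=> va H t v Gv; rewrite -ract_tensor_act addrA addrC; apply: G_act; first by rewrite va.
exact: H.
Qed.

Lemma contracts_mull f r a q : nuD a = q%:E -> contracts f r -> contracts (fun l => a * f l) (q + r).
Proof.
move=> va H t v Gv; rewrite -tensor_act_ract addrA; apply: H.
by rewrite addrC; apply: G_act; rewrite ?va.
Qed.

Lemma contractsB f g r : contracts f r -> contracts g r -> contracts (fun l => f l - g l) r.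
Proof. by move=> Hf Hg t v Gv; rewrite -tensor_actB; apply: GB; [exact: Hf|exact: Hg]. Qed.

(** The action of x raises the value of s0 by exactly q, because the inverse of x brings it back at
    the cost of -q. *)
Lemma iota_exact x q t : nuE x = q%:E -> G (t + q) (iota x s0) -> t <= g0.
Proof.
move=> vx Gx; apply/Gs0; have ux := E_unit (valu_neq0 vE vx).
have -> : s0 = iota x^-1 (iota x s0) by rewrite -comp_lfunE -iotaM mulVr // S_id.
have -> : t = - q + (t + q) by lra.
by apply: G_iota => //; rewrite (valuV vE ux vx).
Qed.

Lemma iota_sum (P : pred 'I_m) (a : 'I_m -> k) v :
  iota (\sum_(l | P l) a l *: b l) v = \sum_(l | P l) ract (a l)%:A (iota (b l) v).
Proof.
have i0 : iota 0 = 0 by apply: (addIr (iota 0)); rewrite -iotaD !add0r.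
rewrite (big_morph iota iotaD i0) sum_lfunE; apply: eq_bigr => l _; exact: iotaZ.
Qed.

Definition minimal_terms (f : 'I_m -> D) (r : R) := [set l | nuD (f l) == (r - c l)%:E]%SET.

Lemma val_lt_ge x (q : R) : (q%:E <= nuD x)%E -> nuD x != q%:E -> (q%:E < nuD x)%E.
Proof. by move=> le ne; rewrite lt_neqAle eq_sym ne. Qed.

(* the leading coefficients cannot all be central *)
Lemma central_terms f r r' l0 : r < r' -> contracts f r' -> (forall l, ((r - c l)%:E <= nuD (f l))%E) ->
  l0 \in minimal_terms f r ->
  (forall l, l \in minimal_terms f r -> exists a : k, (nuD (f l) < nuD (f l - a%:A)%R)%E) -> False.
Proof.
move=> rr' fr' fr l0P cen.
have /choice[a aP] l : exists a : k, l \in minimal_terms f r -> (nuD (f l) < nuD (f l - a%:A)%R)%E.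
  by have [/cen[a Ha]|] := boolP (l \in minimal_terms f r); [exists a|exists 0].
pose P := minimal_terms f r; pose u := \sum_(l in P) a l *: b l.
have vf l : l \in P -> nuD (f l) = (r - c l)%:E by rewrite inE => /eqP.
have va l : l \in P -> nu (a l) = (r - c l)%:E.
  by move=> lP; rewrite -nuD_ext.2 (valu_close vD (aP _ lP)) vf.
have vu : nuE u = r%:E.
  pose a' l := if l \in P then a l else 0.
  have uE : u = \sum_l a' l *: b l.
    rewrite /u big_mkcond; apply: eq_bigr => l _.
    by rewrite /a'; case: ifP => //; rewrite scale0r.
  apply: ereal_cut => t.
  have := orthP bL t a'; rewrite -uE => H; apply: iff_trans H _; split=> [H|tr l].
    by have := H l0; rewrite /a' l0P va // lee_fin lerD2r.
  rewrite /a'; case: ifP => [lP|_]; last by rewrite (valu0 (cdv_val kv)) leey.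
  by rewrite va // lee_fin lerD2r.
pose f' l := if l \in P then f l - (a l)%:A else f l.
have /choice[h hP] l : exists h, r < h /\ ((h - c l)%:E <= nuD (f' l))%E.
  have : ((r - c l)%:E < nuD (f' l))%E.
    rewrite /f'; case: ifP => lP; first by rewrite -vf //; exact: aP.
    by apply: val_lt_ge => //; move: lP; rewrite inE => ->.
  case: (nuD _) => [q| |] //.
    by rewrite lte_fin => lt; exists (q + c l); rewrite addrK; split=> //; lra.
  by exists (r + 1); rewrite leey; split=> //; lra.
have [q rq qP] := fin_lower_bound_gt (fun l => (hP l).1).
have Gs : G g0 s0 by apply/Gs0.
have E1 : iota u s0 = tensor_act f s0 -
    tensor_act f' s0.
  rewrite tensor_actB /u iota_sum big_mkcond; apply: eq_bigr => l _ /=.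
  by rewrite /f'; case: ifP => _; rewrite ?subrr ?ract0l // subKr.
(* The operator f raises values by r' > r and the remainder f' by q > r, whereas u lies in E with
   value r and raises the value of s0 by r only. *)
suff : g0 + (Num.min r' q - r) <= g0 by rewrite gerDl subr_le0 ge_min; lra.
apply: (iota_exact vu); rewrite E1; apply: GB.
  by apply: G_anti (fr' _ _ Gs); rewrite -addrA subrK lerD2l ge_min lexx.
rewrite -addrA subrK; apply: G_sum => l _.
apply: (@G_anti _ ((h l - c l) + (c l + g0))).
  have := qP l; rewrite addrA subrK addrC lerD2r ge_min => ->; exact: orbT.
apply: G_act; first exact: (hP l).2.
by apply: G_iota => //; rewrite b_val.
Qed.

(** Induction on the number of leading terms. One of them is normalised to 1; commuting with x in D
    removes it, so by induction the commutator has no leading terms. The other leading coefficients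
    then commute with D to leading order, and [graded_centre] with [central_terms] gives a
    contradiction. *)
Lemma no_minimal_terms N : forall f r r', r < r' -> contracts f r' ->
  (forall l, ((r - c l)%:E <= nuD (f l))%E) -> (#|minimal_terms f r| <= N)%N ->
  minimal_terms f r = finset.set0.
Proof.
elim: N => [|N IH] f r r' rr' fr' fr cardN.
  by apply/eqP; rewrite -cards_eq0 -leqn0.
apply/eqP; apply: contraT => /set0Pn[l0 l0P].
have vl0 : nuD (f l0) = (r - c l0)%:E by move: l0P; rewrite inE => /eqP.
have ul0 := cdv_unit Dv (valu_neq0 vD vl0); have vl0' := valuV vD ul0 vl0.
pose f1 l := f l / f l0; pose r1 := c l0.
have v1 l : nuD (f1 l) = (nuD (f l) + (- (r - c l0))%:E)%E by rewrite (valuationM vD) vl0'.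
have f1r l : ((r1 - c l)%:E <= nuD (f1 l))%E.
  rewrite v1; have -> : r1 - c l = (r - c l) + - (r - c l0) by rewrite /r1; ring.
  by rewrite EFinD leeD2r.
have c1 : contracts f1 (r' + - (r - c l0)) by exact: contracts_mulr.
have rr1 : r1 < r' + - (r - c l0) by rewrite /r1; lra.
have minE : minimal_terms f1 r1 = minimal_terms f r.
  apply/setP => l; rewrite !inE v1; have -> : r1 - c l = (r - c l) + - (r - c l0) by rewrite /r1; ring.
  case: (nuD (f l)) => [q| |] //; rewrite -EFinD; apply/eqP/eqP => -[] H; congr (_%:E); lra.
have f1l0 : f1 l0 = 1 by rewrite /f1 divrr.
exfalso; apply: (central_terms rr1 c1 f1r (l0 := l0)); rewrite minE // => l lP.
have vfl : nuD (f1 l) = (r1 - c l)%:E by move: lP; rewrite -minE inE => /eqP.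
have [pi piu] := cdv_pi Dv.
apply: (graded_centre k_local D_central D_index nuD_ext piu (valu_neq0 vD vfl)) => x x0.
have [q vx] := valu_fin vD x0; have ux := cdv_unit Dv x0; have vx' := valuV vD ux vx.
(* Conjugation by x changes no value, so f2 satisfies the same bounds as f1, and its l0-th term is 1
   - 1 = 0. *)
pose f2 l := x * f1 l / x - f1 l.
have c2 : contracts f2 (r' + - (r - c l0)).
  apply: contractsB => //.
  have -> : r' + - (r - c l0) = q + (r' + - (r - c l0)) + - q by ring.
  by apply: contracts_mulr => //; apply: contracts_mull.
have vc j : nuD (x * f1 j / x) = nuD (f1 j) by exact: valu_conj ux vx.
have f2r j : ((r1 - c j)%:E <= nuD (f2 j))%E by apply: (valuB_ge vD); rewrite ?vc.
have sub2 : minimal_terms f2 r1 \subset minimal_terms f1 r1 :\ l0.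
  apply/fintype.subsetP => j; rewrite !inE => vj; apply/andP; split.
    by apply: contraTneq vj => ->; rewrite /f2 f1l0 mulr1 divrr // subrr (valu0 vD).
  apply: contraTT vj => ne; rewrite gt_eqF // /f2.
  by apply: (valuD_gt vD); rewrite ?(valuN vD) ?vc val_lt_ge.
have card2 : (#|minimal_terms f2 r1| <= N)%N.
  apply: leq_trans (subset_leq_card sub2) _.
  by move: cardN; rewrite -minE (cardsD1 l0) minE l0P.
have /setP/(_ l) := IH _ _ _ rr1 c2 f2r card2; rewrite inE finset.in_set0 => /negbT ne.
have lt := val_lt_ge (f2r l) ne.
have -> : x * f1 l - f1 l * x = f2 l * x by rewrite mulrBl divrK.
by rewrite (valuationM vD (f2 l) x) vx vfl addeC lteD2rE.
Qed.

(** Otherwise the least value of nuD(f l) + c l would be below r and the terms attaining it would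
    contradict [no_minimal_terms]. *)
Theorem tensor_norm f r : contracts f r -> forall l, ((r - c l)%:E <= nuD (f l))%E.
Proof.
move=> fr l; rewrite leNgt; apply/negP => lt.
have fl0 : f l != 0 by apply: contraTneq lt => ->; rewrite (valu0 vD) -leNgt leey.
have /choice[h hP] j : exists h, f j != 0 -> nuD (f j) = h%:E.
  have [->|fj] := eqVneq (f j) 0; first by exists 0.
  by have [h vh] := valu_fin vD fj; exists h.
pose l1 := [arg min_(j < l | f j != 0) (h j + c j)]%O.
have [fl1 l1min] : f l1 != 0 /\ forall j, f j != 0 -> h l1 + c l1 <= h j + c j.
  by rewrite /l1; case: arg_minP.
have lt1 : h l1 + c l1 < r.
  by apply: le_lt_trans (l1min _ fl0) _; move: lt; rewrite (hP _ fl0) lte_fin; lra.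
have fmin j : (((h l1 + c l1) - c j)%:E <= nuD (f j))%E.
  have [->|fj] := eqVneq (f j) 0; first by rewrite (valu0 vD) leey.
  by rewrite (hP _ fj) lee_fin lerBlDr; exact: l1min.
have /setP/(_ l1) := no_minimal_terms lt1 fr fmin (leqnn _).
by rewrite inE finset.in_set0 (hP _ fl1) addrK eqxx.
Qed.

End TensorNorm.

(** * The components of V *)

Section Component.
Variables (R : realType) (k : fieldType) (nu : k -> \bar R) (D : falgType k) (nuD : D -> \bar R) (d : nat).
Hypotheses (k_local : is_local_field nu) (D_central : is_central_division D).
Hypotheses (D_index : \dim {:D} = (d ^ 2)%N) (nuD_ext : extends_valuation nu nuD).
Variables (E : fieldExtType k) (nuE : E -> \bar R) (nuE_ext : extends_valuation nu nuE).
Variables (D' : falgType E) (nuD' : D' -> \bar R).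
Hypotheses (D'_central : is_central_division D') (nuD'_ext : extends_valuation nuE nuD').
Let kv := local_field_cdv k_local.
Let Dv : is_cdv nuD := falg_cdv kv D_central.1 nuD_ext.
Let E_unit (x : E) : x != 0 -> x \is a GRing.unit. Proof. by rewrite unitfE. Qed.
Let Ev : is_cdv nuE := falg_cdv kv E_unit nuE_ext.
Let D'v : is_cdv nuD' := falg_cdv Ev D'_central.1 nuD'_ext.
Let vD := cdv_val Dv.
Let vE := cdv_val Ev.
Let vD' := cdv_val D'v.
Variables (V : vectType D^c) (V' : vectType D'^c) (iota : E -> 'End(V)) (theta : 'End(V') -> 'End(V)).
Hypotheses (iotaD : forall x y, iota (x + y) = iota x + iota y)
  (iotaM : forall x y, iota (x * y) = (iota x \o iota y)%VF)
  (iotaZ : forall (c : k) x v, iota (c *: x) v = ract c%:A (iota x v))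
  (iota_inj : injective iota).
Hypotheses (thetaD : forall a b, theta (a + b) = theta a + theta b)
  (thetaM : forall a b, theta (a \o b)%VF = (theta a \o theta b)%VF)
  (theta1 : theta \1%VF = iota 1)
  (thetaZ : forall (x : E) (a b : 'End(V')), (forall v, b v = ract x%:A (a v)) ->
     theta b = (iota x \o theta a)%VF)
  (theta_inj : injective theta)
  (theta_im : [set theta a | a in @setT 'End(V')] =
    [set a | [/\ (iota 1 \o a)%VF = a, (a \o iota 1)%VF = a &
                 forall x, (iota x \o a = a \o iota x)%VF]]).

Let theta_range a : [/\ (iota 1 \o theta a)%VF = theta a, (theta a \o iota 1)%VF = theta a &
  forall x, (iota x \o theta a = theta a \o iota x)%VF].
Proof.
have : [set theta a | a in @setT 'End(V')] (theta a) by exists a.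
by rewrite theta_im.
Qed.

Lemma theta_id a v : iota 1 (theta a v) = theta a v.
Proof. by have [H _ _] := theta_range a; rewrite -comp_lfunE H. Qed.

Lemma theta_idr a v : theta a (iota 1 v) = theta a v.
Proof. by have [_ H _] := theta_range a; rewrite -comp_lfunE H. Qed.

Lemma theta_iota a x v : iota x (theta a v) = theta a (iota x v).
Proof. by have [_ _ H] := theta_range a; rewrite -!comp_lfunE H. Qed.

Lemma theta_comp a b v : theta a (theta b v) = theta (a \o b)%VF v.
Proof. by rewrite thetaM comp_lfunE. Qed.

Lemma theta0 : theta 0 = 0.
Proof. by apply: (addIr (theta 0)); rewrite -thetaD !add0r. Qed.

Lemma theta_sum (J : Type) (s : seq J) (P : pred J) (F : J -> 'End(V')) :
  theta (\sum_(j <- s | P j) F j) = \sum_(j <- s | P j) theta (F j).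
Proof. exact: (big_morph theta thetaD theta0). Qed.

Lemma iota0 : iota 0 = 0.
Proof. by apply: (addIr (iota 0)); rewrite -iotaD !add0r. Qed.

Lemma dim_V'_gt0 : (0 < dim V')%N.
Proof.
rewrite lt0n; apply/eqP => n0; have /eqP := oner_neq0 E; apply; apply: iota_inj.
rewrite -theta1 iota0 -theta0; congr theta; apply/lfunP => x.
rewrite id_lfunE zero_lfunE (vcoordK x) big1 // => j _.
by case: j => j jn; exfalso; rewrite n0 in jn.
Qed.

Let j0 : 'I_(dim V') := Ordinal dim_V'_gt0.
Let e0 : V' := vgen j0.
Let f0 (x : V') : D' := vcoord j0 x.
Let f0e0 : f0 e0 = 1. Proof. by rewrite /f0 vcoord_gen eqxx. Qed.

(* S is the image under theta of a rank one idempotent; mu s u is s (x) u. *)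
Definition mu (s : V) (u : V') : V := theta (rank_one j0 u) s.
Definition smul (y : D') (s : V) : V := mu s (ract y e0).
Definition simple : set V := [set s | theta (rank_one j0 e0) s = s].

Lemma muD s u v : mu s (u + v) = mu s u + mu s v.
Proof. by rewrite /mu rank_oneD thetaD add_lfunE. Qed.

Lemma muDl s t u : mu (s + t) u = mu s u + mu t u.
Proof. by rewrite /mu linearD. Qed.

Lemma mu_theta a s u : theta a (mu s u) = mu s (a u).
Proof. by rewrite /mu theta_comp lfun_rank_one. Qed.

Lemma mu_smul y s u : mu (smul y s) u = mu s (ract y u).
Proof. by rewrite /smul /mu theta_comp rank_one_comp vcoordZ -/(f0 e0) f0e0 mul1r. Qed.

Lemma mu_ract a s u : mu (ract a s) u = ract a (mu s u).
Proof. by rewrite /mu lfun_ract. Qed.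

Lemma mu_iota x s u : mu (iota x s) u = iota x (mu s u).
Proof. by rewrite /mu theta_iota. Qed.

Lemma mu_id s u : iota 1 (mu s u) = mu s u.
Proof. exact: theta_id. Qed.

Lemma mu_sum (J : Type) (s : seq J) (P : pred J) (F : J -> V) u :
  mu (\sum_(j <- s | P j) F j) u = \sum_(j <- s | P j) mu (F j) u.
Proof. by rewrite /mu linear_sum. Qed.

Lemma mu_sumr (J : Type) (r : seq J) (P : pred J) (F : J -> V') s :
  mu s (\sum_(j <- r | P j) F j) = \sum_(j <- r | P j) mu s (F j).
Proof.
by apply: (big_morph (mu s) (muD s)); apply: (addIr (mu s 0)); rewrite -muD !add0r.
Qed.

Lemma smul_simple y s : simple (smul y s).
Proof. by rewrite /simple /= /smul mu_theta rank_oneE vcoordZ -/(f0 e0) f0e0 mul1r. Qed.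

Lemma simple_id s : simple s -> iota 1 s = s.
Proof. by move=> <-; rewrite theta_id. Qed.

Lemma smul1 s : simple s -> smul 1 s = s.
Proof. by rewrite /smul ract1. Qed.

Lemma smulM y z s : smul (y * z) s = smul y (smul z s).
Proof. by rewrite /smul -/(smul z s) mu_smul ractM. Qed.

Lemma smulDl y z s : smul (y + z) s = smul y s + smul z s.
Proof. by rewrite /smul ractDl muD. Qed.

Lemma smulDr y s t : smul y (s + t) = smul y s + smul y t.
Proof. exact: muDl. Qed.

Lemma simple_ract a s : simple s -> simple (ract a s).
Proof. by rewrite /simple /= lfun_ract => ->. Qed.

Lemma simple0 : simple 0. Proof. exact: linear0. Qed.

Lemma simpleB s t : simple s -> simple t -> simple (s - t).
Proof. by rewrite /simple /= linearB /= => -> ->. Qed.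

Lemma smul_ract y a s : smul y (ract a s) = ract a (smul y s).
Proof. exact: mu_ract. Qed.

Lemma smul_alg (x : E) s : simple s -> smul x%:A s = iota x s.
Proof.
move=> Ss; rewrite -[in RHS]Ss -comp_lfunE -(thetaZ (b := rank_one j0 (ract x%:A e0))) //.
by move=> v; rewrite !rank_oneE -!ractM alg_comm.
Qed.

Lemma smul_scalar (c : k) s : simple s -> smul (c%:A : E)%:A s = ract c%:A s.
Proof. by move=> Ss; rewrite smul_alg // iotaZ simple_id. Qed.

Lemma fin_space_fg (J : finType) (g : J -> V) : (forall j, simple (g j)) ->
  (forall s, simple s -> aspan smul g s) ->
  exists n (s : 'I_n -> V), (forall i, simple (s i)) /\ simple `<=` aspan smul s.
Proof.
move=> Sg gP; exists #|J|, (fun i => g (enum_val i)); split=> // s /gP[a ->].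
exists (fun i => a (enum_val i)).
by rewrite (reindex _ (onW_bij _ (enum_val_bij J))).
Qed.

Lemma smul_space : is_space smul simple.
Proof.
split; [exact: smulDl|exact: smulDr|exact: smulM|exact: smul1| |exact: simple0|exact: simpleB|].
  by move=> y s _; exact: smul_simple.
pose N := \dim {:D}; pose g (p : 'I_N * 'I_(dim V)) :=
  theta (rank_one j0 e0) (ract (vbasis {:D})`_p.1 (vgen p.2)).
have Sg p : simple (g p).
  by rewrite /simple /g /= theta_comp rank_one_comp -/(f0 e0) f0e0 ract1.
apply: (fin_space_fg Sg) => s Ss.
pose c (p : 'I_N * 'I_(dim V)) : k := coord (vbasis {:D}) p.1 (vcoord p.2 s).
exists (fun p => (c p)%:A%:A).
rewrite -[LHS]Ss {1}(vcoordK s) linear_sum /= -(pair_bigA _ (fun i j => smul (c (i, j))%:A%:A (g (i, j)))) /=.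
rewrite exchange_big /=; apply: eq_bigr => j _.
rewrite {1}[vcoord j s](coord_vbasis (memvf _)) ract_suml linear_sum /=.
by apply: eq_bigr => i _; rewrite smul_scalar // -mulr_algr ractM lfun_ract.
Qed.

Lemma simple_nonzero : exists2 s, simple s & s != 0.
Proof.
apply: contrapT => H; suff : rank_one j0 e0 = 0.
  move/(congr1 (fun a : 'End(V') => f0 (a e0))); rewrite rank_oneE -/(f0 e0) f0e0 ract1 f0e0 zero_lfunE.
  by rewrite /f0 /vcoord linear0 mxE => /eqP; rewrite oner_eq0.
apply: theta_inj; rewrite theta0; apply/lfunP => x; rewrite zero_lfunE.
apply/eqP; apply: contraT => x0; exfalso; apply: H; exists (theta (rank_one j0 e0) x) => //.
by rewrite /simple /= theta_comp rank_one_comp -/(f0 e0) f0e0 ract1.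
Qed.

(* Averaging a D'-norm over D^x; it stays a norm because D is finite over k. *)
Lemma bimodule_norm : exists G, is_norm nuD' smul simple G /\
  forall s t a x, (s%:E <= nuD a)%E -> G t x -> G (s + t) (ract a x).
Proof.
have [L NL] := norm_exists D'v smul_space.
(* In terms of norms, G(s) is the infimum over nonzero a in D of L(s a) - nuD(a). *)
pose G t := [set s | simple s /\ forall a r, nuD a = r%:E -> L (t + r) (ract a s)].
exists G; split; last first.
  move=> s t a x sa [Sx Gx]; split=> [|a' r va']; first exact: simple_ract.
  have [->|a0] := eqVneq a 0.
    by rewrite ract0l ract0; exact: (norm0 NL).
  have [q vq] := valu_fin vD a0; rewrite -ractM.
  apply: (norm_anti NL (t := t + (q + r))); first by rewrite vq lee_fin in sa; lra.
  by apply: Gx; rewrite (valuationM vD) vq va'.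
split.
- by move=> t x [].
- by move=> t; split=> [|a r _]; [exact: simple0|rewrite ract0; exact: (norm0 NL)].
- move=> t x y [Sx Gx] [Sy Gy]; split=> [|a r va]; first exact: simpleB.
  by rewrite /ract scalerBr; apply: (normB NL); [exact: Gx|exact: Gy].
- move=> t x Sx H; split=> // a r va; apply: (norm_cont NL); first exact: simple_ract.
  move=> s st; have [|_ Hs] := H (s - r); first by lra.
  by have := Hs a r va; rewrite subrK.
- move=> s t x st [Sx Gx]; split=> // a r va; apply: (norm_anti NL) (Gx a r va); lra.
(* The infimum is finite: expanding a in an orthogonal k-basis of D bounds it by the finitely many
   values at the basis. *)
- move=> x Sx; have [m [b [c bL]]] := val_orth_basis kv nuD_ext.
  have /choice[f fP] i := norm_exh NL (simple_ract (b i) Sx).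
  have [t tP] := fin_lower_bound (fun i => f i - c i).
  exists t; split=> // a r va.
  have [h ah] := orth_span bL (I : setT a).
  have [hP _] := orthP bL r h; rewrite -ah in hP.
  have {}hP : forall i, ((r - c i)%:E <= nu (h i))%E by apply: hP; rewrite /val_filtration /= va.
  rewrite ah ract_suml; apply: (norm_sum NL) => i _.
  rewrite -mulr_algr ractM -smul_scalar; last exact: simple_ract.
  apply: (norm_anti NL (t := (r - c i) + f i)); first by have := tP i; lra.
  by apply: (norm_act NL) => //; rewrite nuD'_ext.2 nuE_ext.2.
- move=> x Sx H; apply: (norm_sep NL) => // t; have [_ /(_ 1 0)] := H t.
  by rewrite ract1 addr0; apply; exact: (valu1 vD).
- move=> s t y x sy [Sx Gx]; split=> [|a r va]; first exact: smul_simple.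
  rewrite -smul_ract -addrA; apply: (norm_act NL) => //; exact: Gx.
Qed.

(* The double centraliser property: a D'-linear endomorphism of S is a sum of     *)
(* D-linear ones twisted by a basis of D, and those are given by D'; averaging    *)
(* over D' moves their coefficients into E.                                        *)
Section Endomorphisms.
Variable phi : V -> V.
Hypotheses (phiS : forall s, simple s -> simple (phi s))
  (phiD : forall s t, simple s -> simple t -> phi (s + t) = phi s + phi t)
  (phi_smul : forall y s, simple s -> phi (smul y s) = smul y (phi s)).

Lemma phi_scalar (c : k) s : simple s -> phi (ract c%:A s) = ract c%:A (phi s).
Proof. by move=> Ss; rewrite -!smul_scalar ?phi_smul //; exact: phiS. Qed.

Lemma phi_iota x s : simple s -> phi (iota x s) = iota x (phi s).
Proof. by move=> Ss; rewrite -!smul_alg ?phi_smul //; exact: phiS. Qed.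

Lemma phi0 : phi 0 = 0.
Proof.
by apply: (addIr (phi 0)); rewrite -phiD ?addr0 ?add0r //; exact: simple0.
Qed.

Lemma simple_sum (J : Type) (s : seq J) (P : pred J) (F : J -> V) :
  (forall j, P j -> simple (F j)) -> simple (\sum_(j <- s | P j) F j).
Proof. by move=> SF; apply: (space_sum smul_space). Qed.

Lemma phi_sum (J : Type) (s : seq J) (P : pred J) (F : J -> V) :
  (forall j, P j -> simple (F j)) -> phi (\sum_(j <- s | P j) F j) = \sum_(j <- s | P j) phi (F j).
Proof.
move=> SF; have [] : simple (\sum_(j <- s | P j) F j) /\
    phi (\sum_(j <- s | P j) F j) = \sum_(j <- s | P j) phi (F j); last by [].
elim/big_rec2: _ => [|j y x Pj [Sx xy]]; first by split; [exact: simple0|exact: phi0].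
split; first by apply: (spaceD smul_space) => //; exact: SF.
by rewrite phiD ?xy //; exact: SF.
Qed.

(** Such a T commutes with E and D, so composed with the idempotent defining S it comes from End(V')
    under theta. Cut by the idempotent on both sides, it is a scalar in D'. *)
Lemma endo_smul (T : 'End(V)) : (forall s, simple s -> simple (T s)) ->
  (forall x s, simple s -> T (iota x s) = iota x (T s)) ->
  exists y, forall s, simple s -> T s = smul y s.
Proof.
move=> TS Tiota; pose p := rank_one j0 e0.
have pp v : theta p (theta p v) = theta p v.
  by rewrite theta_comp rank_one_comp -/(f0 e0) f0e0 ract1.
have Sp v : simple (theta p v) by exact: pp.
have [a _ aE] : [set theta a | a in @setT 'End(V')] (T \o theta p)%VF.
  rewrite theta_im; split.
  - by apply/lfunP => v; rewrite !comp_lfunE simple_id //; exact: TS.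
  - by apply/lfunP => v; rewrite !comp_lfunE theta_idr.
  - by move=> x; apply/lfunP => v; rewrite !comp_lfunE -theta_iota Tiota.
exists (f0 (a e0)) => s Ss.
have -> : T s = theta (p \o (a \o p))%VF s.
  by rewrite !thetaM !comp_lfunE aE !comp_lfunE pp Ss (TS _ Ss).
by rewrite /p lfun_rank_one rank_one_comp.
Qed.

(** The pieces T_l(v) = sum_j phi(v b_j) y_lj are D-linear by the second clause of [casimir], hence
    given by elements of D'. The third clause gives back phi as the sum of the T_l times b_l. *)
Lemma endo_expand : exists n (b : 'I_n -> D) (z : 'I_n -> D'), forall s, simple s ->
  phi s = \sum_l ract (b l) (smul (z l) s).
Proof.
have [n [b [y [_ yC [u u1 uE]]]]] := casimir D_central.
pose p := rank_one j0 e0.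
have Sp v : simple (theta p v) by rewrite /simple /= theta_comp rank_one_comp -/(f0 e0) f0e0 ract1.
pose T l v := \sum_j ract (y l j) (phi (ract (b j) (theta p v))).
have TD l v w : T l (v + w) = T l v + T l w.
  rewrite -big_split; apply: eq_bigr => j _.
  by rewrite linearD /= ractDr phiD ?ractDr //; exact: simple_ract.
have TZ l a v : T l (ract a v) = ract a (T l v).
  have [c bc cy] := yC a; rewrite /T lfun_ract.
  have E1 j : phi (ract (b j) (ract a (theta p v))) =
      \sum_i ract (c i j)%:A (phi (ract (b i) (theta p v))).
    rewrite -ractM bc ract_suml phi_sum => [|i _]; last by apply: simple_ract.
    apply: eq_bigr => i _; rewrite -mulr_algr ractM phi_scalar //; exact: simple_ract.
  under eq_bigr do rewrite E1 ract_sumr; rewrite exchange_big /= ract_sumr.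
  apply: eq_bigr => i _; rewrite -ractM -cy ract_suml; apply: eq_bigr => j _.
  by rewrite -ractM mulr_algl.
have Tlin l v : linfun (T l) v = T l v by exact: (linfun_ract (TD l) (TZ l)).
have TS l s : simple (linfun (T l) s).
  by rewrite Tlin; apply: simple_sum => j _; apply/simple_ract/phiS/simple_ract.
have Tiota l x s : simple s -> linfun (T l) (iota x s) = iota x (linfun (T l) s).
  move=> Ss; rewrite !Tlin /T linear_sum; apply: eq_bigr => j _ /=.
  by rewrite -theta_iota -lfun_ract phi_iota ?lfun_ract //; exact: simple_ract.
have /choice[z zP] l : exists z, forall s, simple s -> linfun (T l) s = smul z s.
  by apply: endo_smul => [s _|x s]; [exact: TS|exact: Tiota].
exists n, b, z => s Ss.
under eq_bigr do rewrite -zP // Tlin /T ract_sumr; rewrite exchange_big /=.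
have -> : theta p s = s by exact: Ss.
transitivity (\sum_j ract (u j)%:A (phi (ract (b j) s))).
  have <- : phi (ract 1 s) = phi s by rewrite ract1.
  rewrite -{1}u1 ract_suml phi_sum => [|j _]; last by apply: simple_ract.
  apply: eq_bigr => j _; rewrite -mulr_algr ractM phi_scalar //; exact: simple_ract.
by apply: eq_bigr => j _; rewrite -uE ract_suml; apply: eq_bigr => l _; rewrite -ractM.
Qed.

(** As phi commutes with D', its coefficients z_l may be replaced by their projections onto the
    centre E of D' ([casimir_unit]). *)
Theorem endo_tensor m (b : 'I_m -> E) : aspan *:%R b = setT ->
  exists f : 'I_m -> D, forall s, simple s -> phi s = tensor_act iota b f s.
Proof.
move=> bT; have [n [g [z gz]]] := endo_expand.
have [m' [b' [y' [cen b1]]]] := casimir_unit D'_central.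
have /choice[x xP] l : exists x : E, \sum_j b' j * z l * y' j = x%:A by exact: cen.
have phiE s : simple s -> phi s = \sum_l ract (g l) (iota (x l) s).
  move=> Ss; rewrite -[LHS]smul1; last exact: phiS.
  rewrite -b1 (act_suml smul_space).
  transitivity (\sum_j \sum_l smul (b' j) (ract (g l) (smul (z l) (smul (y' j) s)))).
    apply: eq_bigr => j _; rewrite smulM -phi_smul // gz; last exact: smul_simple.
    exact: (act_sum smul_space).
  rewrite exchange_big /=; apply: eq_bigr => l _.
  rewrite -smul_alg // -xP -smul_ract (act_suml smul_space); apply: eq_bigr => j _.
  by rewrite smul_ract -!smulM smul_ract.
have /choice[c cP] l : exists c : 'I_m -> k, x l = \sum_i c i *: b i.
  by have : setT (x l) by []; rewrite -bT.
exists (fun i => \sum_l c l i *: g l) => s Ss; rewrite phiE // /tensor_act.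
under [RHS]eq_bigr do rewrite ract_suml; rewrite exchange_big /=; apply: eq_bigr => l _.
rewrite cP (big_morph iota iotaD iota0) sum_lfunE ract_sumr; apply: eq_bigr => i _.
by rewrite iotaZ -!ractM mulr_algl.
Qed.

End Endomorphisms.

(** * Norms on V_i as tensor products with the norm of S *)

Definition comp : set V := [set v | iota 1 v = v].

Record is_ED_norm (L : R -> set V) : Prop := IsEDNorm {
  ED_norm : @is_norm R D^c nuD V (@ract D V) comp L;
  ED_iota : forall s t x v, (s%:E <= nuE x)%E -> L t v -> L (s + t) (iota x v) }.

(** The tensor product norm: v = sum_a s_a (x) u_a has value min_a (c a + X(u_a)), where u_a = q a
    v. *)
Definition transfer r (q : 'I_r.+1 -> V -> V') (c : 'I_r.+1 -> R) (X : R -> set V') (t : R) : set V :=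
  [set v | iota 1 v = v /\ forall a, X (t - c a) (q a v)].

(* m a u is s_a (x) u, for an orthogonal basis (s_a) of S over D' with values c a, *)
(* and q gives the coordinates.                                                    *)
Record component_data r (m : 'I_r.+1 -> V' -> V) (q : 'I_r.+1 -> V -> V') (c : 'I_r.+1 -> R) : Prop :=
  ComponentData {
  compD : forall a u v, m a (u + v) = m a u + m a v;
  comp_id : forall a u, iota 1 (m a u) = m a u;
  comp_coord : forall (u : 'I_r.+1 -> V') b, q b (\sum_a m a (u a)) = u b;
  comp_sum : forall v, iota 1 v = \sum_a m a (q a v);
  comp_proj : forall a v, q a (iota 1 v) = q a v;
  comp_theta : forall b a u, theta b (m a u) = m a (b u);
  comp_restrict : forall L, is_ED_norm L ->
    @is_norm R D'^c nuD' V' (@ract D' V') setT (fun t => [set u | L (t + c ord0) (m ord0 u)]);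
  comp_transferK : forall L, is_ED_norm L ->
    L = transfer q c (fun t => [set u | L (t + c ord0) (m ord0 u)]);
  comp_transfer : forall X, @is_norm R D'^c nuD' V' (@ract D' V') setT X ->
    is_ED_norm (transfer q c X) }.

(** Translating the norm of S amounts to translating the norm on V' in the opposite place of the
    tensor product. The freedom in z is what [dual_transfer] exploits. *)
Lemma component_shift r m q c (z : R) : @component_data r m q c ->
  component_data m q (fun a => c a + z).
Proof.
move=> H; split; [exact: compD H|exact: comp_id H|exact: comp_coord H|exact: comp_sum H|
  exact: comp_proj H|exact: comp_theta H| | |].
- move=> L HL; have := norm_shift z (comp_restrict H HL).
  by under eq_fun do rewrite /= addrAC -addrA.
- move=> L HL; rewrite {1}(comp_transferK H HL); apply/funext => t; apply/seteqP.
  have shE a v : L (t - (c a + z) + (c ord0 + z)) (m ord0 (q a v)) = L (t - c a + c ord0) (m ord0 (q a v)).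
    by congr (L _ _); ring.
  by split=> v [Pv Hv]; split=> // a; have := Hv a; rewrite /= shE.
- move=> X NX; have -> : transfer q (fun a => c a + z) X = transfer q c (fun t => X (t - z)).
    apply/funext => t; apply/seteqP.
    have shE a v : X (t - (c a + z)) (q a v) = X (t - c a - z) (q a v) by congr (X _ _); ring.
    by split=> v [Pv Hv]; split=> // a; have := Hv a; rewrite /= shE.
  exact/(comp_transfer H)/(norm_shift (- z) NX).
Qed.

Section Structure.
Variables (G : R -> set V).
Hypotheses (NG : is_norm nuD' smul simple G)
  (G_ract : forall s t a x, (s%:E <= nuD a)%E -> G t x -> G (s + t) (ract a x)).
Variables (r : nat) (g : 'I_r.+1 -> V) (c : 'I_r.+1 -> R).
Hypothesis gL : orth_basis nuD' smul simple G g c.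
Variable f : 'I_r.+1 -> V -> D'.
Hypothesis fP : forall s, simple s -> s = \sum_a smul (f a s) (g a).

Let g_ind := orth_independent D'v NG gL.
Let f_sum : forall y b, f b (\sum_a smul (y a) (g a)) = y b :=
  coord_sum smul_space g_ind fP (orth_in gL).

Lemma f_add a s t : simple s -> simple t -> f a (s + t) = f a s + f a t.
Proof.
move=> Ss St; rewrite {1}(fP Ss) {1}(fP St) -big_split /=.
by under eq_bigr do rewrite -smulDl; rewrite f_sum.
Qed.

Lemma f_smul a y s : simple s -> f a (smul y s) = y * f a s.
Proof.
move=> Ss; rewrite {1}(fP Ss) (act_sum smul_space).
by under eq_bigr do rewrite -smulM; rewrite f_sum.
Qed.

Lemma f_gen a b : f b (g a) = (a == b)%:R.
Proof.
have Sg := orth_in gL a; rewrite -[g a]smul1 //.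
have -> : smul 1 (g a) = \sum_i smul ((i == a)%:R) (g i).
  rewrite (bigD1 a) //= eqxx big1 ?addr0 // => i /negPf->.
  by rewrite (act0l smul_space).
by rewrite f_sum eq_sym.
Qed.

Definition cm (a : 'I_r.+1) (u : V') : V := mu (g a) u.
Definition cq (a : 'I_r.+1) (v : V) : V' :=
  \sum_j ract (f a (theta (rank_one j e0) v)) (vgen j).

Lemma simple_rank_one j v : simple (theta (rank_one j e0) v).
Proof. by rewrite /simple /= theta_comp rank_one_comp -/(f0 e0) f0e0 ract1. Qed.

Lemma cq_cm b a u : cq b (cm a u) = if a == b then u else 0.
Proof.
transitivity (\sum_j ract (vcoord j u * (a == b)%:R) (vgen j)).
  apply: eq_bigr => j _; congr (ract _ _).
  by rewrite /cm mu_theta rank_oneE -/(smul _ _) f_smul ?f_gen //; exact: (orth_in gL).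
rewrite [in RHS](vcoordK u); case: eqP => _; first by under eq_bigr do rewrite mulr1.
by rewrite big1 // => j _; rewrite mulr0 ract0l.
Qed.

Lemma cqD b v w : cq b (v + w) = cq b v + cq b w.
Proof.
rewrite /cq -big_split; apply: eq_bigr => j _.
by rewrite linearD f_add ?ractDl //; exact: simple_rank_one.
Qed.

Lemma cq_sum (J : Type) (l : seq J) (P : pred J) (F : J -> V) b :
  cq b (\sum_(j <- l | P j) F j) = \sum_(j <- l | P j) cq b (F j).
Proof.
by apply: (big_morph (cq b) (cqD b)); apply: (addIr (cq b 0)); rewrite -cqD !add0r.
Qed.

Lemma cq_coord (u : 'I_r.+1 -> V') b : cq b (\sum_a cm a (u a)) = u b.
Proof.
rewrite cq_sum; under eq_bigr do rewrite cq_cm.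
by rewrite -big_mkcond big_pred1_eq.
Qed.

Lemma cm_sum v : iota 1 v = \sum_a cm a (cq a v).
Proof.
rewrite -theta1 -rank_one_sum theta_sum sum_lfunE.
under [RHS]eq_bigr do rewrite /cm /cq mu_sumr; rewrite exchange_big /=.
apply: eq_bigr => j _.
have -> : rank_one j (vgen j) = (rank_one j0 (vgen j) \o rank_one j e0)%VF :> 'End(V').
  by rewrite rank_one_comp -/(f0 e0) f0e0 ract1.
rewrite -theta_comp -/(mu _ _) {1}(fP (simple_rank_one j v)) mu_sum.
by apply: eq_bigr => a _; rewrite mu_smul.
Qed.

Lemma cq_proj a v : cq a (iota 1 v) = cq a v.
Proof. by rewrite /cq; under eq_bigr do rewrite theta_idr. Qed.

Lemma cm_smul a y u : mu (smul y (g a)) u = cm a (ract y u).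
Proof. exact: mu_smul. Qed.

Lemma tensor_act_cm m (bE : 'I_m -> E) h v u : tensor_act iota bE h (mu v u) = mu (tensor_act iota bE h v) u.
Proof. by rewrite /tensor_act mu_sum; apply: eq_bigr => l _; rewrite mu_ract mu_iota. Qed.

Lemma tensor_actD m (bE : 'I_m -> E) h v w :
  tensor_act iota bE h (v + w) = tensor_act iota bE h v + tensor_act iota bE h w.
Proof. by rewrite -big_split; apply: eq_bigr => l _; rewrite linearD /= ractDr. Qed.

Lemma tensor_act_sum m (bE : 'I_m -> E) h (J : Type) (l : seq J) (P : pred J) (F : J -> V) :
  tensor_act iota bE h (\sum_(j <- l | P j) F j) = \sum_(j <- l | P j) tensor_act iota bE h (F j).
Proof.
apply: (big_morph (tensor_act iota bE h) (tensor_actD bE h)).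
by apply: (addIr (tensor_act iota bE h 0)); rewrite -tensor_actD !add0r.
Qed.

(* Matrix units of S over D' act on V through E (x) D, with the same norm. *)
Lemma matrix_unit_norm L a b y p t v : is_ED_norm L -> (p%:E <= nuD' y)%E -> L t v ->
  L (t + (p + c a - c b)) (cm a (ract y (cq b v))).
Proof.
move=> [NL Liota] py Lv.
pose phi s := smul (f b s * y) (g a).
have phiS s : simple s -> simple (phi s) by move=> _; exact: smul_simple.
have phiD s t' : simple s -> simple t' -> phi (s + t') = phi s + phi t'.
  by move=> Ss St; rewrite /phi f_add // mulrDl smulDl.
have phi_smul z s : simple s -> phi (smul z s) = smul z (phi s).
  by move=> Ss; rewrite /phi f_smul // -mulrA smulM.
have [m [bE [cE bEL]]] := val_orth_basis kv nuE_ext.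
have bET : aspan *:%R bE = setT.
  by apply/seteqP; split=> // x; exact: (orth_span bEL).
have [h hP] := endo_tensor phiS phiD phi_smul bET.
have [s0 Ss0 s00] := simple_nonzero.
have [g0 Gs0] := norm_val NG Ss0 s00.
have Giota s t' x w : (s%:E <= nuE x)%E -> G t' w -> G (s + t') (iota x w).
  move=> sx Gw; rewrite -smul_alg; last exact: (norm_sub NG) Gw.
  by apply: (norm_act NG) => //; rewrite nuD'_ext.2.
(* On S the bound for the matrix unit phi is read off from the orthogonal basis g. Then
   [tensor_norm] turns it into bounds for the coefficients h, which hold for any norm compatible
   with E and D. *)
have con : contracts iota G bE h (p + c a - c b).
  move=> t' s Gs; have Ss := norm_sub NG Gs; rewrite -hP //.
  have [fs _] := orthP gL t' (fun i => f i s); rewrite -fP // in fs.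
  have {}fs := fs Gs b; rewrite /phi; apply/(orth1 D'v smul_space gL).
  have -> : t' + (p + c a - c b) - c a = (t' - c b) + p by ring.
  exact: (valuM_ge vD').
have hb := tensor_norm k_local D_central D_index nuD_ext nuE_ext iotaD iotaM iotaZ
  (S := simple) simple_id (normB NG) (norm0 NG) (norm_anti NG) G_ract Giota Ss0 Gs0 bEL con.
have vbE := val_orthE kv bEL.
have Pv : iota 1 v = v by exact: (norm_sub NL Lv).
have hg i : tensor_act iota bE h (g i) = phi (g i) by rewrite hP //; exact: (orth_in gL).
have -> : cm a (ract y (cq b v)) = tensor_act iota bE h v.
  rewrite -[in RHS]Pv cm_sum tensor_act_sum (bigD1 b) //= big1 ?addr0 => [|i ib].
    rewrite /cm tensor_act_cm hg /phi f_gen eqxx mul1r.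
    by rewrite cm_smul.
  rewrite /cm tensor_act_cm hg /phi f_gen (negPf ib) mul0r.
  by rewrite (act0l smul_space) /mu linear0.
apply: (norm_sum NL) => l _.
have -> : t + (p + c a - c b) = (p + c a - c b - cE l) + (cE l + t) by ring.
by apply: (norm_act NL); [exact: hb|apply: Liota => //; rewrite vbE].
Qed.

Lemma cm0 a : cm a 0 = 0.
Proof. by rewrite -[0]/(0 : V'); apply: (addIr (cm a 0)); rewrite /cm -muD !add0r. Qed.

Lemma cm_inj a u : cm a u = 0 -> u = 0.
Proof.
move=> mu0; have := cq_cm a a u; rewrite eqxx mu0 => <-.
by apply: (addIr (cq a 0)); rewrite -cqD !add0r.
Qed.

Lemma restrict_norm L : is_ED_norm L ->
  @is_norm R D'^c nuD' V' (@ract D' V') setT (fun t => [set u | L (t + c ord0) (cm ord0 u)]).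
Proof.
move=> EL; have NL := ED_norm EL.
have cmC a u : comp (cm a u) by exact: mu_id.
split=> //.
- by move=> t; rewrite /= cm0; exact: (norm0 NL).
- move=> t x y /= Lx Ly; have -> : cm ord0 (x - y) = cm ord0 x - cm ord0 y.
    by apply/eqP; rewrite eq_sym subr_eq /cm -muD subrK.
  exact: (normB NL).
- move=> t x _ H; apply: (norm_cont NL) => // s st.
  by have := H (s - c ord0); rewrite /= subrK; apply; lra.
- by move=> s t x st /=; apply: (norm_anti NL); rewrite lerD2r.
- move=> x _; have [t Lt] := norm_exh NL (cmC ord0 x); exists (t - c ord0).
  by rewrite /= subrK.
- move=> x _ H; apply: (@cm_inj ord0); apply: (norm_sep NL) => // t.
  by have := H (t - c ord0); rewrite /= subrK.
- move=> s t y u sy /= Lu.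
  have := matrix_unit_norm ord0 ord0 EL sy Lu; rewrite cq_cm eqxx.
  by congr (L _ _); ring.
Qed.

(** The matrix units with y = 1 that carry g_a to g_0 and back shift values by at least c_0 - c_a
    and c_a - c_0; the two inclusions follow. *)
Lemma transfer_restrict L : is_ED_norm L ->
  L = transfer cq c (fun t => [set u | L (t + c ord0) (cm ord0 u)]).
Proof.
move=> EL; have NL := ED_norm EL; have v1 : ((0 : R)%:E <= nuD' 1%R)%E by rewrite (valu1 vD').
apply/funext => t; apply/seteqP; split=> v.
  move=> Lv; split=> [|a]; first exact: (norm_sub NL Lv).
  have := matrix_unit_norm ord0 a EL v1 Lv; rewrite ract1 /=.
  by congr (L _ _); ring.
move=> [Pv H]; rewrite -Pv cm_sum; apply: (norm_sum NL) => a _.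
have := matrix_unit_norm a ord0 EL v1 (H a); rewrite ract1 cq_cm eqxx.
by congr (L _ _); ring.
Qed.

Lemma cq0 a : cq a 0 = 0.
Proof. by apply: (addIr (cq a 0)); rewrite -cqD !add0r. Qed.

Lemma cqB a v w : cq a (v - w) = cq a v - cq a w.
Proof. by apply/eqP; rewrite eq_sym subr_eq -cqD subrK. Qed.

Lemma cq_ract b x v : iota 1 v = v ->
  cq b (ract x v) = \sum_a ract (f b (ract x (g a))) (cq a v).
Proof.
move=> Pv; rewrite -{1}Pv cm_sum ract_sumr cq_sum; apply: eq_bigr => a _.
rewrite /cm -mu_ract {1}(fP (simple_ract x (orth_in gL a))) mu_sum.
by under eq_bigr do rewrite cm_smul; rewrite cq_coord.
Qed.

Lemma cq_iota b x v : iota 1 v = v -> cq b (iota x v) = ract x%:A (cq b v).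
Proof.
move=> Pv; rewrite -{1}Pv cm_sum linear_sum /=.
have E1 a : iota x (cm a (cq a v)) = cm a (ract x%:A (cq a v)).
  by rewrite /cm -mu_iota -smul_alg ?mu_smul //; exact: (orth_in gL).
by under eq_bigr do rewrite E1; rewrite cq_coord.
Qed.

(** Compatibility with D comes from G: the D'-coordinates of g_a x have values bounded by
    orthogonality of g. Elements of E act through the scalars of D'. *)
Lemma transfer_ED X : @is_norm R D'^c nuD' V' (@ract D' V') setT X -> is_ED_norm (transfer cq c X).
Proof.
move=> NX; split; first split.
- by move=> t x [].
- by move=> t; split=> [|a]; [exact: linear0|rewrite cq0; exact: (norm0 NX)].
- move=> t x y [Px Xx] [Py Xy]; split=> [|a]; first by rewrite linearB /= Px Py.
  by rewrite cqB; exact: (normB NX).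
- move=> t x Px H; split=> // a; apply: (norm_cont NX) => // s st.
  have [|_ Hs] := H (s + c a); first by lra.
  by have := Hs a; rewrite addrK.
- by move=> s t x st [Px Xx]; split=> // a; apply: (norm_anti NX) (Xx a); rewrite lerD2r.
- move=> x Px; have /choice[h hP] a := norm_exh NX (I : setT (cq a x)).
  have [t tP] := fin_lower_bound (fun a => h a + c a).
  by exists t; split=> // a; apply: (norm_anti NX) (hP a); rewrite lerBlDr.
- move=> x Px H; rewrite -Px cm_sum big1 // => a _.
  rewrite (norm_sep NX (I : setT (cq a x))) ?cm0 // => t.
  by have [_ /(_ a)] := H (t + c a); rewrite addrK.
- move=> s t x v sx [Pv Xv]; rewrite -[@ract D V x v]/(ract (x : D) v).
  move: (x : D) sx => {}x sx; split=> [|b]; first by rewrite lfun_ract Pv.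
  rewrite cq_ract //; apply: (norm_sum NX) => a _.
  have -> : s + t - c b = (s + c a - c b) + (t - c a) by ring.
  apply: (norm_act NX) => //.
  have Gg : G (s + c a) (ract x (g a)).
    by apply: G_ract => //; apply/(orth1_gen D'v smul_space gL).
  have [H _] := orthP gL (s + c a) (fun i => f i (ract x (g a))).
  by apply: H; rewrite -fP //; exact: simple_ract (orth_in gL a).
- move=> s t x v sx [Pv Xv]; split=> [|b].
    by rewrite -!comp_lfunE -iotaM mul1r.
  by rewrite cq_iota // -addrA; apply: (norm_act NX) => //; rewrite nuD'_ext.2.
Qed.

Lemma structure_data : component_data cm cq c.
Proof.
split; [by move=> a u v; exact: muD|by move=> a u; exact: mu_id|exact: cq_coord|exact: cm_sum|
  exact: cq_proj|by move=> b a u; exact: mu_theta|exact: restrict_norm|exact: transfer_restrict|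
  exact: transfer_ED].
Qed.

End Structure.

Theorem component_structure : exists r (m : 'I_r.+1 -> V' -> V) q c, component_data m q c.
Proof.
have [G [NG G_ract]] := bimodule_norm.
have [[|r] [g [c gL]]] := orth_basis_exists smul_space NG D'v.
  have [s Ss] := simple_nonzero.
  by have [a ->] := orth_span gL Ss; rewrite big_ord0 eqxx.
have [f fP] := independent_coord (orth_span gL).
by exists r, (cm g), (cq f), c; apply: (structure_data NG G_ract gL fP).
Qed.

End Component.

Lemma involution1 (A : unitRingType) (rho : A -> A) : is_involution rho -> rho 1 = 1.
Proof. by move=> [_ rM rK]; have := rM (rho 1) 1; rewrite mulr1 rK mulr1. Qed.

(** * Duality *)

Section Hermitian.
Variables (R : realType) (A : unitRingType) (v : A -> \bar R).
Hypotheses (Av : is_cdv v) (v2 : v 2%:R = 0%E).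
Let vv := cdv_val Av.
Variables (rho : A -> A) (rho_inv : is_involution rho).
Variables (V : vectType A^c) (eps : A) (h : V -> V -> A) (hh : is_nondeg_hermitian rho eps h).
Local Notation norm := (@is_norm R A^c v V (@ract A V) setT).

Lemma rho1 : rho 1 = 1. Proof. exact: involution1. Qed.

Lemma rho0 : rho 0 = 0.
Proof. by apply: (addIr (rho 0)); rewrite -(involutionD rho_inv) !add0r. Qed.

Lemma rhoN x : rho (- x) = - rho x.
Proof. by apply: (addIr (rho x)); rewrite -(involutionD rho_inv) !addNr rho0. Qed.

Lemma rho_valu x : v (rho x) = v x.
Proof. exact: (involution_valu Av v2 rho_inv). Qed.

Lemma eps_comm x : eps * x = x * eps.
Proof. by case: (hermitian_sign hh) => ->; rewrite ?mul1r ?mulr1 // mulN1r mulrN1. Qed.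

Lemma eps_sqr : eps * eps = 1.
Proof. by case: (hermitian_sign hh) => ->; rewrite ?mulr1 // mulrNN mulr1. Qed.

Lemma rho_eps : rho eps = eps.
Proof. by case: (hermitian_sign hh) => ->; rewrite ?rhoN rho1. Qed.

Lemma valu_eps : v eps = 0%E.
Proof. by case: (hermitian_sign hh) => ->; rewrite ?(valuN vv) (valu1 vv). Qed.

Lemma herm_sym x y : h x y = eps * rho (h y x).
Proof. by have := hermitianE hh x y 1 1; rewrite !ract1 rho1 !mulr1. Qed.

Lemma hermZr x y b : h x (ract b y) = h x y * b.
Proof. by have := hermitianE hh x y 1 b; rewrite ract1 rho1 mulr1 -herm_sym. Qed.

Lemma hermZl x y a : h (ract a x) y = rho a * h x y.
Proof.
have := hermitianE hh x y a 1; rewrite ract1 !mulr1 => ->.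
by rewrite eps_comm -mulrA -herm_sym.
Qed.

Lemma herm0r x : h x 0 = 0.
Proof. by apply: (addIr (h x 0)); rewrite -(hermitianDr hh) !add0r. Qed.

Lemma herm0l x : h 0 x = 0.
Proof. by apply: (addIr (h 0 x)); rewrite -(hermitianDl hh) !add0r. Qed.

Lemma hermBr x y z : h x (y - z) = h x y - h x z.
Proof. by apply/eqP; rewrite eq_sym subr_eq -(hermitianDr hh) subrK. Qed.

Lemma hermBl x y z : h (x - y) z = h x z - h y z.
Proof. by apply/eqP; rewrite eq_sym subr_eq -(hermitianDl hh) subrK. Qed.

Lemma herm_sumr (J : Type) (s : seq J) (P : pred J) (F : J -> V) x :
  h x (\sum_(j <- s | P j) F j) = \sum_(j <- s | P j) h x (F j).
Proof. exact: (big_morph (h x) (hermitianDr hh x) (herm0r x)). Qed.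

Lemma herm_suml (J : Type) (s : seq J) (P : pred J) (F : J -> V) x :
  h (\sum_(j <- s | P j) F j) x = \sum_(j <- s | P j) h (F j) x.
Proof. exact: (big_morph (h^~ x) (fun y z => hermitianDl hh y z x) (herm0l x)). Qed.

Lemma herm_valu x y : v (h x y) = v (h y x).
Proof. by rewrite herm_sym (valuationM vv) valu_eps add0e rho_valu. Qed.

Lemma herm_inj y z : (forall x, h x y = h x z) -> y = z.
Proof.
move=> E; apply/eqP; rewrite -subr_eq0; apply/eqP/(hermitian_nondeg hh) => x.
by rewrite herm_sym hermBr E subrr rho0 mulr0.
Qed.

(** The dual norm, with value the infimum over w of v(h(x, w)) - L(w). The strict inequalities of
    [dual_lattice_function] are avoided. *)
Definition dual (L : R -> set V) (t : R) : set V :=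
  [set x | forall s w, L s w -> ((t + s)%:E <= v (h x w))%E].

(** If h(x, w) had value n st below t + s, scaling w by a scalar of value -n st would give a pairing
    of value 0 at a parameter still above -t. *)
Lemma dual_lattice_functionE L : norm L -> dual_lattice_function v h L = dual L.
Proof.
move=> NL; have [pi piu] := cdv_pi Av; have st0 := step_gt0 piu.
set st := fine (v pi) in st0.
apply/funext => t; apply/seteqP; split=> x H s => [w Lw|ts w Lw]; last first.
  by apply: lt_le_trans (H _ _ Lw); rewrite lte_fin; lra.
rewrite leNgt; apply/negP => lt.
have hxw : h x w != 0 by apply: contraTneq lt => ->; rewrite (valu0 vv) -leNgt leey.
have [n] := valu_discrete Av piu hxw; rewrite -/st => vn.
rewrite vn lte_fin in lt.
have [b b0] := valu_scalar Av piu (- n); rewrite -/st mulrNz mulNr => vb.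
have Lb : L (- (n%:~R * st) + s) (ract b w) by apply: (norm_act NL) => //; rewrite vb.
have := H _ _ _ Lb; rewrite /val_ideal /= hermZr (valuationM vv) vn vb -EFinD subrr ltxx.
by move=> F; have := F (ltac:(lra)).
Qed.

Lemma dual_mem_basis L (J : finType) (b : J -> V) (c : J -> R) x t :
  norm L -> @orth_basis R A^c v V (@ract A V) setT L J b c ->
  dual L t x <-> forall j, ((t + c j)%:E <= v (h x (b j)))%E.
Proof.
move=> NL bL; have Ac := is_cdv_conv Av; have S := right_spaceT V; split=> [H j|H s w Lw].
  by apply: H; apply/(orth1_gen Ac S bL).
have [a wa] := orth_span bL (I : setT w).
have [aP _] := orthP bL s a; rewrite -wa in aP; have {}aP := aP Lw.
rewrite wa herm_sumr; apply: (valu_sum_ge vv) => j _.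
rewrite -[@ract A V _ _]/(ract (a j : A) (b j)) hermZr.
have -> : t + s = (t + c j) + (s - c j) by ring.
exact: (valuM_ge vv).
Qed.

(** An orthogonal basis reduces membership in the dual to finitely many inequalities; compatibility
    with scalars uses that rho preserves v. *)
Lemma dual_norm L : norm L -> norm (dual L).
Proof.
move=> NL; have Ac := is_cdv_conv Av; have S := right_spaceT V.
have [n [b [c bL]]] := orth_basis_exists S NL Ac.
have memP t x := dual_mem_basis x t NL bL.
split=> //.
- by move=> t s w _; rewrite herm0l (valu0 vv) leey.
- by move=> t x y Hx Hy s w Lw; rewrite hermBl; apply: (valuB_ge vv); [exact: Hx|exact: Hy].
- move=> t x _ H s w Lw.
  have [->|h0] := eqVneq (h x w) 0; first by rewrite (valu0 vv) leey.
  have [r vr] := valu_fin vv h0; rewrite vr lee_fin leNgt; apply/negP => lt.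
  have := H ((t + (r - s)) / 2); rewrite ltr_pdivrMr // => /(_ _ s w Lw).
  by rewrite vr lee_fin -lerBrDr ler_pdivrMr // => F; have := F (ltac:(lra)); lra.
- by move=> s t x st H s' w Lw; apply: le_trans (H _ _ Lw); rewrite lee_fin lerD2r.
- move=> x _.
  have /choice[f fP] j : exists t, ((t + c j)%:E <= v (h x (b j)))%E.
    have [->|h0] := eqVneq (h x (b j)) 0; first by exists 0; rewrite (valu0 vv) leey.
    by have [r ->] := valu_fin vv h0; exists (r - c j); rewrite subrK.
  have [t tP] := fin_lower_bound f; exists t; apply/memP => j.
  by apply: le_trans (fP j); rewrite lee_fin lerD2r.
- move=> x _ H; apply: (hermitian_nondeg hh) => w.
  have [s Ls] := norm_exh NL (I : setT w).
  by apply: (valu_eq0 vv) => t; have := H (t - s) _ _ Ls; rewrite subrK.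
- move=> s t a x sa H s' w Lw.
  rewrite -[@ract A V _ _]/(ract (a : A) x) hermZl -addrA.
  by apply: (valuM_ge vv); [rewrite rho_valu|exact: H].
Qed.

Variables (sigma : 'End(V) -> 'End(V)) (sigma_adj : is_adjoint_involution h sigma).

Lemma sigma_unique (a b : 'End(V)) : (forall x y, h (a x) y = h x (b y)) -> sigma a = b.
Proof. by move=> E; apply/lfunP => y; apply: herm_inj => x; rewrite -sigma_adj. Qed.

Lemma sigmaD a b : sigma (a + b) = sigma a + sigma b.
Proof.
apply: sigma_unique => x y.
by rewrite !add_lfunE (hermitianDl hh) (hermitianDr hh) !sigma_adj.
Qed.

Lemma sigmaM a b : sigma (a \o b)%VF = (sigma b \o sigma a)%VF.
Proof. by apply: sigma_unique => x y; rewrite !comp_lfunE !sigma_adj. Qed.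

Lemma sigma_adjr (a : 'End(V)) x y : h x (a y) = h (sigma a x) y.
Proof. by rewrite [RHS]herm_sym -sigma_adj -herm_sym. Qed.

Lemma sigmaK a : sigma (sigma a) = a.
Proof. by apply: sigma_unique => x y; rewrite -sigma_adjr. Qed.

Lemma sigma0 : sigma 0 = 0.
Proof. by apply: sigma_unique => x y; rewrite !zero_lfunE herm0l herm0r. Qed.

Lemma sigmaN a : sigma (- a) = - sigma a.
Proof. by apply: (addIr (sigma a)); rewrite -sigmaD !addNr sigma0. Qed.

Lemma sigma_sum (J : Type) (s : seq J) (P : pred J) (F : J -> 'End(V)) :
  sigma (\sum_(j <- s | P j) F j) = \sum_(j <- s | P j) sigma (F j).
Proof. exact: (big_morph sigma sigmaD sigma0). Qed.

Lemma herm_pair_one x : x != 0 -> exists u, h u x = 1.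
Proof.
move=> x0; have [w hw] : exists w, h x w != 0.
  apply: contrapT => H; move/eqP: x0; apply; apply: (hermitian_nondeg hh) => w.
  by apply/eqP; apply: contraT => hw; case: H; exists w.
have uw : h w x \is a GRing.unit.
  apply: (cdv_unit Av); apply: contra hw => /eqP E.
  by rewrite herm_sym E rho0 mulr0.
by exists (ract (rho (h w x)^-1) w); rewrite hermZl (involutionK rho_inv) mulVr.
Qed.

(* D-linear functionals are represented by h, through the adjoint of a rank one map *)
Lemma riesz (f : V -> A) : (forall x y, f (x + y) = f x + f y) -> (forall a x, f (ract a x) = f x * a) ->
  exists y, forall x, h y x = f x.
Proof.
move=> fD fZ; have [[x0 nx0]|all0] := pselect (exists x : V, x != 0); last first.
  exists 0 => x; rewrite herm0l; have -> : x = 0.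
    by apply/eqP; apply: contraT => nx; case: all0; exists x.
  by apply/esym/(addIr (f 0)); rewrite -fD !add0r.
have [u hu] := herm_pair_one nx0.
pose a : 'End(V) := linfun (fun x => ract (f x) u).
have aE x : a x = ract (f x) u.
  by apply: linfun_ract => [y z|b y]; rewrite ?fD ?ractDl ?fZ ?ractM.
exists (ract eps (sigma a x0)) => x.
by rewrite hermZl rho_eps herm_sym -sigma_adj aE hermZl hu mulr1 (involutionK rho_inv) mulrA eps_sqr mul1r.
Qed.

Lemma dual_basis_exists L (J : finType) (b : J -> V) (c : J -> R) :
  norm L -> @orth_basis R A^c v V (@ract A V) setT L J b c ->
  exists y : J -> V, forall (a : J -> A) j, h (y j) (\sum_i ract (a i) (b i)) = a j.
Proof.
move=> NL bL; have Ac := is_cdv_conv Av; have S := right_spaceT V.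
have ib := orth_independent Ac NL bL.
have [f fP] := independent_coord (orth_span bL).
have fE a j : f j (\sum_i ract (a i) (b i)) = a j.
  exact: (coord_sum S ib fP (orth_in bL)).
have fT x : x = \sum_i ract (f i x : A) (b i) by exact: fP.
have /choice[y yP] j : exists y, forall x, h y x = f j x.
  apply: riesz => [x1 x2|a x].
    rewrite {1}(fT x1) {1}(fT x2) -big_split /=.
    by under eq_bigr do rewrite -ractDl; rewrite fE.
  rewrite {1}(fT x) ract_sumr; under eq_bigr do rewrite -ractM.
  by rewrite fE.
by exists y => a j; rewrite yP fE.
Qed.

(** The basis dual to an orthogonal basis with values c_j has dual values at least -c_j, and pairing
    with it recovers the coordinates. *)
Lemma dualK L : norm L -> dual (dual L) = L.
Proof.
move=> NL; have Ac := is_cdv_conv Av; have S := right_spaceT V.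
apply/funext => t; apply/seteqP; split=> x; last first.
  by move=> Lx s w Hw; rewrite herm_valu addrC; exact: Hw.
have [n [b [c bL]]] := orth_basis_exists S NL Ac.
have [y yP] := dual_basis_exists NL bL.
have dy j : dual L (- c j) (y j).
  move=> s w Lw; have [a wa] := orth_span bL (I : setT w).
  have [aP _] := orthP bL s a; rewrite -wa in aP; have {}aP := aP Lw j.
  by rewrite wa yP addrC.
move=> H; have [a xa] := orth_span bL (I : setT x).
rewrite xa; apply/(orthP bL) => j.
by have := H _ _ (dy j); rewrite herm_valu xa yP.
Qed.

Lemma square_dual L (a : 'End(V)) t : (forall s x, L s x -> L (s + t) (a x)) ->
  forall s x, dual L s x -> dual L (s + t) (sigma a x).
Proof.
move=> La s x Hx s' w Lw; rewrite -sigma_adjr.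
have -> : s + t + s' = s + (s' + t) by ring.
by apply: Hx; exact: La.
Qed.

End Hermitian.

(* Both h(m v', m w') and h'(v', w') have the same adjoint involution, so the first *)
(* is a function of the second; hence dualisation commutes with transfer up to a    *)
(* translation, which the choice of origin in the norm of S absorbs.                *)
Section DualTransfer.
Variables (R : realType) (k : fieldType) (D : falgType k) (nuD : D -> \bar R).
Variables (E : fieldExtType k) (nuE : E -> \bar R) (D' : falgType E) (nuD' : D' -> \bar R).
Hypotheses (Dv : is_cdv nuD) (D'v : is_cdv nuD') (D2 : nuD 2%:R = 0%E) (D'2 : nuD' 2%:R = 0%E).
Let vD := cdv_val Dv.
Let vD' := cdv_val D'v.
Variables (V : vectType D^c) (V' : vectType D'^c) (iota : E -> 'End(V)) (theta : 'End(V') -> 'End(V)).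
Variables (rho : D -> D) (rho_inv : is_involution rho) (eps : D) (h : V -> V -> D).
Hypothesis hh : is_nondeg_hermitian rho eps h.
Variables (sigma : 'End(V) -> 'End(V)) (sigma_adj : is_adjoint_involution h sigma).
Variables (rho' : D' -> D') (eps' : D') (h' : V' -> V' -> D').
Hypotheses (rho'_inv : is_involution rho') (hh' : is_nondeg_hermitian rho' eps' h').
Hypothesis h'_adj : forall a a' : 'End(V'), theta a' = sigma (theta a) ->
  forall v w, h' (a v) w = h' v (a' w).
Hypothesis sigma_theta : forall a, exists a', theta a' = sigma (theta a).
Hypothesis V'_neq0 : exists x : V', x != 0.

Definition comp_dual (L : R -> set V) (t : R) : set V :=
  [set v | iota 1 v = v /\ dual nuD h L t v].

Hypothesis comp_dual_ED : forall L, is_ED_norm nuD nuE iota L -> is_ED_norm nuD nuE iota (comp_dual L).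
Variables (r : nat) (m : 'I_r.+1 -> V' -> V) (q : 'I_r.+1 -> V -> V') (c : 'I_r.+1 -> R).
Hypothesis cd : component_data nuD nuE nuD' iota theta m q c.

Local Notation norm' := (@is_norm R D'^c nuD' V' (@ract D' V') setT).

(** The rank one map a with a(x1) = u commutes with m through theta. Moving it to the other side of
    h replaces w by its image under the adjoint, which depends on w only through h'(u, w). *)
Lemma pairing_factor : exists g : 'I_r.+1 -> D' -> D, (forall b, g b 0 = 0) /\
  forall b u w, h (m ord0 u) (m b w) = g b (h' u w).
Proof.
have [x1 x10] := V'_neq0; have [u1 hu1] := herm_pair_one D'v rho'_inv hh' x10.
have m0 b : m b 0 = 0 by apply: (addIr (m b 0)); rewrite -(compD cd) !add0r.
exists (fun b y => h (m ord0 x1) (m b (ract (eps' * y) u1))); split=> [b|b u w].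
  by rewrite mulr0 ract0l m0 (herm0r hh).
pose a : 'End(V') := linfun (fun x => ract (h' u1 x) u).
have aE x : a x = ract (h' u1 x) u.
  apply: linfun_ract => [y z|y z]; first by rewrite (hermitianDr hh') ractDl.
  by rewrite (hermZr rho'_inv hh') ractM.
have [a' a'P] := sigma_theta a; have adj := h'_adj a'P.
have a'E y : a' y = ract (eps' * h' u y) u1.
  apply: (herm_inj rho'_inv hh') => x.
  rewrite -adj aE (hermZl rho'_inv hh') (hermZr rho'_inv hh') (herm_sym rho'_inv hh' x u1).
  by rewrite (eps_comm hh' (rho' _)) -mulrA [eps' * (eps' * _)]mulrA (eps_sqr hh') mul1r.
have {1}-> : u = a x1 by rewrite aE hu1 ract1.
by rewrite -(comp_theta cd) sigma_adj -a'P (comp_theta cd) a'E.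
Qed.

Lemma transfer_gen X b s w : norm' X -> X s w -> transfer iota q c X (s + c b) (m b w).
Proof.
move=> NX Xw; have m0 a : m a 0 = 0 by apply: (addIr (m a 0)); rewrite -(compD cd) !add0r.
split=> [|a]; first exact: (comp_id cd).
have -> : m b w = \sum_i m i (if i == b then w else 0).
  by rewrite (bigD1 b) //= eqxx big1 ?addr0 // => i /negPf->.
rewrite (comp_coord cd); case: eqP => [->|_]; last exact: (norm0 NX).
by rewrite addrK.
Qed.

(** By [pairing_factor], and since w can be rescaled to give h'(u, w) any value in D', membership in
    the dual depends on u only through t + s - nuD'(h'(u, w)). The admissible numbers form a closed
    ray, whose end point is z. *)
Lemma dual_transfer_cut : exists z, forall X, norm' X ->
  comp_dual (transfer iota q c X) = transfer iota q c (fun t => dual nuD' h' X (t - z)).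
Proof.
have [g [g0 gP]] := pairing_factor.
pose P t := forall b x p, nuD' x = p%:E -> ((t + p + c ord0 + c b)%:E <= nuD (g b x))%E.
pose Xd X t := [set u | comp_dual (transfer iota q c X) (t + c ord0) (m ord0 u)].
have XdP X t u : norm' X -> Xd X t u <->
    forall s w p, X s w -> nuD' (h' u w) = p%:E -> P (t + s - p).
  move=> NX; split=> [[_ H] s w p Xw vp b x p' vp'|H].
    have y0 := valu_neq0 vD' vp; have uy := cdv_unit D'v y0.
    pose w1 := ract ((h' u w)^-1 * x) w.
    have Xw1 : X (- p + p' + s) w1.
      by apply: (norm_act NX) => //; apply: (valuM_ge vD'); rewrite ?(valuV vD' uy vp) ?vp'.
    have := H _ _ (transfer_gen b NX Xw1); rewrite gP /w1 (hermZr rho'_inv hh') mulVKr //.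
    by congr (_%:E <= _)%E; ring.
  split=> [|s w [Pw Xw]]; first exact: (comp_id cd).
  rewrite -Pw (comp_sum cd) (herm_sumr hh); apply: (valu_sum_ge vD) => b _; rewrite gP.
  have [->|h0] := eqVneq (h' u (q b w)) 0; first by rewrite g0 (valu0 vD) leey.
  have [p vp] := valu_fin vD' h0.
  have := H _ _ _ (Xw b) vp b _ _ vp.
  by congr (_%:E <= _)%E; ring.
(* The ray is nonempty and proper because the restriction of the dual to V' is a norm: it is
   exhaustive and separated. *)
have [z zP] : exists z, forall t, P t <-> t <= z.
  have [x1 x10] := V'_neq0.
  have [X NX] := norm_exists (is_cdv_conv D'v) (right_spaceT V').
  have NXd := comp_restrict cd (comp_dual_ED (comp_transfer cd NX)).
  apply: real_cut.
  - have [t Xt] := norm_exh NXd (I : setT x1).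
    have [w hw] : exists w, h' x1 w != 0.
      apply: contrapT => H; move/eqP: x10; apply; apply: (hermitian_nondeg hh') => w.
      by apply/eqP; apply: contraT => hw; case: H; exists w.
    have [s Xs] := norm_exh NX (I : setT w); have [p vp] := valu_fin vD' hw.
    by exists (t + s - p); exact: ((XdP X t x1 NX).1 Xt s w p Xs vp).
  - apply: contrapT => /forallNP H; move/eqP: x10; apply; apply: (norm_sep NXd) => // t.
    by apply/(XdP X t x1 NX) => s w p _ _; exact: contrapT (H _).
  - move=> s t st Pt b x p vp; apply: le_trans (Pt b x p vp); rewrite lee_fin; lra.
  - move=> t Ps b x p vp.
    have [->|h0] := eqVneq (g b x) 0; first by rewrite (valu0 vD) leey.
    have [y vy] := valu_fin vD h0; rewrite vy lee_fin leNgt; apply/negP => lt.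
    have := Ps ((t + (y - (p + c ord0 + c b))) / 2); rewrite ltr_pdivrMr // => /(_ _ b x p vp).
    by rewrite vy lee_fin => F; have := F (ltac:(lra)); lra.
exists z => X NX.
rewrite (comp_transferK cd (comp_dual_ED (comp_transfer cd NX))).
congr (transfer iota q c _); apply/funext => t; apply/seteqP.
split=> u; rewrite -/(Xd X t u).
  move=> /(XdP X t u NX) H s w Xw.
  have [->|h0] := eqVneq (h' u w) 0; first by rewrite (valu0 vD') leey.
  have [p vp] := valu_fin vD' h0; rewrite vp lee_fin.
  by have /zP := H s w p Xw vp; lra.
move=> H; apply/(XdP X t u NX) => s w p Xw vp; apply/zP.
by have := H s w Xw; rewrite vp lee_fin; lra.
Qed.

Lemma transfer_shift z X : transfer iota q (fun a => c a + z) X = transfer iota q c (fun t => X (t - z)).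
Proof.
apply/funext => t; apply/seteqP.
have shE a v : X (t - (c a + z)) (q a v) = X (t - c a - z) (q a v) by congr (X _ _); ring.
by split=> v [Pv Hv]; split=> // a; have := Hv a; rewrite /= shE.
Qed.

Theorem dual_transfer : exists z, forall X, norm' X ->
  comp_dual (transfer iota q (fun a => c a + z) X) = transfer iota q (fun a => c a + z) (dual nuD' h' X).
Proof.
(* Moving the origin by z translates X by z and its dual by -z, so the discrepancy z0 drops to zero
   at z = z0 / 2. *)
have [z0 z0P] := dual_transfer_cut; exists (z0 / 2) => X NX.
rewrite !transfer_shift z0P.
  congr (transfer iota q c _); apply/funext => t; apply/seteqP; split=> u H s w Xw.
    have := H (s + z0 / 2) w; rewrite addrK => /(_ Xw).
    by congr (_%:E <= _)%E; lra.
  have := H _ _ Xw; congr (_%:E <= _)%E; lra.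
exact: (norm_shift (- (z0 / 2)) NX).
Qed.

End DualTransfer.

(** V is finite-dimensional over k, so b, which is injective and k-linear, is surjective. *)
Lemma endo_left_inverse (k : fieldType) (D : falgType k) (V : vectType D^c) (a b : 'End(V)) :
  (a \o b)%VF = \1%VF -> (b \o a)%VF = \1%VF.
Proof.
move=> ab.
pose phi (x : V) : {ffun 'I_(dim V) -> D} := [ffun j => @vcoord D V j x].
pose psi (f : {ffun 'I_(dim V) -> D}) : V := \sum_j ract (f j) (@vgen D V j).
have phiK x : psi (phi x) = x.
  by rewrite /psi [RHS]vcoordK; apply: eq_bigr => j _; rewrite ffunE.
have phiD x y : phi (x + y) = phi x + phi y.
  by apply/ffunP => j; rewrite !ffunE vcoordD.
have phiZ c x : phi (ract c%:A x) = c *: phi x.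
  by apply/ffunP => j; rewrite !ffunE vcoordZ mulr_algr.
have psiD f g : psi (f + g) = psi f + psi g.
  by rewrite -big_split; apply: eq_bigr => j _; rewrite ffunE ractDl.
have psiZ c f : psi (c *: f) = ract c%:A (psi f).
  by rewrite /psi ract_sumr; apply: eq_bigr => j _; rewrite ffunE -mulr_algr ractM.
have [B BP] : exists B : 'End({ffun 'I_(dim V) -> D}), forall f, B f = phi (b (psi f)).
  by apply: linear_lfun => [f g|c f]; rewrite ?psiD ?psiZ ?linearD ?lfun_ract ?phiD ?phiZ.
have psiK f : phi (psi f) = f.
  apply/ffunP => j; rewrite ffunE /psi.
  rewrite (big_morph (@vcoord D V j) (vcoordD j) (_ : _ = 0)); last first.
    by rewrite /vcoord linear0 mxE.
  rewrite (bigD1 j) //= big1 => [|i ij]; rewrite vcoordZ vcoord_gen.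
    by rewrite eqxx mul1r addr0.
  by rewrite eq_sym (negPf ij) mul0r.
have kB : lker B == 0%VS.
  apply/lker0P => f g; rewrite !BP => /(congr1 psi); rewrite !phiK => /(congr1 a).
  by rewrite -!comp_lfunE ab !id_lfunE => /(congr1 phi); rewrite !psiK.
have limgB : limg B = fullv.
  by apply/eqP; rewrite eqEdim subvf limg_dim_eq ?leqnn // (eqP kB) capv0.
apply/lfunP => x; rewrite comp_lfunE id_lfunE.
have : phi x \in limg B by rewrite limgB memvf.
move=> /memv_imgP[f _]; rewrite BP => /(congr1 psi); rewrite !phiK => ->.
by rewrite -[a (b _)]comp_lfunE ab id_lfunE.
Qed.

Lemma sum_tagged (Z : nmodType) (J : finType) (K : J -> finType) (F : {l : J & K l} -> Z) :
  \sum_p F p = \sum_l \sum_(i : K l) F (Tagged K i).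
Proof.
have /= -> := @sig_big_dep Z 0 (@GRing.add Z) J K xpredT (fun _ => xpredT) (fun l i => F (Tagged K i)).
by apply: eq_bigr => -[].
Qed.

Lemma lattice_norm_val (R : realType) (V : zmodType) (L : R -> set V) x c :
  (forall t, L t x <-> t <= c) -> lattice_norm L x = c%:E.
Proof.
move=> Lc; apply/eqP; rewrite eq_le; apply/andP; split.
  by apply: ge_ereal_sup => _ [t Lt <-]; rewrite lee_fin; apply/Lc.
by apply: ereal_sup_ubound; exists c => //; apply/Lc.
Qed.

(** * Splitting bases *)

Section OrthGlue.
Variables (R : realType) (A : unitRingType) (v : A -> \bar R).
Hypothesis Av : is_cdv v.
Let Ac := is_cdv_conv Av.
Let vv := cdv_val Av.
Variables (V : vectType A^c).
Local Notation norm := (@is_norm R A^c v V (@ract A V)).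
Local Notation orth W L b c := (@orth_basis R A^c v V (@ract A V) W L _ b c).

Definition fixed_space (Q : 'End(V)) : set V := [set x | Q x = x].
Definition norm_on (Q : 'End(V)) (L : R -> set V) (t : R) : set V := [set x | Q x = x /\ L t x].

Lemma norm_on_norm (Q : 'End(V)) (W : set V) (L : R -> set V) : (forall x, Q x = x -> W x) -> norm W L -> norm (fixed_space Q) (norm_on Q L).
Proof.
move=> QW NL; split.
- by move=> t x [].
- by move=> t; split; [exact: linear0|exact: (norm0 NL)].
- move=> t x y [Qx Lx] [Qy Ly]; split; last exact: (normB NL).
  by rewrite linearB /= Qx Qy.
- move=> t x Qx H; split=> //; apply: (norm_cont NL) => [|s st]; first exact: QW.
  by have [] := H s st.
- by move=> s t x st [Qx Lx]; split=> //; exact: (norm_anti NL) Lx.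
- by move=> x Qx; have [t Lt] := norm_exh NL (QW _ Qx); exists t.
- by move=> x Qx H; apply: (norm_sep NL (QW _ Qx)) => t; have [] := H t.
- move=> s t a x sa [Qx Lx]; split; last exact: (norm_act NL).
  by rewrite -[@ract A V _ _]/(ract (a : A) x) lfun_ract Qx.
Qed.

(** The projectors Q l do not lower values, so the sum of the pieces is orthogonal and orthogonal
    bases of the pieces combine. *)
Lemma orth_glue (J : finType) (Q : J -> 'End(V)) (Q0 : 'End(V)) (W : set V) (L : R -> set V) (K : J -> finType)
  (b : forall l, K l -> V) (c : forall l, K l -> R) :
  (forall x, Q0 x = x -> W x) -> norm W L ->
  (forall l x, Q l (Q l x) = Q l x) -> (forall l l' x, l != l' -> Q l (Q l' x) = 0) ->
  (forall x, Q0 x = \sum_l Q l x) -> (forall l t x, L t x -> L t (Q l x)) ->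
  (forall l, orth (fixed_space (Q l)) (norm_on (Q l) L) (b l) (c l)) ->
  orth (fixed_space Q0) (norm_on Q0 L)
    (fun p : {l : J & K l} => b (tag p) (tagged p)) (fun p => c (tag p) (tagged p)).
Proof.
move=> QW NL QQ Qo Qs LQ bL.
have Q0Q l x : Q l x = x -> Q0 x = x.
  move=> Qx; rewrite Qs (bigD1 l) //= Qx big1 ?addr0 // => l' ll'.
  by rewrite -Qx Qo.
have sumE (F : {l : J & K l} -> V) : \sum_p F p = \sum_(l : J) \sum_(i : K l) F (Tagged K i).
  exact: (sum_tagged F).
split.
- by move=> [l i]; apply: (Q0Q l); exact: (orth_in (bL l)).
- move=> x Qx.
  have ex l : exists a : K l -> A, Q l x = \sum_i ract (a i) (b l i).
    by have [a aE] := orth_span (bL l) (QQ l x : fixed_space (Q l) (Q l x)); exists a.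
  pose a l := projT1 (cid (ex l)).
  exists (fun p => a (tag p) (tagged p)); rewrite sumE -{1}Qx Qs.
  by apply: eq_bigr => l _; exact: projT2 (cid (ex l)).
- move=> t a; rewrite sumE.
  pose z l := \sum_i ract (a (Tagged K i) : A) (b l i).
  have Ql l : Q l (z l) = z l.
    rewrite /z linear_sum; apply: eq_bigr => i _ /=; rewrite lfun_ract; congr (ract _ _).
    exact: (orth_in (bL l)).
  pose y := \sum_l z l; rewrite -[X in norm_on _ _ _ X]/y.
  have Qy l : Q l y = z l.
    rewrite /y linear_sum (bigD1 l) //= big1 => [|l' ll'].
      by rewrite addr0; exact: Ql.
    by rewrite -[X in Q l X]Ql Qo // eq_sym.
  have Q0y : Q0 y = y by rewrite Qs /y; apply: eq_bigr => l _; rewrite Qy.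
  split=> [[_ Ly] [l i]|H].
    have [H _] := orthP (bL l) t (fun i => a (Tagged K i)).
    by apply: H; rewrite -/(z l) -Qy; split; [exact: QQ|exact: LQ].
  split=> //; apply: (norm_sum NL) => l _.
  have [_ F] := orthP (bL l) t (fun i => a (Tagged K i)).
  by have [_] := F (fun i => H (Tagged K i)).
Qed.

Lemma orth_reindex W L (J : finType) (b : J -> V) (c : J -> R) : orth W L b c ->
  orth W L (fun i : 'I_#|J| => b (enum_val i)) (fun i => c (enum_val i)).
Proof.
move=> bL; have sumE (F : J -> V) : \sum_(i < #|J|) F (enum_val i) = \sum_j F j.
  by rewrite [RHS](reindex _ (onW_bij _ (enum_val_bij J))).
split=> [i|x /(orth_span bL)[a ->]|t a]; first exact: (orth_in bL).
  by exists (fun i => a (enum_val i)); rewrite (sumE (fun j => ract (a j : A) (b j))).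
have := orthP bL t (fun j => a (enum_rank j)).
rewrite -sumE /=; under eq_bigr do rewrite enum_valK.
move=> H; apply: iff_trans H _; split=> H j; last by have := H (enum_rank j); rewrite enum_rankK.
by have := H (enum_val j); rewrite enum_valK.
Qed.

Lemma lattice_norm_orth W L (J : finType) (b : J -> V) c : is_space (A := A^c) (@ract A V) W -> norm W L -> orth W L b c ->
  forall j, lattice_norm L (b j) = (c j)%:E.
Proof. by move=> S NL bL j; apply: lattice_norm_val => t; exact: (orth1_gen Ac S bL). Qed.

Lemma orth_neq0 L (J : finType) (b : J -> V) c j : norm setT L -> orth setT L b c -> b j != 0.
Proof.
move=> NL bL; apply/eqP => b0.
have /(orth1_gen Ac (right_spaceT V) bL) : L (c j + 1) (b j) by rewrite b0; exact: (norm0 NL).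
by rewrite gerDl ler10.
Qed.

Lemma orth_line_sum L (J : finType) (b : J -> V) c : norm setT L -> orth setT L b c ->
  is_direct_sum (fun j => line (b j)) setT.
Proof.
move=> NL bL; have S := right_spaceT V; have ib := orth_independent Ac NL bL; split.
  apply/seteqP; split=> // x _; have [a ->] := orth_span bL (I : setT x).
  by exists (fun j => ract (a j : A) (b j)) => // j; exists (a j).
move=> y yb y0 j; have /choice[a aP] j' : exists a : A, ract a (b j') = y j'.
  by have [a _ <-] := yb j'; exists a.
rewrite -aP; have -> : a j = 0; last exact: ract0l.
by apply: (ib a) => //; rewrite -[RHS]y0; apply: eq_bigr => i _; exact: aP.
Qed.

Lemma orth_split L (J : finType) (b : J -> V) c : norm setT L -> orth setT L b c ->
  split_by (fun j => line (b j)) L.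
Proof.
move=> NL bL t; have S := right_spaceT V; have [_ ds] := orth_line_sum NL bL; split.
  apply/seteqP; split=> x.
    have [a ->] := orth_span bL (I : setT x) => /(orthP bL) H.
    exists (fun j => ract (a j : A) (b j)) => // j; split; last by exists (a j).
    exact/(orth1 Ac S bL).
  by move=> [y yP ->]; apply: (norm_sum NL) => j _; have [] := yP j.
by move=> y yb; apply: ds => j; have [] := yb j.
Qed.

Lemma orth_convex_comb lam L1 L2 L3 n (b : 'I_n -> V) (c1 c2 c3 : 'I_n -> R) :
  norm setT L1 -> norm setT L2 -> norm setT L3 ->
  orth setT L1 b c1 -> orth setT L2 b c2 -> orth setT L3 b c3 ->
  (forall j, c3 j = lam * c1 j + (1 - lam) * c2 j) -> is_convex_comb lam L1 L2 L3.
Proof.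
move=> N1 N2 N3 b1 b2 b3 cE; have S := right_spaceT V.
exists n, b; split.
- by move=> j; exact: orth_neq0 N1 b1.
- exact: orth_line_sum N1 b1.
- by split; [exact: orth_split N1 b1|exact: orth_split N2 b2|exact: orth_split N3 b3].
- move=> j; rewrite (lattice_norm_orth S N1 b1) (lattice_norm_orth S N2 b2) (lattice_norm_orth S N3 b3).
  by rewrite cE.
Qed.

(** Uniqueness in the direct sum identifies the components given by the splitting with the
    coordinate terms, so a splitting into lines is an orthogonal basis. *)
Lemma split_orth L (J : finType) (b : J -> V) : norm setT L -> (forall j, b j != 0) ->
  is_direct_sum (fun j => line (b j)) setT -> split_by (fun j => line (b j)) L ->
  exists c, orth setT L b c.
Proof.
move=> NL b0 [dT dU] bL; have S := right_spaceT V.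
have /choice[c cP] j : exists c, forall t, L t (b j) <-> t <= c by exact: (norm_val NL).
have cP' t (a : A) j : L t (ract a (b j)) <-> ((t - c j)%:E <= v a)%E.
  have [->|a0] := eqVneq a 0.
    by rewrite ract0l (valu0 vv) leey; split=> // _; exact: (norm0 NL).
  have [r va] := valu_fin vv a0; rewrite va lee_fin.
  have -> : t = r + (t - r) by ring.
  rewrite (norm_act_eq S NL Ac (t - r) va) // cP; split; lra.
exists c; split=> //.
  move=> x _; have : setT x by [].
  rewrite dT => -[y yb ->]; have /choice[a aP] j : exists a : A, ract a (b j) = y j.
    by have [a _ <-] := yb j; exists a.
  by exists a; apply: eq_bigr => j _; rewrite -aP.
move=> t a; split=> [|H]; last first.
  by apply: (norm_sum NL) => j _; exact/(cP' t (a j : A) j).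
have [-> _] := bL t => -[y yP ay] j.
apply/cP'; have [Ly _] := yP j; suff -> : ract (a j : A) (b j) = y j by [].
apply/eqP; rewrite -subr_eq0; apply/eqP.
apply: (dU (fun j => ract (a j : A) (b j) - y j)); last by rewrite sumrB -ay subrr.
move=> i; have [_ [a' _ <-]] := yP i; exists ((a i : A) - a') => //.
by rewrite /ract scalerBl.
Qed.

Lemma convex_comb_orth lam L1 L2 L3 : norm setT L1 -> norm setT L2 -> norm setT L3 ->
  is_convex_comb lam L1 L2 L3 -> exists n (b : 'I_n -> V) c1 c2,
  [/\ orth setT L1 b c1, orth setT L2 b c2 & orth setT L3 b (fun j => lam * c1 j + (1 - lam) * c2 j)].
Proof.
move=> N1 N2 N3 [n [b [b0 ds [s1 s2 s3] cE]]]; have S := right_spaceT V.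
have [c1 b1] := split_orth N1 b0 ds s1; have [c2 b2] := split_orth N2 b0 ds s2.
have [c3 b3] := split_orth N3 b0 ds s3.
exists n, b, c1, c2; split=> //.
suff -> : (fun j => lam * c1 j + (1 - lam) * c2 j) = c3 by [].
apply/funext => j; have := cE j.
rewrite (lattice_norm_orth S N1 b1) (lattice_norm_orth S N2 b2) (lattice_norm_orth S N3 b3).
by move=> -[].
Qed.

Lemma orth_projectors L (J : finType) (b : J -> V) c : norm setT L -> orth setT L b c ->
  exists (f : J -> V -> A) (e : J -> 'End(V)), [/\ forall l u, e l u = ract (f l u) (b l),
    forall u, u = \sum_l e l u & forall l l' u, e l (e l' u) = if l == l' then e l' u else 0].
Proof.
move=> NL bL; have S := right_spaceT V; have ib := orth_independent Ac NL bL.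
have [f fP] := independent_coord (orth_span bL).
have fE (a : J -> A) j : f j (\sum_i ract (a i) (b i)) = a j.
  exact: (coord_sum S ib fP (orth_in bL)).
have fT x : x = \sum_i ract (f i x : A) (b i) by exact: fP.
have fD j x y : f j (x + y) = f j x + f j y.
  rewrite {1}(fT x) {1}(fT y) -big_split /=.
  by under eq_bigr do rewrite -ractDl; rewrite fE.
have fZ j (a : A) x : f j (ract a x) = ((f j x : A) * a)%R.
  rewrite {1}(fT x) ract_sumr; under eq_bigr do rewrite -ractM.
  by rewrite fE.
pose e l : 'End(V) := linfun (fun u => ract (f l u : A) (b l)).
have eE l u : e l u = ract (f l u : A) (b l).
  by apply: linfun_ract => [x y|a x]; rewrite ?fD ?ractDl ?fZ ?ractM.
have fb l l' : f l (b l') = (l == l')%:R.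
  have -> : b l' = \sum_i ract ((i == l')%:R : A) (b i).
    rewrite (bigD1 l') //= eqxx ract1 big1 ?addr0 // => i /negPf->.
    by rewrite ract0l.
  by rewrite fE.
exists f, e; split=> // [u|l l' u]; first by under eq_bigr do rewrite eE; exact: fT.
rewrite !eE fZ fb; case: eqP => [->|_]; first by rewrite mul1r.
by rewrite mul0r ract0l.
Qed.

Lemma orth_shift (Q : 'End(V)) L L' (J : finType) (b : J -> V) c z :
  (forall t x, norm_on Q L t x <-> norm_on Q L' (t + z) x) ->
  orth (fixed_space Q) (norm_on Q L) b c ->
  orth (fixed_space Q) (norm_on Q L') b (fun j => c j + z).
Proof.
move=> H bL; split; [exact: (orth_in bL)|exact: (orth_span bL)|] => t a.
rewrite -[t](subrK z); apply: iff_trans (iff_sym (H _ _)) _.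
apply: iff_trans (orthP bL _ _) _.
by split=> F j; have := F j; congr (_%:E <= _)%E; ring.
Qed.

Lemma orth_fixed1 L (J : finType) (b : J -> V) c :
  orth (fixed_space \1%VF) (norm_on \1%VF L) b c -> orth setT L b c.
Proof.
have -> : fixed_space \1%VF = setT by apply/seteqP; split=> // x _; exact: id_lfunE.
have -> // : norm_on \1%VF L = L.
by apply/funext => t; apply/seteqP; split=> x; [case|split; rewrite ?id_lfunE].
Qed.

End OrthGlue.

(** * Transport between norms on V'_i and norms on V_i *)

Section Transport.
Variables (R : realType) (k : fieldType) (D : falgType k) (nuD : D -> \bar R).
Variables (E : fieldExtType k) (nuE : E -> \bar R) (D' : falgType E) (nuD' : D' -> \bar R).
Variables (V : vectType D^c) (V' : vectType D'^c) (iota : E -> 'End(V)) (theta : 'End(V') -> 'End(V)).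
Local Notation norm' := (@is_norm R D'^c nuD' V' (@ract D' V') setT).
Local Notation ED := (is_ED_norm nuD nuE iota).

(** What the global argument needs from the tensor product construction. [transport_op] serves
    equivariance and CLF; [transport_agree], on two norms that differ by a constant on the image of
    an operator, serves affinity. *)
Record component_transport (Tr : (R -> set V') -> R -> set V) (Res : (R -> set V) -> R -> set V') : Prop :=
  ComponentTransport {
  transport_ED : forall X, norm' X -> ED (Tr X);
  transport_res : forall L, ED L -> norm' (Res L);
  transport_resK : forall L, ED L -> Tr (Res L) = L;
  transportK : forall X, norm' X -> Res (Tr X) = X;
  transport_op : forall X Y (a : 'End(V')) t, norm' X -> norm' Y ->
    (forall s u, X s u -> Y (s + t) (a u)) <->
    (forall s v, Tr X s v -> Tr Y (s + t) (theta a v));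
  transport_agree : forall X Y (a : 'End(V')) t, (forall s u, X s (a u) <-> Y (s + t) (a u)) ->
    forall s v, Tr X s (theta a v) <-> Tr Y (s + t) (theta a v) }.

Hypothesis theta_id : forall a v, iota 1 (theta a v) = theta a v.
Hypothesis theta_idr : forall a v, theta a (iota 1 v) = theta a v.

Lemma component_dataP r (m : 'I_r.+1 -> V' -> V) q c : component_data nuD nuE nuD' iota theta m q c ->
  component_transport (transfer iota q c) (fun L t => [set u | L (t + c ord0) (m ord0 u)]).
Proof.
move=> cd.
have qtheta a b v : q b (theta a v) = a (q b v).
  rewrite -theta_idr (comp_sum cd) linear_sum /=.
  by under eq_bigr do rewrite (comp_theta cd); rewrite (comp_coord cd).
have TrK X : norm' X -> (fun t => [set u | transfer iota q c X (t + c ord0) (m ord0 u)]) = X.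
  move=> NX; apply/funext => t; apply/seteqP; split=> u; last exact: (transfer_gen cd).
  move=> [_ /(_ ord0)]; rewrite addrK.
  have -> : m ord0 u = \sum_i m i (if i == ord0 then u else 0).
    have m0 a : m a 0 = 0 by apply: (addIr (m a 0)); rewrite -(compD cd) !add0r.
    by rewrite (bigD1 ord0) //= big1 ?addr0 // => i /negPf->.
  by rewrite (comp_coord cd) eqxx.
split.
- exact: (comp_transfer cd).
- exact: (comp_restrict cd).
- by move=> L /(comp_transferK cd).
- exact: TrK.
- move=> X Y a t NX NY; split=> H s v.
    move=> [Pv Xv]; split=> [|b]; first exact: theta_id.
    have -> : s + t - c b = s - c b + t by ring.
    by rewrite qtheta; exact: H.
  move=> Xv; have := H _ _ (transfer_gen cd ord0 NX Xv).
  rewrite (comp_theta cd) => F; rewrite -(TrK Y NY) /=.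
  by have -> : s + t + c ord0 = s + c ord0 + t by ring.
- move=> X Y a t H s v; have shE b : s + t - c b = s - c b + t by ring.
  split=> -[_ F]; split=> [|b]; try exact: theta_id.
    by have := F b; rewrite qtheta shE => /H.
  by have := F b; rewrite qtheta shE => /H.
Qed.

End Transport.

(** * The embedding *)

Section PolynomialAlgebra.
Variables (k : fieldType) (D : falgType k) (V : vectType D^c).

Lemma poly_alg_sum (beta a : 'End(V)) n (c : nat -> k) :
  (forall v, a v = \sum_(i < n) ract (c i)%:A (iter i beta v)) -> poly_alg beta a.
Proof.
move=> aE; exists (\poly_(i < n) c i) => v; rewrite aE.
rewrite (big_ord_widen n (fun i => ract ((\poly_(i < n) c i)`_i)%:A (iter i beta v)) (size_poly n c)).
rewrite [RHS]big_mkcond /=; apply: eq_bigr => i _; rewrite coef_poly ltn_ord; case: ltnP => // le.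
have : (\poly_(i < n) c i)`_i = 0 by exact: nth_default.
by rewrite coef_poly ltn_ord => ->; rewrite scale0r ract0l.
Qed.

Lemma poly_alg_commute (beta a g : 'End(V)) : (g \o beta = beta \o g)%VF -> poly_alg beta a ->
  (g \o a = a \o g)%VF.
Proof.
move=> gb [p aE]; apply/lfunP => v; rewrite !comp_lfunE !aE linear_sum /=.
apply: eq_bigr => i _; rewrite lfun_ract; congr (ract _ _).
elim: (nat_of_ord i) => //= n IH; rewrite -IH.
by rewrite -[g (beta _)]comp_lfunE gb comp_lfunE.
Qed.

End PolynomialAlgebra.

Section Global.
Variables (R : realType) (k : fieldType) (nu : k -> \bar R).
Hypotheses (k_local : is_local_field nu) (k_odd : odd_residue_char nu).
Variables (D : falgType k) (d : nat) (nuD : D -> \bar R).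
Hypotheses (D_central : is_central_division D) (D_index : \dim {:D} = (d ^ 2)%N)
  (nuD_ext : extends_valuation nu nuD).
Variables (rho : D -> D) (rho_inv : is_involution rho).
Variables (V : vectType D^c) (eps : D) (h : V -> V -> D) (h_herm : is_nondeg_hermitian rho eps h).
Variables (sigma : 'End(V) -> 'End(V)) (sigma_adj : is_adjoint_involution h sigma).
Variables (beta : 'End(V)) (beta_lie : unitary_lie sigma beta).
Variables (I : finType) (E : I -> fieldExtType k) (iota : forall i, E i -> 'End(V)).
Hypothesis E_prod : is_field_product iota beta.
Variables (nuE : forall i, E i -> \bar R) (nuE_ext : forall i, extends_valuation nu (@nuE i)).
Variables (sI : I -> I) (sI_sigma : forall i, sigma (idem iota i) = idem iota (sI i)).

Let kv := local_field_cdv k_local.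
Let Dv : is_cdv nuD := falg_cdv kv D_central.1 nuD_ext.
Let E_unit i (x : E i) : x != 0 -> x \is a GRing.unit. Proof. by rewrite unitfE. Qed.
Let Ev i : is_cdv (@nuE i) := falg_cdv kv (@E_unit i) (nuE_ext i).
Let vD := cdv_val Dv.
Let vE i := cdv_val (Ev i).
Let k2 : nu 2%:R = 0%E := odd_residue_valu2 (cdv_val kv) k_odd.
Let D2 : nuD 2%:R = 0%E. Proof. by rewrite (extends_valu_nat _ nuD_ext). Qed.
Let E2 i : @nuE i 2%:R = 0%E. Proof. by rewrite (extends_valu_nat _ (nuE_ext i)). Qed.
Local Notation P i := (@idem _ _ _ _ _ iota i).

Lemma iota_zero i : iota (0 : E i) = 0.
Proof. by apply: (addIr (iota (0 : E i))); rewrite -(field_productD E_prod) !add0r. Qed.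

Lemma idem_idem i v : P i (P i v) = P i v.
Proof. by rewrite -comp_lfunE -(field_productM E_prod) mulr1. Qed.

Lemma idem_orth i j v : i != j -> P i (P j v) = 0.
Proof. by move=> ij; rewrite -comp_lfunE (field_product_orth E_prod _ _ ij) zero_lfunE. Qed.

Lemma idem_sum v : v = \sum_i P i v.
Proof. by rewrite -sum_lfunE (field_product1 E_prod) id_lfunE. Qed.

Lemma idem_iota i (x : E i) v : P i (iota x v) = iota x v.
Proof. by rewrite -comp_lfunE -(field_productM E_prod) mul1r. Qed.

Lemma iota_idem i (x : E i) v : iota x (P i v) = iota x v.
Proof. by rewrite -comp_lfunE -(field_productM E_prod) mulr1. Qed.

Lemma iota_orth i j (x : E i) v : i != j -> iota x (P j v) = 0.
Proof. by move=> ij; rewrite -comp_lfunE (field_product_orth E_prod _ _ ij) zero_lfunE. Qed.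

Lemma idem_inj : injective (idem iota).
Proof.
move=> i j Pij; apply/eqP; apply: contraT => ij; have /eqP[] := oner_neq0 (E i).
apply: (field_product_inj E_prod); rewrite iota_zero; apply/lfunP => v; rewrite zero_lfunE.
by rewrite -[LHS]/(P i v) -idem_idem {2}Pij idem_orth.
Qed.

Lemma sIK i : sI (sI i) = i.
Proof. by apply: idem_inj; rewrite -!sI_sigma (sigmaK rho_inv h_herm sigma_adj). Qed.

Lemma herm_idem i v w : h (P i v) w = h v (P (sI i) w).
Proof. by rewrite sigma_adj sI_sigma. Qed.

Lemma rho_scalar (c : k) : exists2 c', rho c%:A = c'%:A & nu c' = nu c.
Proof.
have [_ /(_ (rho c%:A))[F _]] := D_central; have [|c' c'E] := F.
  move=> x; rewrite -[x](involutionK rho_inv) -!(involutionM rho_inv).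
  by rewrite mulr_algl mulr_algr.
exists c' => //; rewrite -!nuD_ext.2 -c'E.
exact: (involution_valu Dv D2 rho_inv).
Qed.

Lemma iota_poly_alg i (x : E i) : poly_alg beta (iota x).
Proof.
rewrite (field_product_image E_prod); exists (dfwith (fun j => 0 : E j) x) => //.
rewrite (bigD1 i) //= dfwith_in big1 ?addr0 // => j ji.
by rewrite dfwith_out ?iota_zero // eq_sym.
Qed.

(** Since sigma(beta) = -beta, sigma takes p(beta) to the polynomial in beta with coefficients
    (-1)^i rho(p_i), and rho preserves the centre k. *)
Lemma sigma_poly_alg a : poly_alg beta a -> poly_alg beta (sigma a).
Proof.
move=> [p aE]; have /choice[f fP] c : exists c', rho c%:A = c'%:A.
  by have [c' cE _] := rho_scalar c; exists c'.
apply: (@poly_alg_sum _ _ _ _ _ (size p) (fun i => (-1) ^+ i * f p`_i)) => w.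
apply: (herm_inj rho_inv h_herm) => v; rewrite -sigma_adj aE.
rewrite (herm_suml h_herm) (herm_sumr h_herm); apply: eq_bigr => i _.
rewrite (hermZl rho_inv h_herm) (hermZr rho_inv h_herm) fP mulr_algr mulr_algl.
rewrite mulrC -scalerA; congr (_ *: _).
have bE : sigma beta = - beta by exact: beta_lie.
elim: (nat_of_ord i) w => [|n IH] w; first by rewrite expr0 scale1r.
rewrite iterS sigma_adj bE opp_lfunE -sub0r (hermBr h_herm) (herm0r h_herm) sub0r IH -iterSr.
by rewrite exprS -scalerA scaleN1r.
Qed.

(** sigma preserves k[beta] and sends the idempotent of i to that of [sI i], so it induces an
    injective ring map between the two fields. This map preserves valuations by [ring_map_val], with
    the scale fixed by a uniformizer of k. *)
Lemma sigma_iota i (x : E i) : exists2 y : E (sI i), sigma (iota x) = iota y & nuE y = nuE x.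
Proof.
have ex j (z : E j) : exists y : E (sI j), sigma (iota z) = iota y.
  have := sigma_poly_alg (iota_poly_alg z); rewrite (field_product_image E_prod) => -[y _ yE].
  exists (y (sI j)); rewrite -[LHS](_ : sigma (iota z) \o P (sI j) = _)%VF; last first.
    rewrite -sI_sigma -(sigmaM rho_inv h_herm sigma_adj) -(field_productM E_prod).
    by rewrite mul1r.
  rewrite -yE; apply/lfunP => v; rewrite comp_lfunE sum_lfunE (bigD1 (sI j)) //= iota_idem.
  by rewrite big1 ?addr0 // => l lj; rewrite iota_orth.
have /choice[f fP] := ex i; have f_inj := field_product_inj E_prod (i := sI i).
have sD := sigmaD rho_inv h_herm sigma_adj; have sM := sigmaM rho_inv h_herm sigma_adj.
have fD y z : f (y + z) = f y + f z.
  by apply: f_inj; rewrite (field_productD E_prod) -!fP (field_productD E_prod) sD.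
have fM y z : f (y * z) = f y * f z.
  by apply: f_inj; rewrite (field_productM E_prod) -!fP mulrC (field_productM E_prod) sM.
have f0 y : f y = 0 -> y = 0.
  move=> fy; apply: (field_product_inj E_prod); rewrite iota_zero.
  by rewrite -[LHS](sigmaK rho_inv h_herm sigma_adj) fP fy iota_zero (sigma0 rho_inv h_herm sigma_adj).
exists (f x); first exact: fP.
have [pi piu] := cdv_pi kv; have p0 := step_gt0 piu; have vp := step_val piu.
have [c' c'E vc'] := rho_scalar pi.
have fc : f pi%:A = c'%:A.
  apply: f_inj; rewrite -fP; apply: (sigma_unique rho_inv h_herm sigma_adj) => v w.
  rewrite !(field_productZ E_prod) (hermZl rho_inv h_herm) (hermZr rho_inv h_herm) c'E.
  by rewrite mulr_algr mulr_algl -/(P i) -/(P (sI i)) herm_idem.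
apply: (ring_map_val (Ev i) (Ev (sI i)) (E2 i) fD (fun y => fM y y) _ f0 (c := pi%:A) (a := fine (nu pi))) => //.
- by move=> y z; rewrite fM (valuationM (vE _)).
- by rewrite (nuE_ext i).2.
- by rewrite fc (nuE_ext (sI i)).2 vc'.
Qed.

Local Notation norm := (@is_norm R D^c nuD V (@ract D V) setT).
Local Notation ED i := (is_ED_norm nuD (@nuE i) (@iota i)).

(** The norm-theoretic form of o_E-o_D-lattice functions ([oE_oD_gED]). *)
Record is_gED (L : R -> set V) : Prop := IsGED {
  gED_norm : norm L;
  gED_iota : forall i s t (x : E i) v, (s%:E <= nuE x)%E -> L t v -> L (s + t) (iota x v) }.

Definition glue (Ls : I -> R -> set V) (t : R) : set V := [set v | forall i, Ls i t (P i v)].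

Lemma gED_idem L i t v : is_gED L -> L t v -> L t (P i v).
Proof.
by move=> GL Lv; rewrite -[t]add0r; apply: (gED_iota GL) => //; rewrite (valu1 (vE i)).
Qed.

Lemma gED_restrict L i : is_gED L -> ED i (norm_on (P i) L).
Proof.
move=> GL; split; first by apply: (norm_on_norm _ (gED_norm GL)).
by move=> s t x v sx [_ Lv]; split; [exact: idem_iota|exact: gED_iota].
Qed.

Lemma glue_restrict L : is_gED L -> glue (fun i => norm_on (P i) L) = L.
Proof.
move=> GL; apply/funext => t; apply/seteqP; split=> v.
  move=> H; rewrite (idem_sum v); apply: (norm_sum (gED_norm GL)) => i _.
  by have [] := H i.
by move=> Lv i; split; [exact: idem_idem|exact: gED_idem].
Qed.

Section Glue.
Variable Ls : I -> R -> set V.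
Hypothesis ELs : forall i, ED i (Ls i).

Lemma restrict_glue i : norm_on (P i) (glue Ls) = Ls i.
Proof.
have NL j := ED_norm (ELs j).
apply/funext => t; apply/seteqP; split=> v.
  by move=> [Pv H]; have := H i; rewrite Pv.
move=> Lv; have Pv : P i v = v by exact: (norm_sub (NL i) Lv).
split=> // j; have [->|ji] := eqVneq j i; first by rewrite Pv.
by rewrite -Pv idem_orth //; exact: (norm0 (NL j)).
Qed.

Lemma glue_gED : is_gED (glue Ls).
Proof.
have NL j := ED_norm (ELs j).
split; first split=> //.
- by move=> t i; rewrite linear0; exact: (norm0 (NL i)).
- by move=> t x y Hx Hy i; rewrite linearB; exact: (normB (NL i)).
- move=> t x _ H i; apply: (norm_cont (NL i)); first exact: idem_idem.
  by move=> s st; exact: H.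
- by move=> s t x st H i; exact: (norm_anti (NL i)) (H i).
- move=> x _; have /choice[f fP] i := norm_exh (NL i) (idem_idem i x).
  have [t tP] := fin_lower_bound f.
  by exists t => i; exact: (norm_anti (NL i)) (fP i).
- move=> x _ H; rewrite (idem_sum x) big1 // => i _.
  apply: (norm_sep (NL i) (idem_idem i x)) => t; exact: H.
- move=> s t a x sa H i; rewrite -[@ract D V a x]/(ract (a : D) x) lfun_ract.
  exact: (norm_act (NL i)).
- move=> i s t x v sx H j; have [->|ji] := eqVneq j i.
    by rewrite idem_iota -iota_idem; exact: (ED_iota (ELs i)).
  by rewrite -idem_iota idem_orth //; exact: (norm0 (NL j)).
Qed.

End Glue.

Lemma dual_gED L : is_gED L -> is_gED (dual nuD h L).
Proof.
move=> GL; split; first exact: (dual_norm Dv D2 rho_inv h_herm (gED_norm GL)).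
move=> i s t x v sx Hv s' w Lw; rewrite sigma_adj.
have [y -> vy] := sigma_iota x; rewrite -addrA addrCA; apply: Hv.
by apply: (gED_iota GL) => //; rewrite vy.
Qed.

Local Notation cdual i := (comp_dual nuD (@iota i) h).

(** The form h pairs V_i with the component at [sI i] and is zero between V_i and the others. *)
Lemma restrict_dual i L : is_gED L -> norm_on (P i) (dual nuD h L) = cdual i (norm_on (P (sI i)) L).
Proof.
move=> GL; apply/funext => t; apply/seteqP; split=> v [Pv Hv]; split=> //.
  by move=> s w [_ Lw]; exact: Hv.
move=> s w Lw; rewrite -Pv herm_idem; apply: Hv; split; first exact: idem_idem.
exact: gED_idem.
Qed.

Lemma dual_restrict_sI i L : is_gED L -> norm_on (P (sI i)) (dual nuD h L) = cdual (sI i) (norm_on (P i) L).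
Proof. by move=> GL; rewrite restrict_dual // sIK. Qed.

Lemma ED_extend i L (Ls : I -> R -> set V) : (forall j, ED j (Ls j)) -> ED i L ->
  exists2 L', is_gED L' & norm_on (P i) L' = L.
Proof.
move=> ELs EL; pose Ls' j := if j == i then L else Ls j.
have ELs' j : ED j (Ls' j) by rewrite /Ls'; case: eqP => // ->.
exists (glue Ls'); first exact: glue_gED.
by rewrite restrict_glue // /Ls' eqxx.
Qed.

Lemma latt1_norm L : Latt1 nuD (d%:R^-1) L <-> norm L.
Proof.
have [pi piu] := cdv_pi Dv.
rewrite -(local_index k_local D_central D_index nuD_ext piu).
have piu' : @is_uniformizer R D^c nuD pi by case: piu.
exact: iff_trans (is_lattice_function_conv _ _ _ _ _) (lattice_functionP (is_cdv_conv Dv) (right_spaceT V) piu' L).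
Qed.

Lemma component_fixed i : component iota i = fixed_space (P i).
Proof.
apply/seteqP; split=> [_ [v _ <-]|v Pv]; first exact: idem_idem.
by exists v.
Qed.

Lemma component_space i : is_space (fun (x : E i) v => iota x v) (fixed_space (P i)).
Proof.
split.
- by move=> a b x; rewrite (field_productD E_prod) add_lfunE.
- by move=> a x y; rewrite linearD.
- by move=> a b x; rewrite (field_productM E_prod) comp_lfunE.
- by move=> x.
- by move=> a x _; exact: idem_iota.
- exact: linear0.
- by move=> x y Px Py; rewrite /fixed_space /= linearB /= Px Py.
- pose N := \dim {:D}.
  pose g (p : 'I_N * 'I_(dim V)) := P i (ract (vbasis {:D})`_p.1 (vgen p.2)).
  exists #|{: 'I_N * 'I_(dim V)}|, (fun j => g (enum_val j)).
  split=> [j|v Pv]; first exact: idem_idem.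
  pose c (p : 'I_N * 'I_(dim V)) : k := coord (vbasis {:D}) p.1 (vcoord p.2 v).
  exists (fun j => (c (enum_val j))%:A).
  rewrite -(reindex _ (onW_bij _ (enum_val_bij _)) (F := fun p => iota (c p)%:A (g p)) (P := xpredT)).
  rewrite -Pv {1}(vcoordK v) linear_sum /= -(pair_bigA _ (fun i' j => iota (c (i', j))%:A (g (i', j)))) /=.
  rewrite exchange_big /=; apply: eq_bigr => j _.
  rewrite {1}[vcoord j v](coord_vbasis (memvf _)) ract_suml linear_sum /=.
  apply: eq_bigr => l _; rewrite (field_productZ E_prod) -/(P i) /g idem_idem.
  by rewrite -mulr_algr ractM lfun_ract.
Qed.

Lemma ramification_step (A : unitRingType) (v : A -> \bar R) (e : nat) (pi : A) :
  is_valuation v -> is_ramification_index v e -> is_uniformizer v pi -> fine (v pi) = e%:R^-1.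
Proof.
move=> vv [e0 vS] piu; have p0 := step_gt0 piu; have vp := step_val piu.
have eR : 0 < e%:R :> R by rewrite ltr0n.
have : [set v x | x in [set x | x != 0]] (v pi) by exists pi => //; exact: (valu_neq0 vv vp).
rewrite vS => -[n _ vn]; have {}vn : fine (v pi) = n%:~R / e%:R by rewrite -vn.
have : [set (m%:~R / e%:R)%:E | m in @setT int] (1%:~R / e%:R : R)%:E by exists 1.
rewrite -vS => -[x _ vx].
have : (v pi <= v x)%E by case: piu => _ _; apply; rewrite vx lte_fin divr_gt0.
rewrite vx vp lee_fin mul1r => le; apply/eqP; rewrite eq_le le vn.
rewrite vn pmulr_lgt0 ?invr_gt0 // ltr0z in p0.
by rewrite -[leLHS]mul1r ler_pM2r ?invr_gt0 // -[1]/(1%:~R) ler_int -gtz0_ge1.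
Qed.

Variables (e : I -> nat) (e_ram : forall i, is_ramification_index (@nuE i) (e i)).

Lemma component_lattice_function i (L : R -> set V) :
  is_lattice_function (@nuE i) (fun x v => iota x v) (component iota i) (e i)%:R^-1 L <->
  is_norm (@nuE i) (fun x v => iota x v) (fixed_space (P i)) L.
Proof.
have [pi piu] := cdv_pi (Ev i); rewrite component_fixed -(ramification_step (vE i) (e_ram i) piu).
exact: (lattice_functionP (Ev i) (component_space i) piu).
Qed.

(** Being split by the V_i means that the idempotents preserve each L t. Given this, the conditions
    on the components say that each E_i acts compatibly with its valuation. *)
Lemma oE_oD_gED L : is_oE_oD_lattice_function iota nuD d (@nuE) e L <-> is_gED L.
Proof.
split=> [[/latt1_norm NL Ls HE]|GL].
  have PL i t v : L t v -> L t (P i v).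
    have [-> _] := Ls t => -[y yP ->]; exists (fun j => if j == i then y j else 0).
      by move=> j; case: eqP => // _; split; [exact: (norm0 NL)|exists 0; rewrite ?linear0].
    rewrite -big_mkcond big_pred1_eq linear_sum (bigD1 i) //=.
    have yi j : P j (y j) = y j by have [_ [w _ <-]] := yP j; exact: idem_idem.
    by rewrite yi big1 ?addr0 // => j ji; rewrite -yi idem_orth // eq_sym.
  split=> // i s t x v sx Lv; have NE := (component_lattice_function i _).1 (HE i).
  have : L t (P i v) /\ component iota i (P i v) by split; [exact: PL|exists v].
  by move/(norm_act NE sx) => [+ _]; rewrite iota_idem.
have NL := gED_norm GL; split; first exact/latt1_norm.
  move=> t; split.
    apply/seteqP; split=> v.
      move=> Lv; exists (fun i => P i v); last exact: idem_sum.
      by move=> i; split; [exact: gED_idem|exists v].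
    by move=> [y yP ->]; apply: (norm_sum NL) => i _; have [] := yP i.
  move=> y yP y0 i; have yi j : P j (y j) = y j by have [_ [w _ <-]] := yP j; exact: idem_idem.
  have := congr1 (P i) y0; rewrite linear0 linear_sum (bigD1 i) //= yi big1 ?addr0 // => j ji.
  by rewrite -yi idem_orth // eq_sym.
move=> i; apply/component_lattice_function.
have -> : (fun t => L t `&` component iota i) = norm_on (P i) L.
  by rewrite component_fixed; apply/funext => t; rewrite setIC.
have NR := ED_norm (gED_restrict i GL).
split; [exact: (norm_sub NR)|exact: (norm0 NR)|exact: (normB NR)|exact: (norm_cont NR)|
  exact: (norm_anti NR)|exact: (norm_exh NR)|exact: (norm_sep NR)|].
exact: (ED_iota (gED_restrict i GL)).
Qed.

Variables (Ip Im : {set I}) (I_split : is_index_splitting sI Ip Im).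
Variables (D' : forall i, falgType (E i)) (D'_central : forall i, is_central_division (D' i)).
Variables (nuD' : forall i, D' i -> \bar R)
  (nuD'_ext : forall i, extends_valuation (@nuE i) (@nuD' i)).
Variables (varpi : forall i, D' i) (varpi_unif : forall i, is_uniformizer (@nuD' i) (varpi i)).
Variables (V' : forall i, vectType (D' i)^c) (theta : forall i, 'End(V' i) -> 'End(V)).
Hypothesis theta_iso : is_centralizer_iso iota theta.
Variables (rho' : forall i, D' i -> D' i) (eps' : forall i, D' i) (h' : forall i, V' i -> V' i -> D' i).
Hypothesis h'_form : forall i, i \in fixed_indices sI ->
  is_component_form theta sigma (@rho' i) (eps' i) (@h' i).

Let D'v i : is_cdv (@nuD' i) := falg_cdv (Ev i) (D'_central i).1 (nuD'_ext i).
Let D'2 i : @nuD' i 2%:R = 0%E. Proof. by rewrite (extends_valu_nat _ (nuD'_ext i)) E2. Qed.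
Local Notation norm' i := (@is_norm R (D' i)^c (@nuD' i) (V' i) (@ract (D' i) (V' i)) setT).

Lemma theta_image i : [set theta a | a in @setT 'End(V' i)] =
  [set a | [/\ (iota (1 : E i) \o a)%VF = a, (a \o iota (1 : E i))%VF = a &
               forall x : E i, (iota x \o a = a \o iota x)%VF]].
Proof. exact: (centralizer_iso_image theta_iso). Qed.

Lemma theta_centralizes i (a : 'End(V' i)) : [/\ (P i \o theta a)%VF = theta a,
  (theta a \o P i)%VF = theta a & forall x : E i, (iota x \o theta a = theta a \o iota x)%VF].
Proof.
have : [set theta b | b in @setT 'End(V' i)] (theta a) by exists a.
by rewrite theta_image.
Qed.

Lemma theta_onto i (f : 'End(V)) : (P i \o f)%VF = f -> (f \o P i)%VF = f ->
  (forall x : E i, (iota x \o f = f \o iota x)%VF) -> exists a : 'End(V' i), theta a = f.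
Proof.
move=> H1 H2 H3; have : [set theta b | b in @setT 'End(V' i)] f by rewrite theta_image.
by move=> [a _ <-]; exists a.
Qed.

Lemma component_data_exists i : exists r m q (c : 'I_r.+1 -> R),
  component_data nuD (@nuE i) (@nuD' i) (@iota i) (@theta i) m q c.
Proof.
apply: (component_structure k_local D_central D_index nuD_ext (nuE_ext i) (D'_central i) (nuD'_ext i)).
- exact: (field_productD E_prod).
- exact: (field_productM E_prod).
- exact: (field_productZ E_prod).
- exact: (field_product_inj E_prod).
- exact: (centralizer_isoD theta_iso).
- exact: (centralizer_isoM theta_iso).
- exact: (centralizer_iso1 theta_iso).
- exact: (centralizer_isoZ theta_iso).
- exact: (centralizer_iso_inj theta_iso).
- exact: theta_image.
Qed.

Lemma default_norm i : exists X, norm' i X.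
Proof. exact: (norm_exists (is_cdv_conv (D'v i)) (right_spaceT (V' i))). Qed.

Lemma ED_exists i : exists L, ED i L.
Proof.
have [r [m [q [c cd]]]] := component_data_exists i; have [X NX] := default_norm i.
by exists (transfer (@iota i) q c X); exact: (comp_transfer cd).
Qed.

(** Extending a norm from one component to V lets duality, established for norms on V, be applied
    componentwise. *)
Lemma ED_glue i L : ED i L -> exists2 L', is_gED L' & norm_on (P i) L' = L.
Proof. by have /choice[Ls ELs] := ED_exists; exact: ED_extend. Qed.

Lemma cdual_ED i L : ED (sI i) L -> ED i (cdual i L).
Proof.
move=> /ED_glue[L' GL' <-]; rewrite -restrict_dual //; apply: gED_restrict; exact: dual_gED.
Qed.

Lemma cdualK i L : ED i L -> cdual i (cdual (sI i) L) = L.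
Proof.
move=> /ED_glue[L' GL' <-]; rewrite -dual_restrict_sI // -restrict_dual; last exact: dual_gED.
by rewrite (dualK Dv D2 rho_inv h_herm sigma_adj (gED_norm GL')).
Qed.

Lemma sigma_centralizer i (a : 'End(V)) : sI i = i -> (forall x : E i, (iota x \o a = a \o iota x)%VF) ->
  forall x : E i, (iota x \o sigma a = sigma a \o iota x)%VF.
Proof.
move=> ii Ca x; have sM := sigmaM rho_inv h_herm sigma_adj; have sK := sigmaK rho_inv h_herm sigma_adj.
have [y xy _] := sigma_iota x; rewrite -[iota x]sK xy -!sM; congr sigma.
have : forall j (z : E j), j = i -> (iota z \o a = a \o iota z)%VF.
  by move=> j z ji; move: z; rewrite ji => z; exact: Ca.
by move=> -> //; rewrite ii.
Qed.

(** For i in I_0 the origin of the norm of S is the one from [dual_transfer], so that transport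
    commutes with duality. *)
Lemma transport_exists i : exists Tr Res,
  component_transport nuD (@nuE i) (@nuD' i) (@iota i) (@theta i) Tr Res /\
  (i \in fixed_indices sI -> forall X, norm' i X -> cdual i (Tr X) = Tr (dual (@nuD' i) (@h' i) X)).
Proof.
have [r [m [q [c cd]]]] := component_data_exists i.
have tid := theta_id (theta_image i); have tidr := theta_idr (theta_image i).
have [fi|nfi] := boolP (i \in fixed_indices sI); last first.
  by do 2!eexists; split; [exact: (component_dataP tid tidr cd)|].
have [inv' herm' adj'] := h'_form fi.
have ii : sI i = i by apply/eqP; move: fi; rewrite inE.
have V'0 : exists x : V' i, x != 0.
  pose j0 : 'I_(dim (V' i)) := Ordinal (dim_V'_gt0 (field_productD E_prod (i := i))
    (field_product_inj E_prod (i := i)) (centralizer_isoD theta_iso (i := i))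
    (centralizer_iso1 theta_iso i)).
  exists (@vgen (D' i) (V' i) j0); apply/eqP => v0; have := vcoord_gen j0 j0.
  by rewrite v0 /vcoord linear0 mxE eqxx => /esym/eqP; rewrite oner_eq0.
have st (a : 'End(V' i)) : exists a' : 'End(V' i), theta a' = sigma (theta a).
  have sM := sigmaM rho_inv h_herm sigma_adj; have [H1 H2 H3] := theta_centralizes a.
  apply: theta_onto => [||x]; last exact: (sigma_centralizer ii H3).
    by rewrite -[in RHS]H2 sM sI_sigma ii.
  by rewrite -[in RHS]H1 sM sI_sigma ii.
have cED L : ED i L -> ED i (cdual i L) by move=> EL; apply: cdual_ED; rewrite ii.
have [z zP] := dual_transfer Dv (D'v i) h_herm sigma_adj inv' herm' adj' st V'0 cED cd.
by do 2!eexists; split; [exact: (component_dataP tid tidr (component_shift z cd))|].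
Qed.

Lemma Im_sI i : i \in Im -> sI i \in Ip.
Proof. by rewrite -(index_splitting_swap I_split) => /imsetP[j jp ->]; rewrite sIK. Qed.

Lemma Ip_sI i : i \in Ip -> sI i \in Im.
Proof. by move=> ip; rewrite -(index_splitting_swap I_split); exact: imset_f. Qed.

Lemma Im_nfixed i : i \in Im -> i \notin fixed_indices sI.
Proof. by move=> im; rewrite -finset.in_setC (index_splittingU I_split) inE im orbT. Qed.

Lemma HIdx_Im i : (i \in fixed_indices sI :|: Ip)%SET = (i \notin Im).
Proof.
apply/idP/idP => [|im].
  rewrite inE => /orP[fi|ip]; first by apply: contraL fi; exact: Im_nfixed.
  by rewrite (disjointFr (index_splittingI I_split) ip).
rewrite inE; apply: contraT; rewrite negb_or => /andP[nf np].
by rewrite -finset.in_setC (index_splittingU I_split) inE (negPf np) (negPf im) in nf.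
Qed.

Lemma fixed_sI i : i \in fixed_indices sI -> sI i = i.
Proof. by rewrite inE => /eqP. Qed.

(** * The map j and its properties *)

Section Building.
Variables (Tr : forall i, (R -> set (V' i)) -> R -> set V) (Res : forall i, (R -> set V) -> R -> set (V' i)).
Hypothesis TrP : forall i,
  component_transport nuD (@nuE i) (@nuD' i) (@iota i) (@theta i) (@Tr i) (@Res i).
Hypothesis Tr_dual : forall i, i \in fixed_indices sI ->
  forall X, norm' i X -> cdual i (Tr X) = Tr (dual (@nuD' i) (@h' i) X).
Variable X0 : forall i, R -> set (V' i).
Hypothesis NX0 : forall i, norm' i (@X0 i).
Local Notation buildH := (building_H (R := R) sI Ip nuD' varpi h').
Implicit Types (x y z : buildH).

(** The default [X0] makes the family total on I; the component of j at an index of I_- is supplied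
    by [summand']. *)
Definition extend (x : buildH) (i : I) : R -> set (V' i) :=
  match boolP (i \in fixed_indices sI :|: Ip)%SET with
  | AltTrue Hi => sval (x (exist _ i Hi))
  | AltFalse _ => @X0 i
  end.

Arguments extend : clear implicits.

Lemma extendE x (i : HIdx sI Ip) : extend x (val i) = sval (x i).
Proof.
case: i => i Hi /=; rewrite /extend; case: {-}_ / boolP => [Hi'|]; last by rewrite Hi.
by rewrite (bool_irrelevance Hi' Hi).
Qed.

Lemma latt1_norm' i X : Latt1 (@nuD' i) (fine (nuD' (varpi i))) X <-> norm' i X.
Proof.
have piu' : @is_uniformizer R (D' i)^c (@nuD' i) (varpi i) by case: (varpi_unif i).
exact: iff_trans (is_lattice_function_conv _ _ _ _ _)
  (lattice_functionP (is_cdv_conv (D'v i)) (right_spaceT (V' i)) piu' X).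
Qed.

Lemma latt1_i_norm i X : Latt1_i sI nuD' varpi h' X <->
  norm' i X /\ (i \in fixed_indices sI -> dual (@nuD' i) (@h' i) X = X).
Proof.
rewrite /Latt1_i; case: ifP => fi; last first.
  by split=> [/latt1_norm' NX|[/latt1_norm']] //; split.
have [inv' herm' _] := h'_form fi.
have dE := dual_lattice_functionE (D'v i) inv' herm'.
split=> [[/latt1_norm' NX XX]|[NX /(_ isT) XX]].
  by split=> // _; rewrite -dE.
by split; [exact/latt1_norm'|rewrite dE].
Qed.

Lemma extend_norm x i : norm' i (extend x i).
Proof.
rewrite /extend; case: {-}_ / boolP => [Hi|_]; last exact: NX0.
by case: (x _) => X /= /latt1_i_norm[].
Qed.

Lemma extend_dual x i : i \in fixed_indices sI -> dual (@nuD' i) (@h' i) (extend x i) = extend x i.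
Proof.
move=> fi; have Hi : (i \in fixed_indices sI :|: Ip)%SET by rewrite inE fi.
rewrite (extendE x (exist _ i Hi)); case: (x _) => X /= /latt1_i_norm[_]; exact.
Qed.

Definition summand (x : buildH) (i : I) : R -> set V := Tr (extend x i).

(** On I_- self-duality forces the component to be the dual of the one at [sI i], which lies in
    I_+. *)
Definition summand' (x : buildH) (i : I) : R -> set V :=
  if i \in Im then cdual i (summand x (sI i)) else summand x i.

Definition jmap (x : buildH) : R -> set V := glue (summand' x).

Lemma summand_ED x i : ED i (summand x i).
Proof. by apply: (transport_ED (TrP i)); exact: extend_norm. Qed.

Lemma summand'_ED x i : ED i (summand' x i).
Proof.
rewrite /summand'; case: ifP => _; last exact: summand_ED.
by apply: cdual_ED; exact: summand_ED.
Qed.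

Lemma jmap_gED x : is_gED (jmap x).
Proof. by apply: glue_gED => i; exact: summand'_ED. Qed.

Lemma restrict_jmap x i : norm_on (P i) (jmap x) = summand' x i.
Proof. by apply: restrict_glue => l; exact: summand'_ED. Qed.

Lemma summand_dual x i : i \in fixed_indices sI -> cdual i (summand x i) = summand x i.
Proof. by move=> fi; rewrite /summand Tr_dual ?extend_dual //; exact: extend_norm. Qed.

(** Componentwise: on I_0 each transported norm is self-dual, on I_- the claim is the definition,
    and on I_+ it is biduality. *)
Lemma jmap_dual x : dual nuD h (jmap x) = jmap x.
Proof.
have GJ := jmap_gED x.
rewrite -(glue_restrict (dual_gED GJ)) -[RHS](glue_restrict GJ); congr glue; apply/funext => i.
rewrite restrict_dual // !restrict_jmap /summand'.
have [im|nim] := boolP (i \in Im).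
  suff /negPf-> : sI i \notin Im by [].
  by rewrite -HIdx_Im inE Im_sI ?orbT.
move: (nim); rewrite -HIdx_Im inE => /orP[fi|ip].
  by rewrite fixed_sI // (negPf nim) summand_dual.
by rewrite Ip_sI // sIK cdualK //; exact: summand_ED.
Qed.

Lemma jmap_latt x : Latt1_h nuD h (d%:R^-1) (jmap x).
Proof.
have NJ := gED_norm (jmap_gED x).
by split; [exact/latt1_norm|rewrite (dual_lattice_functionE Dv rho_inv h_herm NJ) jmap_dual].
Qed.

Definition jH (x : buildH) : building_G nuD h (d%:R^-1 : R) := exist _ (jmap x) (jmap_latt x).

Lemma summand_HIdx x (i : HIdx sI Ip) : norm_on (P (val i)) (jmap x) = Tr (sval (x i)).
Proof.
rewrite restrict_jmap /summand' ifN; last by rewrite -HIdx_Im; exact: valP.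
by rewrite /summand extendE.
Qed.

Lemma building_norm x (i : HIdx sI Ip) : norm' (val i) (sval (x i)).
Proof. by rewrite -extendE; exact: extend_norm. Qed.

Lemma jH_inj : injective jH.
Proof.
move=> x y /(congr1 sval) /= Jxy; apply: functional_extensionality_dep => i.
have : sval (x i) = sval (y i).
  rewrite -(transportK (TrP _) (building_norm x i)) -(transportK (TrP _) (building_norm y i)).
  by rewrite -!summand_HIdx Jxy.
by case: (x i) => X PX; case: (y i) => Y PY /= XY; exact: eq_exist.
Qed.

(** Self-duality recovers the parts of L on I_- from those on I_+. *)
Lemma jmap_unique x L : is_gED L -> dual nuD h L = L ->
  (forall i : HIdx sI Ip, norm_on (P (val i)) L = Tr (sval (x i))) -> jmap x = L.
Proof.
move=> GL LL HL; rewrite -(glue_restrict GL); congr glue; apply/funext => i.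
have HE l (Hl : (l \in fixed_indices sI :|: Ip)%SET) : summand x l = norm_on (P l) L.
  by rewrite -[l]/(val (exist _ l Hl : HIdx sI Ip)) HL /summand extendE.
rewrite /summand'; have [im|nim] := boolP (i \in Im); last by rewrite HE // HIdx_Im.
by rewrite HE -?restrict_dual ?LL // inE Im_sI // orbT.
Qed.

(** For i in I_0 the part of L on V_i is self-dual; as [Tr] commutes with duality and [Res] inverts
    it, the norm on V'_i is self-dual too. *)
Lemma res_latt L i : is_gED L -> dual nuD h L = L ->
  Latt1_i sI nuD' varpi h' (@Res i (norm_on (P i) L)).
Proof.
move=> GL LL; have EL := gED_restrict i GL; have NX := transport_res (TrP i) EL.
apply/latt1_i_norm; split=> // fi; have [inv' herm' _] := h'_form fi.
have ND := dual_norm (D'v i) (D'2 i) inv' herm' NX.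
rewrite -[LHS](transportK (TrP i)) // -Tr_dual // (transport_resK (TrP i)) //.
by have := restrict_dual i GL; rewrite fixed_sI // LL => <-.
Qed.

Lemma jH_image : [set sval (jH x) | x in setT] =
  [set L | Latt1_h nuD h (d%:R^-1) L /\ is_oE_oD_lattice_function iota nuD d (@nuE) e L].
Proof.
apply/seteqP; split=> [_ [x _ <-]|L [[/latt1_norm NL LL] /oE_oD_gED GL]].
  by split; [exact: jmap_latt|exact/oE_oD_gED/jmap_gED].
rewrite (dual_lattice_functionE Dv rho_inv h_herm NL) in LL.
exists (fun i => exist _ _ (res_latt (val i) GL LL)) => //.
apply: jmap_unique => // i /=; rewrite (transport_resK (TrP _)) //; exact: gED_restrict.
Qed.

Lemma pullback_gED L (f g : 'End(V)) : is_gED L -> (f \o g)%VF = \1%VF -> (g \o f)%VF = \1%VF ->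
  (forall i (x : E i), (iota x \o f = f \o iota x)%VF) -> is_gED (fun t => [set v | L t (f v)]).
Proof.
move=> GL fg gf fi; have NL := gED_norm GL.
split; first split=> //.
- by move=> t; rewrite /= linear0; exact: (norm0 NL).
- by move=> t x y; rewrite /= linearB; exact: (normB NL).
- by move=> t x _; exact: (norm_cont NL).
- by move=> s t x; exact: (norm_anti NL).
- by move=> x _; exact: (norm_exh NL).
- move=> x _ /(norm_sep NL (Logic.I : setT (f x)))/(congr1 g).
  by rewrite linear0 -comp_lfunE gf id_lfunE.
- move=> s t a x sa; rewrite /= -[@ract D V a x]/(ract (a : D) x) lfun_ract.
  exact: (norm_act NL).
- by move=> i s t x v sx; rewrite /= -comp_lfunE -fi comp_lfunE; exact: gED_iota.
Qed.

(** The translate of j(x) by g is again self-dual and compatible with E and D. Its components are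
    those of j(y), by [transport_op] with t = 0 for g_i and for its inverse, so [jmap_unique]
    applies. *)
Lemma jH_equivariant g x y : unitary_centralizer sigma beta g -> is_act_H iota theta g x y ->
  is_act_G g (jH x) (jH y).
Proof.
move=> [gg gb] act; have {}gg : (sigma g \o g)%VF = \1%VF by exact: gg.
have gg' := endo_left_inverse gg; set g' := sigma g in gg gg'.
have cg i (z : E i) : (g \o iota z = iota z \o g)%VF by apply: poly_alg_commute gb (iota_poly_alg z).
have cg' i (z : E i) : (iota z \o g' = g' \o iota z)%VF.
  apply/lfunP => v; rewrite !comp_lfunE -{2}[v]id_lfunE -gg' comp_lfunE -[iota z (g _)]comp_lfunE -cg.
  by rewrite comp_lfunE -[g' (g _)]comp_lfunE gg id_lfunE.
have g'K v : g (g' v) = v by rewrite -comp_lfunE gg' id_lfunE.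
have gK v : g' (g v) = v by rewrite -comp_lfunE gg id_lfunE.
pose L t := [set v | jmap x t (g' v)].
have GL : is_gED L by apply: pullback_gED (jmap_gED x) gg gg' cg'.
have hg' v w : h (g' v) (g' w) = h v w.
  by rewrite -(sigma_adjr rho_inv h_herm sigma_adj) g'K.
have LL : dual nuD h L = L.
  apply/funext => t; rewrite /L -[in RHS](jmap_dual x); apply/seteqP; split=> v H s w Lw.
    by rewrite -[w]gK hg'; apply: H; rewrite /= gK.
  by rewrite -hg'; exact: H.
have JL : jmap y = L.
  apply: jmap_unique => // i; have [gi giE yE] := act i.
  have [gi' gi'E] : exists gi' : 'End(V' (val i)), theta gi' = (P (val i) \o g')%VF.
    apply: theta_onto => [||z].
    - by apply/lfunP => v; rewrite !comp_lfunE idem_idem.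
    - by rewrite -comp_lfunA -[(g' \o _)%VF]cg'; apply/lfunP => v; rewrite !comp_lfunE idem_idem.
    - by apply/lfunP => v; rewrite !comp_lfunE iota_idem -[g' (iota z v)]comp_lfunE -cg' comp_lfunE idem_iota.
  have gi'gi : (gi' \o gi)%VF = \1%VF.
    apply: (centralizer_iso_inj theta_iso).
    rewrite (centralizer_isoM theta_iso) (centralizer_iso1 theta_iso) giE gi'E.
    apply/lfunP => v; rewrite !comp_lfunE -[g' (P _ _)]comp_lfunE -cg' comp_lfunE gK.
    by rewrite idem_idem.
  have gi'K u : gi' (gi u) = u by rewrite -comp_lfunE gi'gi id_lfunE.
  have Nx := building_norm x i; have Ny := building_norm y i.
  have xy s u : sval (x i) s u -> sval (y i) (s + 0) (gi u) by rewrite addr0 yE => xu; exists u.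
  have yx s u : sval (y i) s u -> sval (x i) (s + 0) (gi' u).
    by rewrite addr0 yE => -[w xw <-]; rewrite gi'K.
  have Txy := (transport_op (TrP _) gi 0 Nx Ny).1 xy.
  have Tyx := (transport_op (TrP _) gi' 0 Ny Nx).1 yx.
  have cP v : P (val i) (g' v) = g' (P (val i) v) by rewrite -!comp_lfunE cg'.
  have xP t v : P (val i) v = v -> Tr (sval (x i)) t (g' v) <-> jmap x t (g' v).
    by move=> Pv; rewrite -summand_HIdx; split=> [[]|Jv] //; split=> //; rewrite cP Pv.
  apply/funext => t; apply/seteqP; split=> v.
    move=> [Pv /(xP _ _ Pv)/Txy]; rewrite addr0 giE comp_lfunE g'K Pv; exact.
  move=> Yv; have Pv : P (val i) v = v.
    by have := Yv; rewrite -summand_HIdx => -[].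
  split=> //; apply/(xP t v Pv); have := Tyx _ _ Yv.
  by rewrite addr0 gi'E comp_lfunE cP Pv.
move=> t /=; rewrite JL; apply/seteqP; split=> v.
  by move=> Lv; exists (g' v); [exact: Lv|exact: g'K].
by move=> [w Jw <-]; rewrite /L /= gK.
Qed.

Lemma sigma_theta_idem l (a : 'End(V' l)) w : sigma (theta a) w = sigma (theta a) (P (sI l) w).
Proof.
have [H _ _] := theta_centralizes a.
by rewrite -{1}H (sigmaM rho_inv h_herm sigma_adj) sI_sigma comp_lfunE.
Qed.

Lemma theta_idem l (a : 'End(V' l)) w : theta a w = theta a (P l w).
Proof. by have [_ H _] := theta_centralizes a; rewrite -{1}H comp_lfunE. Qed.

Lemma idem_theta l (a : 'End(V' l)) w : P l (theta a w) = theta a w.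
Proof. by have [H _ _] := theta_centralizes a; rewrite -comp_lfunE H. Qed.

Lemma HIdx_swap (l i : HIdx sI Ip) : val l \notin fixed_indices sI -> sI (val l) != val i.
Proof.
move=> nl; apply: contraTneq (valP i) => <-; rewrite HIdx_Im negbK.
by apply: Ip_sI; have := valP l; rewrite inE (negPf nl).
Qed.

(** The blocks do not interfere: for l in I_+ the term sigma(theta(a_l)) acts on the component at
    [sI l], which lies in I_-. *)
Lemma embed_component (a : forall i : HIdx sI Ip, 'End(V' (val i))) i v :
  P (val i) (lie_H_embed theta sigma a (P (val i) v)) = theta (a i) v.
Proof.
have st l : val l \notin fixed_indices sI -> sigma (theta (a l)) (P (val i) v) = 0.
  by move=> nl; rewrite sigma_theta_idem idem_orth ?linear0 // HIdx_swap.
rewrite /lie_H_embed sum_lfunE (bigD1 i) //= big1 ?addr0 => [|l li].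
  case: ifPn => ni; first by rewrite -theta_idem idem_theta.
  by rewrite add_lfunE opp_lfunE st // subr0 -theta_idem idem_theta.
have tl : theta (a l) (P (val i) v) = 0.
  by rewrite theta_idem idem_orth ?linear0 // (inj_eq val_inj).
by case: ifPn => nl //; rewrite add_lfunE opp_lfunE st // tl subrr.
Qed.

Lemma embed_lie (a : forall i : HIdx sI Ip, 'End(V' (val i))) :
  (forall i, lie_Hi theta sigma sI (a i)) -> unitary_lie sigma (lie_H_embed theta sigma a).
Proof.
move=> Ha; rewrite /unitary_lie /= (sigma_sum rho_inv h_herm sigma_adj) -sumrN.
apply: eq_bigr => i _; have := Ha i; rewrite /lie_Hi; case: ifP => [_ -> //|_ _].
rewrite (sigmaD rho_inv h_herm sigma_adj) (sigmaN rho_inv h_herm sigma_adj).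
by rewrite (sigmaK rho_inv h_herm sigma_adj) opprB addrC.
Qed.

(** If the a_i raise values by t, so do the theta(a_i) and, the norm being self-dual, their images
    under sigma. Conversely the idempotents, which do not lower values, cut the blocks theta(a_i)
    out of the embedded element. *)
Lemma jH_CLF x t : lie_H_filtration theta sigma x t =
  lie_H theta sigma sI Ip `&` lie_filtration sigma (sval (jH x)) t.
Proof.
have GJ := jmap_gED x; have NJ := gED_norm GJ.
have memJ (i : HIdx sI Ip) s v : Tr (sval (x i)) s v <-> P (val i) v = v /\ jmap x s v.
  by rewrite -summand_HIdx.
apply/seteqP; split=> [_ [a Ha <-]|_ [[a Ha <-] [sq _]]].
  have La i : lie_Hi theta sigma sI (a i) by have [] := Ha i.
  split; first by exists a.
  split; last exact: embed_lie.
  have ta i s v : jmap x s v -> jmap x (s + t) (theta (a i) v).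
    move=> Jv; have [sq _] := Ha i.
    have op : forall s u, sval (x i) s u -> sval (x i) (s + t) (a i u).
      by move=> s' u xu; apply: (sq s'); exists u.
    have T := (transport_op (TrP _) (a i) t (building_norm x i) (building_norm x i)).1 op.
    have /T/memJ[_] : Tr (sval (x i)) s (P (val i) v).
      by apply/memJ; split; [exact: idem_idem|exact: gED_idem GJ Jv].
    by rewrite -theta_idem.
  move=> s _ [v Jv <-]; rewrite -[sval _]/(jmap x) /lie_H_embed sum_lfunE.
  apply: (norm_sum NJ) => i _.
  case: ifP => _; first exact: ta.
  rewrite add_lfunE opp_lfunE; apply: (normB NJ); first exact: ta.
  rewrite -(jmap_dual x); apply: (square_dual rho_inv h_herm sigma_adj (ta i)).
  by rewrite jmap_dual.
exists a => // i; split; last exact: Ha.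
have op : forall s v, Tr (sval (x i)) s v -> Tr (sval (x i)) (s + t) (theta (a i) v).
  move=> s v /memJ[Pv Jv]; apply/memJ; rewrite idem_theta; split=> //.
  rewrite -embed_component Pv; apply: (gED_idem (L := jmap x)) => //.
  by apply: (sq s); exists v.
move=> s _ [u xu <-].
exact: (transport_op (TrP _) (a i) t (building_norm x i) (building_norm x i)).2 op s u xu.
Qed.

Local Notation orth W L b c := (@orth_basis R D^c nuD V (@ract D V) W L _ b c).

(* Through theta, the lines of a common splitting basis of V'_i give a common splitting *)
(* of V_i on whose pieces the norms differ by constants.                                 *)
Lemma component_affine (i : HIdx sI Ip) lam x y z :
  is_convex_comb lam (sval (x i)) (sval (y i)) (sval (z i)) ->
  exists (K : finType) (b : K -> V) (c1 c2 : K -> R),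
  [/\ orth (fixed_space (P (val i))) (norm_on (P (val i)) (jmap x)) b c1,
      orth (fixed_space (P (val i))) (norm_on (P (val i)) (jmap y)) b c2 &
      orth (fixed_space (P (val i))) (norm_on (P (val i)) (jmap z)) b
        (fun j => lam * c1 j + (1 - lam) * c2 j)].
Proof.
have Nx := building_norm x i; have Ny := building_norm y i; have Nz := building_norm z i.
move=> /(convex_comb_orth (D'v (val i)) Nx Ny Nz)[n [b' [c1 [c2 [bx by_ bz]]]]].
pose c3 j := lam * c1 j + (1 - lam) * c2 j.
have S' := right_spaceT (V' (val i)); have D'c := is_cdv_conv (D'v (val i)).
have [f [pr [prE prsum pro]]] := orth_projectors (D'v (val i)) Nx bx.
pose Q l := theta (pr l).
have PQ l v : Q l v = v -> P (val i) v = v by move=> <-; rewrite idem_theta.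
have ee l l' : (pr l \o pr l')%VF = if l == l' then pr l' else 0.
  by apply/lfunP => u; rewrite comp_lfunE pro; case: eqP => //; rewrite zero_lfunE.
have th0 : theta (0 : 'End(V' (val i))) = 0.
  by apply: (addIr (theta (0 : 'End(V' (val i))))); rewrite -(centralizer_isoD theta_iso) !add0r.
have QQ l l' v : Q l (Q l' v) = if l == l' then Q l' v else 0.
  rewrite -comp_lfunE -(centralizer_isoM theta_iso) ee; case: eqP => // _.
  by rewrite th0 zero_lfunE.
have Qs v : P (val i) v = \sum_l Q l v.
  rewrite -sum_lfunE -(big_morph _ (centralizer_isoD theta_iso (i := val i)) th0).
  rewrite -(centralizer_iso1 theta_iso); congr (theta _ v); apply/lfunP => u.
  by rewrite id_lfunE sum_lfunE; exact: prsum.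
pose split_basis (w : buildH) (c : 'I_n -> R) := @orth_basis R (D' (val i))^c (@nuD' (val i))
  (V' (val i)) (@ract (D' (val i)) (V' (val i))) setT (sval (w i)) _ b' c.
have agree w w' c c' l t v : split_basis w c -> split_basis w' c' ->
    norm_on (Q l) (jmap w) t v <-> norm_on (Q l) (jmap w') (t + (c' l - c l)) v.
  move=> bw bw'.
  have op s u : sval (w i) s (pr l u) <-> sval (w' i) (s + (c' l - c l)) (pr l u).
    rewrite prE; apply: iff_trans (orth1 D'c S' bw _ _ _) _.
    apply: iff_trans (iff_sym (orth1 D'c S' bw' _ _ _)).
    by have -> : s + (c' l - c l) - c' l = s - c l by ring.
  have T := transport_agree (TrP (val i)) op.
  have JT w0 s : Q l v = v -> Tr (sval (w0 i)) s (Q l v) <-> jmap w0 s v.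
    move=> Qv; rewrite Qv -summand_HIdx; split=> [[]//|Jv]; split=> //; exact: PQ Qv.
  split=> -[Qv Jv]; split=> //.
    by apply/(JT w' _ Qv)/T/JT.
  by apply/(JT w _ Qv)/T/JT.
have contr w c l t v : split_basis w c ->
    jmap w t v -> jmap w t (Q l v).
  move=> bw Jv; have op s u : sval (w i) s u -> sval (w i) (s + 0) (pr l u).
    rewrite addr0 {1}(prsum u); under eq_bigr do rewrite prE.
    by move=> /(orthP bw) H; rewrite prE; apply/(orth1 D'c S' bw).
  have Nw := building_norm w i; have T := (transport_op (TrP _) (pr l) 0 Nw Nw).1 op.
  have /T : Tr (sval (w i)) t (P (val i) v).
    by rewrite -summand_HIdx; split; [exact: idem_idem|exact: gED_idem (jmap_gED w) Jv].
  by rewrite addr0 -theta_idem -summand_HIdx => -[].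
have /choice[p pP] l : exists p : {n : nat & (('I_n -> V) * ('I_n -> R))%type},
    orth (fixed_space (Q l)) (norm_on (Q l) (jmap x)) (tagged p).1 (tagged p).2.
  have Ql v : Q l (Q l v) = Q l v by rewrite QQ eqxx.
  have [m [b [c bl]]] := orth_basis_exists (right_space (P := Q l) (fun v => iff_refl _) Ql)
    (norm_on_norm (fun _ _ => Logic.I) (gED_norm (jmap_gED x))) (is_cdv_conv Dv).
  by exists (Tagged (fun n => (('I_n -> V) * ('I_n -> R))%type) (b, c)).
(* On the image of [Q l] the norms of w and x differ by the constant c l - c1 l, so a basis
   orthogonal for x is orthogonal for w with values shifted by it. *)
pose cc (c : 'I_n -> R) (q : {l : 'I_n & 'I_(tag (p l))}) : R :=
  (tagged (p (tag q))).2 (tagged q) + (c (tag q) - c1 (tag q)).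
have GL w (c : 'I_n -> R) : split_basis w c ->
    orth (fixed_space (P (val i))) (norm_on (P (val i)) (jmap w))
      (fun q : {l : 'I_n & 'I_(tag (p l))} => (tagged (p (tag q))).1 (tagged q))
      (cc c).
  move=> bw; apply: (orth_glue (Q := Q) (W := setT) (K := fun l => 'I_(tag (p l)))
    (b := fun l => (tagged (p l)).1) (c := fun l j => (tagged (p l)).2 j + (c l - c1 l))) => //.
  - exact: gED_norm (jmap_gED w).
  - by move=> l v; rewrite QQ eqxx.
  - by move=> l l' v /negPf ll'; rewrite QQ ll'.
  - by move=> l t v; exact: (contr w c l t v bw).
  - by move=> l; apply: orth_shift (pP l) => t v; exact: agree.
have ccE : (fun q => lam * cc c1 q + (1 - lam) * cc c2 q) = cc c3.
  by apply/funext => q; rewrite /cc /c3; ring.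
exists {l : 'I_n & 'I_(tag (p l))}, (fun q => (tagged (p (tag q))).1 (tagged q)), (cc c1), (cc c2).
by rewrite ccE; split; [exact: GL bx|exact: GL by_|exact: GL bz].
Qed.

(** The dual basis depends on b alone, so one y serves all norms for which b is orthogonal; each
    value is negated. *)
Lemma component_dual_basis i L (K : finType) (b : K -> V) c : is_gED L ->
  orth (fixed_space (P (sI i))) (norm_on (P (sI i)) L) b c ->
  exists y : K -> V, forall L' c', is_gED L' ->
    orth (fixed_space (P (sI i))) (norm_on (P (sI i)) L') b c' ->
    orth (fixed_space (P i)) (norm_on (P i) (dual nuD h L')) y (fun j => - c' j).
Proof.
move=> GL bL; set P' := P (sI i) in bL *.
have P'P' v : P' (P' v) = P' v by exact: idem_idem.
have S : is_space (A := D^c) (@ract D V) (fixed_space P') := right_space (fun v => iff_refl _) P'P'.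
have NL : @is_norm R D^c nuD V (@ract D V) (fixed_space P') (norm_on P' L).
  exact: (norm_on_norm (fun _ _ => Logic.I) (gED_norm GL)).
have ib := orth_independent (is_cdv_conv Dv) NL bL.
have [f fP] := independent_coord (orth_span bL).
have fE (a : K -> D) j : f j (\sum_l ract (a l) (b l)) = a j.
  exact: (coord_sum S ib fP (orth_in bL)).
have fT v : P' v = \sum_l ract (f l (P' v) : D) (b l) by exact: fP.
have fb l l' : f l (b l') = (l == l')%:R.
  have -> : b l' = \sum_j ract ((j == l')%:R : D) (b j).
    rewrite (bigD1 l') //= eqxx ract1 big1 ?addr0 // => j /negPf->.
    by rewrite ract0l.
  by rewrite fE.
have /choice[y yP] l : exists y0 : V, forall v, h y0 v = f l (P' v).
  apply: (riesz Dv rho_inv h_herm sigma_adj (f := fun v => f l (P' v))) => [v w|a v].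
    rewrite [P' _]linearD /= {1}(fT v) {1}(fT w) -big_split /=.
    by under eq_bigr do rewrite -ractDl; rewrite fE.
  rewrite lfun_ract {1}(fT v) ract_sumr; under eq_bigr do rewrite -ractM.
  by rewrite fE.
have hl v w : (forall u, h v u = h w u) -> v = w.
  move=> H; apply/eqP; rewrite -subr_eq0; apply/eqP/(hermitian_nondeg h_herm) => u.
  by rewrite (hermBl h_herm) H subrr.
have yin l : P i (y l) = y l by apply: hl => u; rewrite herm_idem !yP P'P'.
have hy (a : K -> D) v : h (\sum_l ract (a l) (y l)) v = \sum_l rho (a l) * f l (P' v).
  rewrite (herm_suml h_herm); apply: eq_bigr => l _.
  by rewrite (hermZl rho_inv h_herm) yP.
exists y => L' c' GL' bL'; have rv := involution_valu Dv D2 rho_inv.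
split=> [|v Pv|t a]; first exact: yin.
  exists (fun l => rho (h v (b l)) : D); apply: hl => u.
  rewrite [RHS]hy -Pv herm_idem -/P' {1}(fT u) (herm_sumr h_herm); apply: eq_bigr => l _.
  by rewrite (hermZr rho_inv h_herm) (involutionK rho_inv) Pv.
rewrite -[X in norm_on _ _ _ X]/(\sum_l ract (a l : D) (y l)).
split=> [[_ H] j|H].
  have bP : P' (b j) = b j := orth_in bL j.
  have Lb : norm_on P' L' (c' j) (b j) by apply/(orth1_gen (is_cdv_conv Dv) S bL').
  have := H _ _ Lb.2; rewrite hy (bigD1 j) //= big1 ?addr0 => [|l /negPf lj].
    by rewrite bP fb eqxx mulr1 rv opprK.
  by rewrite bP fb lj mulr0.
split; first by rewrite linear_sum; apply: eq_bigr => l _ /=; rewrite lfun_ract yin.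
move=> s w Lw; rewrite hy; apply: (valu_sum_ge vD) => l _.
have : norm_on P' L' s (P' w) by split=> //; exact: (gED_idem _ GL' Lw).
rewrite {1}fT => /(orthP bL')/(_ l) Hl.
have -> : t + s = (t + c' l) + (s - c' l) by ring.
by apply: (valuM_ge vD); [rewrite rv; have := H l; rewrite opprK|exact: Hl].
Qed.

(** The three norms get a common orthogonal basis on every component: from [component_affine] on I_0
    and I_+, and from its dual basis on I_-, where negating the values preserves the convex
    combination. The bases are then glued over I. *)
Lemma jH_affine lam x y z : is_convex_comb_H lam x y z ->
  is_convex_comb lam (sval (jH x)) (sval (jH y)) (sval (jH z)).
Proof.
move=> xyz; pose T := {K : finType & ((K -> V) * (K -> R) * (K -> R))%type}.
have /choice[p pP] i : exists p : T,
    [/\ orth (fixed_space (P i)) (norm_on (P i) (jmap x)) (tagged p).1.1 (tagged p).1.2,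
        orth (fixed_space (P i)) (norm_on (P i) (jmap y)) (tagged p).1.1 (tagged p).2 &
        orth (fixed_space (P i)) (norm_on (P i) (jmap z)) (tagged p).1.1
          (fun j => lam * (tagged p).1.2 j + (1 - lam) * (tagged p).2 j)].
  have HE l : (l \in fixed_indices sI :|: Ip)%SET -> exists (K : finType) (b : K -> V) (c1 c2 : K -> R),
      [/\ orth (fixed_space (P l)) (norm_on (P l) (jmap x)) b c1,
          orth (fixed_space (P l)) (norm_on (P l) (jmap y)) b c2 &
          orth (fixed_space (P l)) (norm_on (P l) (jmap z)) b (fun j => lam * c1 j + (1 - lam) * c2 j)].
    by move=> Hl; exact: (component_affine (xyz (exist _ l Hl))).
  have [im|nim] := boolP (i \in Im); last first.
    have [K [b [c1 [c2 H]]]] := HE i (ltac:(by rewrite HIdx_Im)).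
    by exists (Tagged (fun K : finType => ((K -> V) * (K -> R) * (K -> R))%type) (b, c1, c2)).
  have [|K [b [c1 [c2 [bx by_ bz]]]]] := HE (sI i); first by rewrite inE Im_sI // orbT.
  have [b' b'P] := component_dual_basis (jmap_gED x) bx.
  exists (Tagged (fun K : finType => ((K -> V) * (K -> R) * (K -> R))%type)
    (b', fun j => - c1 j, fun j => - c2 j)) => /=.
  have cE : (fun j => lam * - c1 j + (1 - lam) * - c2 j) = (fun j => - (lam * c1 j + (1 - lam) * c2 j)).
    by apply/funext => j; ring.
  have bx' := b'P _ _ (jmap_gED x) bx; have by' := b'P _ _ (jmap_gED y) by_.
  have bz' := b'P _ _ (jmap_gED z) bz.
  by rewrite !jmap_dual in bx' by' bz'; rewrite cE.
have glueO w (c : forall i, tag (p i) -> R) :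
    (forall i, orth (fixed_space (P i)) (norm_on (P i) (jmap w)) (tagged (p i)).1.1 (c i)) ->
    orth setT (jmap w) (fun q : {i : I & tag (p i)} => (tagged (p (tag q))).1.1 (tagged q))
      (fun q => c (tag q) (tagged q)).
  move=> bw; apply: orth_fixed1.
  apply: (orth_glue (Q := fun i => P i) (W := setT) (K := fun i => tag (p i))
    (b := fun i => (tagged (p i)).1.1) (c := c)) => //.
  - exact: gED_norm (jmap_gED w).
  - by move=> i v; exact: idem_idem.
  - by move=> i j v; exact: idem_orth.
  - by move=> v; rewrite id_lfunE; exact: idem_sum.
  - by move=> i t v; exact: gED_idem (jmap_gED w).
have Nw w : norm (jmap w) by exact: gED_norm (jmap_gED w).
have [bx by_ bz] : [/\ forall i, _, forall i, _ & forall i, _] :=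
  And3 (fun i => let: And3 H _ _ := pP i in H) (fun i => let: And3 _ H _ := pP i in H)
    (fun i => let: And3 _ _ H := pP i in H).
have bx' := orth_reindex (glueO _ _ bx); have by' := orth_reindex (glueO _ _ by_).
have bz' := orth_reindex (glueO _ _ bz).
exact: (orth_convex_comb Dv (Nw x) (Nw y) (Nw z) bx' by' bz').
Qed.

End Building.

Lemma embedding_exists :
  exists j : building_H sI Ip nuD' varpi h' -> building_G nuD h (d%:R^-1 : R),
  [/\ injective j,
      forall (lam : R) x y z, is_convex_comb_H lam x y z ->
        is_convex_comb lam (sval (j x)) (sval (j y)) (sval (j z)),
      forall g x y, unitary_centralizer sigma beta g ->
        is_act_H iota theta g x y -> is_act_G g (j x) (j y),
      forall x t, lie_H_filtration theta sigma x t =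
        lie_H theta sigma sI Ip `&` lie_filtration sigma (sval (j x)) t
    & [set sval (j x) | x in setT] =
      [set L | Latt1_h nuD h (d%:R^-1) L /\
               is_oE_oD_lattice_function iota nuD d (@nuE) e L]].
Proof.
pose Tr i := projT1 (cid (transport_exists i)).
have TrE i := projT2 (cid (transport_exists i)).
pose Res i := projT1 (cid (TrE i)); have TrP i := projT2 (cid (TrE i)).
pose X0 i := projT1 (cid (default_norm i)); have NX0 i := projT2 (cid (default_norm i)).
pose T1 i := (TrP i).1; pose T2 i := (TrP i).2.
exists (jH T1 T2 NX0); split.
- exact: jH_inj.
- exact: jH_affine.
- exact: jH_equivariant.
- exact: jH_CLF.
- exact: jH_image.
Qed.

End Global.
Theorem theorem7p2
  (R : realType)
  (* the local field k and the division algebra D of index d *)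
  (k : fieldType) (nu : k -> \bar R)
  (k_local : is_local_field nu) (k_odd : odd_residue_char nu)
  (D : falgType k) (d : nat) (nuD : D -> \bar R)
  (D_central : is_central_division D) (D_index : \dim {:D} = (d ^ 2)%N)
  (nuD_ext : extends_valuation nu nuD)
  (rho : D -> D) (rho_inv : is_involution rho)
  (* the hermitian space and its adjoint involution *)
  (V : vectType D^c) (eps : D) (h : V -> V -> D)
  (h_herm : is_nondeg_hermitian rho eps h)
  (sigma : 'End(V) -> 'End(V)) (sigma_adj : is_adjoint_involution h sigma)
  (* beta and the decomposition of E = k[beta] *)
  (beta : 'End(V)) (beta_lie : unitary_lie sigma beta)
  (I : finType) (E : I -> fieldExtType k) (iota : forall i, E i -> 'End(V))
  (E_prod : is_field_product iota beta)
  (nuE : forall i, E i -> \bar R)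
  (nuE_ext : forall i, extends_valuation nu (nuE i))
  (e : I -> nat) (e_ram : forall i, is_ramification_index (nuE i) (e i))
  (sI : I -> I) (sI_sigma : forall i, sigma (idem iota i) = idem iota (sI i))
  (Ip Im : {set I}) (I_split : is_index_splitting sI Ip Im)
  (* the centralizers End_{D'_i}(V'_i) of the E_i *)
  (D' : forall i, falgType (E i)) (D'_central : forall i, is_central_division (D' i))
  (nuD' : forall i, D' i -> \bar R)
  (nuD'_ext : forall i, extends_valuation (nuE i) (nuD' i))
  (varpi : forall i, D' i) (varpi_unif : forall i, is_uniformizer (nuD' i) (varpi i))
  (V' : forall i, vectType (D' i)^c)
  (theta : forall i, 'End(V' i) -> 'End(V))
  (theta_iso : is_centralizer_iso iota theta)
  (* the signed hermitian forms h'_i for i in I_0 *)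
  (rho' : forall i, D' i -> D' i) (eps' : forall i, D' i)
  (h' : forall i, V' i -> V' i -> D' i)
  (h'_form : forall i, i \in fixed_indices sI ->
     is_component_form theta sigma (rho' i) (eps' i) (h' i)) :
  exists j : building_H sI Ip nuD' varpi h' -> building_G nuD h (d%:R^-1 : R),
  [/\ injective j,
      (* affine *)
      forall (lam : R) x y z, 0 <= lam -> lam <= 1 ->
        is_convex_comb_H lam x y z ->
        is_convex_comb lam (sval (j x)) (sval (j y)) (sval (j z)),
      (* H-equivariant *)
      forall g x y, unitary_centralizer sigma beta g ->
        is_act_H iota theta g x y -> is_act_G g (j x) (j y),
      (* CLF *)
      forall x t, lie_H_filtration theta sigma x t =
        lie_H theta sigma sI Ip `&` lie_filtration sigma (sval (j x)) t
    & (* image *)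
      [set sval (j x) | x in setT] =
      [set L | Latt1_h nuD h (d%:R^-1) L /\
               is_oE_oD_lattice_function iota nuD d nuE e L]].
Proof.
have [j [j1 j2 j3 j4 j5]] := embedding_exists k_local k_odd D_central D_index nuD_ext rho_inv h_herm
  sigma_adj beta_lie E_prod nuE_ext sI_sigma e_ram I_split D'_central nuD'_ext varpi_unif theta_iso h'_form.
by exists j; split=> // lam x y z _ _; exact: j2.
Qed.
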